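(* Let $\rho>0$. The following statements hold for the space $Z_\rho$ (constructed in the context, part B) and for its dual $Z_\rho^*$, over either scalar field $\mathbb K\in\{\mathbb R,\mathbb C\}$. Over $\mathbb R$, they also hold for the spaces $QX$ and $(I_X-Q)X$ (constructed in the context, part C) and for their duals. (i) Each space admits a conditional (i.e. not unconditional) Schauder basis which is shrinking and boundedly complete. (ii) These bases can be chosen to be asymptotically monotone.
   Context: A basis $(b_i)_{i\in\mathbb N}$ with coordinate functionals $(b_i^* )$ is asymptotically monotone if $\lim_{m\to\infty}\lVert\sum_{i=1}^m b_i\otimes b_i^*\rVert=1$, where $(x\otimes f)(y)=f(y)x$. It is $C$-unconditional if $\lVert\sum_i\theta_ib_i\otimes b_i^*\rVert\le C$ for all finitely supported scalars with $|\theta_i|\le1$, and unconditional if this holds for some $C$. $(\bigoplus_jE_j)_2$ is the $\ell_2$-sum, and a diagonal operator acts coordinatewise on such sums. Subspaces carry inherited norms. **Part A (tensor spaces).** Let $\mathbb K\in\{\mathbb R,\mathbb C\}$; inner products are linear in the first variable. If $\mathbb K=\mathbb R$, $\Omega=\mathbb R/2\pi\mathbb Z$ with normalised Haar measure and $w(t)=\sqrt2(\cos t,\sin t)$. If $\mathbb K=\mathbb C$, $\Omega$ is the unit sphere of $\mathbb C^2$ with its invariant probability measure and $w(t)=\sqrt2\,t$. Let $\mathcal H_n=(\mathbb K^2)^{\otimes n}$ (Hilbert tensor product, norm $|\cdot|_2$), $q_n=2^n$, $W(t)=\bigotimes_{s=1}^nw(t_s)$ for $t\in\Omega^n$. For $2<p\le3$,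 $E(n,p)$ is $\mathcal H_n$ with norm $\lVert x\rVert=\lVert f_x\rVert_{L_p(\Omega^n)}$, $f_x(t)=\langle x,W(t)\rangle$. For $r>0$ put $\alpha_r=(\mathbb E|w_1|^r)^{1/r}$ ($w_1$ the first coordinate of $w(t)$, $t$ uniform in $\Omega$), $p'=p/(p-1)$, $c_p=\alpha_p\alpha_{p'}$. Put $\tau=5/4$ if $\mathbb K=\mathbb R$, $\tau=10/9$ if $\mathbb K=\mathbb C$; $p(n)=2+n^{-3/4}$; $\Lambda(n)=\alpha_{p(n)}^n\tau^{-n(p(n)-2)/(2p(n))}$. A space $V$ is $D$-Hilbertian if it has a Hilbert norm $|\cdot|_H$ with $|x|_H\le\lVert x\rVert\le D|x|_H$. For a linear map $T$, $\gamma_2(T)=\inf\lVert A\rVert\lVert B\rVert$ over factorisations $T=BA$ through a Hilbert space. A normalised Gaussian vector $\zeta$ in $\mathcal H_n$ is $q_n^{-1/2}\sum_ig_ie_i$ with $(e_i)$ orthonormal and $(g_i)$ independent standard (real or complex, $\mathbb E|g_i|^2=1$) Gaussians. For a finite-dimensional Hilbert space $H$, $E(n,p)\oplus_2H$ has norm $(\lVert x\rVert^2+|h|^2)^{1/2}$; for a subspace $F$ of it, $\theta(F)=q_n^{-1}\operatorname{tr}(\iota^*R_F\iota)$, with $R_F$ the orthogonal projection onto $F$ in the Hilbert space $\mathcal H_n\oplus_2H$ and $\iota:\mathcal H_n\to\mathcal H_n\oplus_2H$ the inclusion. Call $n$ admissible if, with $E=E(n,p(n))$: $\mathbb E\lVert\zeta\rVert_E^2\le4$;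 $|\operatorname{tr}T|/q_n\le2\alpha_{p(n)}^{-n}\gamma_2(T)$ for every operator $T$ on $E$; and $\theta(F)\le80C^3/\Lambda(n)$ whenever $C\ge1$, $H$ is a finite-dimensional Hilbert space and $F\subseteq E\oplus_2H$ has $\dim F\le3q_n$ and a $C$-unconditional basis. All sufficiently large $n$ are admissible. For $k\ge1$, $D>1$ fix $\varepsilon(k,D)>0$ such that whenever $X_\alpha$ ($\alpha\in A\neq\emptyset$) are closed subspaces of $L_{r_\alpha}$ spaces with $r_\alpha\in[2,2+\varepsilon(k,D)]$, every subspace of dimension at most $k$ of every quotient of $(\bigoplus_\alpha X_\alpha)_2$ is $D$-Hilbertian (such $\varepsilon(k,D)$ exist). Given a strictly increasing sequence $(n_j)$ of admissible integers write $p_j=p(n_j)$, $E_j=E(n_j,p_j)$, $q_j=2^{n_j}$, $\Lambda_j=\Lambda(n_j)$. Real sampling maps: for $\mathbb K=\mathbb R$ and $n\ge1$ let $M=1000n^2$, $\vartheta_r=2\pi r/M$, let $U_n$ be the real functions on $\{0,\dots,M-1\}^n$ with the $L_{p(n)}$ norm for normalised counting measure, and define $A_n:E(n,p(n))\to U_n$, $B_n:U_n\to E(n,p(n))$ by $(A_nx)_r=f_x(\vartheta_{r_1},\dots,\vartheta_{r_n})$ and $B_nz=M^{-n}\sum_rz_rW(\vartheta_{r_1},\dots,\vartheta_{r_n})$. Then $B_nA_n=I$. **Part B (the space $Z_\rho$).** Put $D_1=2$ and $D_j=\max\{2,\alpha_{p_{j-1}}^{n_{j-1}}\}$ for $j\ge2$.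 Choose recursively admissible $n_1<n_2<\cdots$ with $\Lambda_j\ge D_j^8$ and $p_j-2\le\varepsilon(3q_i,2)$ for $1\le i<j$, and such that there are uniformly bounded operators $\mathcal A_j:E_j\to\mathcal U_j$, $\mathcal B_j:\mathcal U_j\to E_j$, $\mathcal U_j=\ell_{p_j}^{N_j}(\mathbb K)$, with $\mathcal B_j\mathcal A_j=I_{E_j}$ and $\lVert\mathcal A_j\mathcal B_j\rVert\le1+\rho/2$, as follows. Over $\mathbb R$, $\mathcal A_j=A_{n_j}$, $\mathcal B_j=B_{n_j}$, with $U_{n_j}$ identified isometrically with $\ell_{p_j}^{N_j}$ ($N_j=(1000n_j^2)^{n_j}$) by rescaling coordinates. Over $\mathbb C$, one takes $\delta_j\in(0,1)$, $\delta_j\to0$, with $c_{p_j}^{n_j}/(1-\delta_j)\le1+\rho/2$, and $\lVert\mathcal A_j\rVert\le1$, $\lVert\mathcal B_j\rVert\le c_{p_j}^{n_j}/(1-\delta_j)$ (such maps exist for suitable $N_j$). Let $Y=(\bigoplus_jE_j)_2$, $X_\rho=(\bigoplus_j\mathcal U_j)_2$, let $\mathcal A:Y\to X_\rho$, $\mathcal B:X_\rho\to Y$ be the diagonal operators with entries $\mathcal A_j$, $\mathcal B_j$, $P_\rho=\mathcal A\mathcal B$, and $Z_\rho=P_\rho(X_\rho)=\mathcal A(Y)$. **Part C (the spaces $QX$, $(I_X-Q)X$; $\mathbb K=\mathbb R$).** Let $R_n=A_nB_n$, a projection on $U_n$. Consider only admissible $n$ with $\max\{\lVert R_n\rVert,\lVert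 I_{U_n}-R_n\rVert\}\le1+\rho/2$ and $\max\{\lVert A_n\rVert,\lVert B_n\rVert\}\le2$. Choose recursively such $n_1<n_2<\cdots$, with $V_j=U_{n_j}$, $N_j=\dim V_j$, $D_j=\max(\{2\}\cup\{\alpha_{p_i}^{n_i},N_i^{1/2-1/p_i}:1\le i<j\})$, so that $\Lambda_j\ge D_j^8$ and $p_j-2\le\varepsilon(3q_i,2)$ for $1\le i<j$. Put $X=(\bigoplus_jV_j)_2$ and let $Q$ be the diagonal operator on $X$ with entries $Q_j=R_{n_j}$ for odd $j$ and $Q_j=I_{V_j}-R_{n_j}$ for even $j$. *)

(* Defs.v *)
From HB Require Import structures.
From mathcomp Require Import all_boot all_order all_algebra.
From mathcomp Require Import all_classical all_reals all_analysis.
From mathcomp Require Import complex.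

Set Implicit Arguments.
Unset Strict Implicit.
Unset Printing Implicit Defensive.

Import Order.TTheory GRing.Theory Num.Theory.
Import numFieldNormedType.Exports.

Local Open Scope classical_set_scope.
Local Open Scope ring_scope.

(* The norm of a MathComp [numFieldType] takes values in the field itself, i.e.
   in R[i] for complex scalars.  All norms below are real-valued, so the
   modulus [smod] into R is recorded separately. *)
Record scalars (R : realType) := Scalars {
  sfield :> numFieldType;
  smod : sfield -> R;
  sre : sfield -> R;
  sim : sfield -> R;
  sconj : sfield -> sfield;
  sinj : R -> sfield }.

Definition real_scalars (R : realType) : scalars R :=
  @Scalars R R (fun x => `|x|) id (fun=> 0) id id.

Definition complex_scalars (R : realType) : scalars R :=
  @Scalars R R[i] (@Normc.normc R) (@complex.Re R) (@complex.Im R) (@conjc R)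
    (fun x => Complex x 0).

Definition dprod (K : pzRingType) (I : Type) (V : I -> lmodType K) : Type :=
  forall i, V i.

Section dprod_lmod.
Variables (K : pzRingType) (I : Type) (V : I -> lmodType K).

HB.instance Definition _ := gen_eqMixin (dprod V).
HB.instance Definition _ := gen_choiceMixin (dprod V).

Definition dprod_add (x y : dprod V) : dprod V := fun i => x i + y i.
Definition dprod_opp (x : dprod V) : dprod V := fun i => - x i.
Definition dprod_zero : dprod V := fun i => 0.
Definition dprod_scale (a : K) (x : dprod V) : dprod V := fun i => a *: x i.

Fact dprod_addA : associative dprod_add.
Proof. by move=> x y z; apply: functional_extensionality_dep => i; exact: addrA. Qed.
Fact dprod_addC : commutative dprod_add.
Proof. by move=> x y; apply: functional_extensionality_dep => i; exact: addrC. Qed.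
Fact dprod_add0 : left_id dprod_zero dprod_add.
Proof. by move=> x; apply: functional_extensionality_dep => i; exact: add0r. Qed.
Fact dprod_addN : left_inverse dprod_zero dprod_opp dprod_add.
Proof. by move=> x; apply: functional_extensionality_dep => i; exact: addNr. Qed.

HB.instance Definition _ := GRing.isZmodule.Build (dprod V)
  dprod_addA dprod_addC dprod_add0 dprod_addN.

Fact dprod_scaleA a b (x : dprod V) :
  dprod_scale a (dprod_scale b x) = dprod_scale (a * b) x.
Proof. by apply: functional_extensionality_dep => i; exact: scalerA. Qed.
Fact dprod_scale1 : left_id 1 dprod_scale.
Proof. by move=> x; apply: functional_extensionality_dep => i; exact: scale1r. Qed.
Fact dprod_scaleDr : right_distributive dprod_scale +%R.
Proof. by move=> a x y; apply: functional_extensionality_dep => i; exact: scalerDr. Qed.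
Fact dprod_scaleDl (x : dprod V) : {morph dprod_scale^~ x : a b / a + b}.
Proof. by move=> a b; apply: functional_extensionality_dep => i; exact: scalerDl. Qed.

HB.instance Definition _ := GRing.Zmodule_isLmodule.Build K (dprod V)
  dprod_scaleA dprod_scale1 dprod_scaleDr dprod_scaleDl.

End dprod_lmod.

(* A normed space is a linear subspace [mem] of an ambient vector space, with a
   real-valued norm, whose values outside [mem] are irrelevant.  Function
   spaces such as L_r are represented by functions rather than by classes of
   functions, so [nrm] may be a seminorm; the only use of these spaces is through
   [quotient_map] below, which identifies elements at distance 0. *)
Record space (R : realType) (K : scalars R) := Space {
  amb :> lmodType K;
  mem : set amb;
  nrm : amb -> R }.

Section spaces.
Context {R : realType} {K : scalars R}.
Implicit Types S T : space K.

Definition full_space (V : lmodType K) (N : V -> R) : space K := Space setT N.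

Definition subspace_of S (Y : set S) : space K := Space Y (@nrm _ _ S).

Definition linear_subspace (V : lmodType K) (Y : set V) : Prop :=
  Y 0 /\ forall (a : K) x y, Y x -> Y y -> Y (a *: x + y).

Definition linear_on (V W : lmodType K) (Y : set V) (f : V -> W) : Prop :=
  forall (a : K) x y, Y x -> Y y -> f (a *: x + y) = a *: f x + f y.

Definition converges_to S (u : nat -> S) (x : S) : Prop :=
  nrm (x - u m) @[m --> \oo] --> (0 : R).

Definition complete_space S : Prop :=
  forall u : nat -> S, (forall n, mem (u n)) ->
  (forall e : R, 0 < e -> exists N, forall m n, (N <= m)%N -> (N <= n)%N ->
     nrm (u m - u n) <= e) ->
  exists x, mem x /\ converges_to u x.

Definition closed_subspace S (Y : set S) : Prop :=
  [/\ linear_subspace Y, Y `<=` @mem _ _ S &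
      forall (u : nat -> S) x, (forall n, Y (u n)) -> mem x ->
        converges_to u x -> Y x].

Definition unit_ball S : set S := [set x | mem x /\ nrm x <= 1].

Definition opnorm S T (f : S -> T) : \bar R :=
  ereal_sup [set (nrm (f x))%:E | x in @unit_ball S].

(* A functional on S is represented by its extension by 0 outside [mem]. *)
Definition dual S : space K :=
  @Space R K (S -> K^o)
    [set f | [/\ linear_on (@mem _ _ S) f,
                 forall x, ~ mem x -> f x = 0 &
                 exists C : R, forall x, mem x -> smod (f x) <= C * nrm x]]
    (fun f => sup [set smod (f x) | x in @unit_ball S]).

Definition l2sum (I : choiceType) (E : I -> space K) : space K :=
  @Space R K (dprod (fun i => amb (E i)))
    [set x | (forall i, mem (x i)) /\
       (\esum_(i in [set: I]) ((nrm (x i)) ^+ 2)%:E < +oo)%E]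
    (fun x => Num.sqrt (fine (\esum_(i in [set: I]) ((nrm (x i)) ^+ 2)%:E))).

Definition diag_op (E F : nat -> space K) (f : forall j, E j -> F j)
    (x : l2sum E) : l2sum F := fun j => f j (x j).

Section bases.
Variable S : space K.
Implicit Types b : nat -> S.

Definition expands b (a : nat -> K) (x : S) : Prop :=
  converges_to (fun m => \sum_(i < m) a i *: b i) x.

Definition schauder_basis b : Prop :=
  (forall i, mem (b i)) /\ forall x, mem x -> exists! a, expands b a x.

Definition coordf b (i : nat) : S -> K^o := fun x =>
  if `[< mem x >] then xget (fun=> 0) [set a : nat -> K | expands b a x] i
  else 0.

Definition partial_sum b (m : nat) (x : S) : S :=
  \sum_(i < m) coordf b i x *: b i.

Definition multiplier (I : eqType) (b : I -> S) (bs : I -> S -> K) (s : seq I)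
    (t : I -> K) (x : S) : S :=
  \sum_(i <- s) (t i * bs i x) *: b i.

(* The index type is arbitrary so that the definition also applies to bases of
   finite-dimensional spaces; the finite list [s] carries the support of the
   multiplier [t]. *)
Definition unconditional_with (I : eqType) (b : I -> S) (bs : I -> S -> K)
    (C : R) : Prop :=
  forall (s : seq I) (t : I -> K), uniq s -> (forall i, smod (t i) <= 1) ->
  (@opnorm S S (multiplier b bs s t) <= C%:E)%E.

Definition unconditional b : Prop := exists C, unconditional_with b (coordf b) C.

(* The coordinate functionals span a norm-dense subspace of the dual. *)
Definition shrinking b : Prop :=
  forall f : dual S, mem f -> forall e : R, 0 < e ->
  exists (m : nat) (c : nat -> K),
    nrm (f - \sum_(i < m) c i *: (coordf b i : dual S)) < e.

Definition boundedly_complete b : Prop :=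
  forall a : nat -> K,
  (exists C : R, forall m, nrm (\sum_(i < m) a i *: b i) <= C) ->
  exists x, mem x /\ expands b a x.

Definition asymptotically_monotone b : Prop :=
  @opnorm S S (partial_sum b m) @[m --> \oo] --> (1%E : \bar R).

End bases.

Definition inner_product_on (V : lmodType K) (G : set V) (ip : V -> V -> K) :=
  [/\ forall (a : K) x y z, G x -> G y -> G z ->
        ip (a *: x + y) z = a * ip x z + ip y z,
      forall x y, G x -> G y -> ip y x = sconj (ip x y) &
      forall x, G x -> x != 0 -> 0 < ip x x].

Definition ip_norm (V : lmodType K) (ip : V -> V -> K) (x : V) : R :=
  Num.sqrt (sre (ip x x)).

Definition hilbert_space (H : lmodType K) (ip : H -> H -> K) : Prop :=
  inner_product_on setT ip /\ complete_space (full_space (ip_norm ip)).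

Definition D_hilbertian S (D : R) : Prop :=
  exists ip : S -> S -> K,
  [/\ inner_product_on (@mem _ _ S) ip,
      complete_space (Space (@mem _ _ S) (ip_norm ip)) &
      forall x, mem x -> ip_norm ip x <= nrm x <= D * ip_norm ip x].

Definition gamma2 S (T : S -> S) : \bar R :=
  ereal_inf [set c | exists (H : lmodType K) (ip : H -> H -> K)
    (A : {linear S -> H}) (B : {linear H -> S}),
    [/\ hilbert_space ip, (forall x, T x = B (A x)) &
        c = (opnorm (A : S -> full_space (ip_norm ip)) *
             opnorm (B : full_space (ip_norm ip) -> S))%E]].

Definition emod (T : Type) (f : T -> K) (t : T) : \bar R := (smod (f t))%:E.

Definition Lr_space d (T : measurableType d)
    (mu : {measure set T -> \bar R}) (r : R) : space K :=
  @Space R K (T -> K^o)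
    [set f | [/\ measurable_fun [set: T] (fun t => sre (f t)),
                 measurable_fun [set: T] (fun t => sim (f t)) &
                 ('N[mu]_(r%:E)[emod f] < +oo)%E]]
    (fun f => fine ('N[mu]_(r%:E)[emod f])%E).

(* (Q, N) is, up to isometry, the quotient of S by the kernel of q; that N is
   definite expresses that this kernel is closed. *)
Definition quotient_map S (Q : lmodType K) (N : Q -> R) (q : S -> Q) : Prop :=
  [/\ linear_on (@mem _ _ S) q,
      forall z, exists2 x, mem x & q x = z,
      forall z, N z = inf (@nrm _ _ S @` [set x | mem x /\ q x = z]) &
      forall z, N z = 0 -> z = 0].

Definition span_set (V : lmodType K) (k : nat) (v : 'I_k -> V) : set V :=
  [set z | exists c : 'I_k -> K, z = \sum_(i < k) c i *: v i].

Definition is_epsilon (eps : nat -> R -> R) : Prop :=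
  forall (k : nat) (D : R), (1 <= k)%N -> 1 < D ->
  0 < eps k D /\
  forall (A : choiceType) (r : A -> R) (d : A -> measure_display)
    (T : forall a, measurableType (d a))
    (mu : forall a, {measure set (T a) -> \bar R})
    (X : forall a, set (Lr_space (mu a) (r a))),
  inhabited A ->
  (forall a, 2 <= r a <= 2 + eps k D) ->
  (forall a, closed_subspace (X a)) ->
  forall (Q : lmodType K) (N : Q -> R)
    (q : l2sum (fun a => subspace_of (X a)) -> Q),
  quotient_map N q ->
  forall v : 'I_k -> Q, D_hilbertian (Space (span_set v) N) D.

Definition lp_space (p : R) (I : finType) : space K :=
  @full_space {ffun I -> K^o}
    (fun z => (\sum_i smod (z i) `^ p) `^ p^-1).

End spaces.

Section power_probability.
Context {R : realType} {d : measure_display} {T : measurableType d}.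
Variable P : probability T R.

Definition tuple_cons n (u : T * n.-tuple T) : n.+1.-tuple T :=
  [tuple of u.1 :: u.2].

Fact measurable_tuple_cons n : measurable_fun [set: T * n.-tuple T] (@tuple_cons n).
Proof. exact: measurable_cons. Qed.

HB.instance Definition _ n := isMeasurableFun.Build _ _ _ _ (@tuple_cons n)
  (@measurable_tuple_cons n).

(* The n-fold product of P, built as an image of P \x P^(n-1). *)
Fixpoint power_prob n : probability (n.-tuple T) R :=
  match n with
  | 0 => \d_([tuple] : 0.-tuple T)
  | m.+1 => distribution (P \x power_prob m)%E (@tuple_cons m)
  end.

End power_probability.

(* The data depending on the scalar field: the probability space Omega with the
   map w, a probability space carrying a standard Gaussian scalar, and tau. *)
Record model (R : realType) (K : scalars R) := Model {
  omega_disp : measure_display;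
  omega : measurableType omega_disp;
  haar : probability omega R;
  wvec : omega -> 'I_2 -> K;
  gauss_disp : measure_display;
  gauss_space : measurableType gauss_disp;
  gauss_prob : probability gauss_space R;
  gauss : gauss_space -> K;
  tau : R }.

Section real_model.
Variable R : realType.

Fact two_pi_gt0 : (0 : R) < 2 * pi.
Proof. by rewrite mulr_gt0 ?pi_gt0. Qed.

(* The circle is represented by [0, 2 pi] with normalised Lebesgue measure. *)
Definition real_model : model (real_scalars R) :=
  @Model R (real_scalars R) _ _ (uniform_prob two_pi_gt0)
    (fun t i => Num.sqrt 2 * (if i == ord0 then cos t else sin t))
    _ _ (normal_prob 0 1) id (5 / 4).

End real_model.

Section complex_model.
Variable R : realType.
Notation C2 := ((measurableTypeR R * measurableTypeR R) *
  (measurableTypeR R * measurableTypeR R))%type.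

(* C^2 is represented by R^4, for which product measurability is available; the
   sphere measure is a probability on C^2 carried by the unit sphere and
   invariant under the unitary group, which determines it uniquely. *)
Definition C2_coord (t : C2) (i : 'I_2) : R[i] :=
  if i == ord0 then Complex t.1.1 t.1.2 else Complex t.2.1 t.2.2.

Definition C2_point (z : 'I_2 -> R[i]) : C2 :=
  ((complex.Re (z ord0), complex.Im (z ord0)),
   (complex.Re (z ord_max), complex.Im (z ord_max))).

Definition C2_act (U : 'M[R[i]]_2) (t : C2) : C2 :=
  C2_point (fun i => \sum_j U i j * C2_coord t j).

Definition C2_sphere : set C2 :=
  [set t | t.1.1 ^+ 2 + t.1.2 ^+ 2 + (t.2.1 ^+ 2 + t.2.2 ^+ 2) = 1].

Definition invariant_on_sphere (sigma : probability C2 R) : Prop :=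
  sigma C2_sphere = 1%E /\
  forall U : 'M[R[i]]_2, U *m (map_mx (@conjc R) U)^T = 1%:M ->
  forall A : set C2, measurable A -> sigma (C2_act U @^-1` A) = sigma A.

Definition complex_model (sigma : probability C2 R) :
    model (complex_scalars R) :=
  @Model R (complex_scalars R) _ _ sigma
    (fun t i => Complex (Num.sqrt 2) 0 * C2_coord t i)
    _ _ (normal_prob (0 : R) 1 \x normal_prob (0 : R) 1)%E
    (fun g => Complex (g.1 / Num.sqrt 2) (g.2 / Num.sqrt 2)) (10 / 9).

End complex_model.

Section tensor.
Variables (R : realType) (K : scalars R).
Variable M : model K.
Implicit Types (n : nat) (p r : R).

(* The tensor power of K^2 in the coordinates of the product basis. *)
Definition tindex n : finType := {ffun 'I_n -> 'I_2}.
Definition tensor n : vectType K := {ffun tindex n -> K^o}.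

Definition qdim n : nat := (2 ^ n)%N.

Definition tbasis n (i : tindex n) : tensor n := [ffun j => (j == i)%:R].

Definition tip n (x y : tensor n) : K := \sum_i x i * sconj (y i).

Definition Wvec n (t : n.-tuple (omega M)) : tensor n :=
  [ffun i : tindex n => \prod_(s < n) wvec (tnth t s) (i s) : K^o].

Definition ffn n (x : tensor n) (t : n.-tuple (omega M)) : K := tip x (Wvec t).

Definition Espace n p : space K :=
  @full_space R K (tensor n) (fun x =>
    fine ('N[power_prob (haar M) n]_(p%:E)[emod (ffn x)])%E).

Definition alpha r : R :=
  fine ('N[haar M]_(r%:E)[emod (fun t : omega M => wvec t ord0)])%E.

Definition cconst p : R := alpha p * alpha (p / (p - 1)).

Definition pexp n : R := 2 + n%:R `^ (- (3 / 4)).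

Definition Lambda n : R :=
  alpha (pexp n) ^+ n * tau M `^ (- (n%:R * (pexp n - 2) / (2 * pexp n))).

Definition zeta n (g : #|tindex n|.-tuple (gauss_space M)) : tensor n :=
  sinj K (Num.sqrt (qdim n)%:R)^-1 *:
    \sum_i gauss (tnth g (enum_rank i)) *: tbasis i.

Definition trace n (T : tensor n -> tensor n) : K := \sum_i T (tbasis i) i.

Section theta.
Variables (n : nat) (H : vectType K) (ip : H -> H -> K).
Notation big := (tensor n * H)%type.

Definition big_ip (z z' : big) : K := tip z.1 z'.1 + ip z.2 z'.2.

Definition orth_proj (F : {vspace big}) (z : big) : big :=
  xget 0 [set y | y \in F /\ forall f, f \in F -> big_ip (z - y) f = 0].

(* The adjoint of the inclusion of the first summand is the first projection. *)
Definition theta (F : {vspace big}) : R :=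
  (qdim n)%:R^-1 * sre (trace (fun x => (orth_proj F (x, 0)).1)).

Definition big_space (F : {vspace big}) (p : R) : space K :=
  @Space R K big [set z | z \in F]
    (fun z => Num.sqrt (@nrm _ _ (Espace n p) z.1 ^+ 2 + ip_norm ip z.2 ^+ 2)).

End theta.

Definition admissible n : Prop :=
  let p := pexp n in let E := Espace n p in
  [/\ (0 < n)%N,
      (\int[power_prob (gauss_prob M) #|tindex n|]_g
         ((@nrm _ _ E (zeta g)) ^+ 2)%:E <= 4%:E)%E,
      (forall T : {linear tensor n -> tensor n},
         ((smod (trace T) / (qdim n)%:R)%:E <=
          (2 * alpha p ^- n)%:E * @gamma2 R K E T)%E) &
      forall (C : R) (H : vectType K) (ip : H -> H -> K)
        (F : {vspace (tensor n * H)%type}),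
        1 <= C -> inner_product_on setT ip -> (\dim F <= 3 * qdim n)%N ->
        (exists2 X : (\dim F).-tuple (tensor n * H)%type, basis_of F X &
           @unconditional_with R K (big_space ip F p) 'I_(\dim F)
             (fun i => tnth X i) (fun i => coord X i) C) ->
        theta ip F <= 80 * C ^+ 3 / Lambda n].

(* Sequences are indexed from 0, so D_1 is [DB 0]. *)

Section sequence.
Variable (n : nat -> nat).

Definition pj j : R := pexp (n j).
Definition Ej j : space K := Espace (n j) (pj j).

Definition DB j : R :=
  if j is i.+1 then Num.max 2 (alpha (pj i) ^+ n i) else 2.

Definition sequence_conditions (eps : nat -> R -> R) (D : nat -> R) : Prop :=
  [/\ {homo n : i j / (i < j)%N},
      forall j, admissible (n j),
      forall j, D j ^+ 8 <= Lambda (n j) &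
      forall i j, (i < j)%N -> pj j - 2 <= eps (3 * qdim (n i))%N 2].

Variable (I : nat -> finType).
Notation U := (fun j => @lp_space R K (pj j) (I j)).
Variables (a : forall j, Ej j -> U j) (b : forall j, U j -> Ej j).

Definition factorisation_conditions (rho : R) : Prop :=
  [/\ forall j x, b (a x) = x :> Ej j,
      exists C : R, forall j, (opnorm (@a j) <= C%:E)%E /\
                              (opnorm (@b j) <= C%:E)%E &
      forall j, (@opnorm _ _ (U j) (U j) (fun z => a (b z)) <= (1 + rho / 2)%:E)%E].

Definition Zspace : space K :=
  @subspace_of R K (l2sum U)
    (@diag_op R K U U (fun j z => a (b z)) @` @mem _ _ (l2sum U)).

End sequence.

End tensor.

Section sampling.
Variable R : realType.
Notation K := (real_scalars R).
Notation M := (real_model R).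

Definition mesh (n : nat) : nat := (1000 * n ^ 2)%N.
Definition grid (n : nat) : finType := {ffun 'I_n -> 'I_(mesh n)}.

Definition grid_point n (r : grid n) : n.-tuple (omega M) :=
  [tuple (2 * pi * (r s)%:R / (mesh n)%:R : measurableTypeR R) | s < n].

Definition gridfun n : vectType R := {ffun grid n -> R^o}.

Definition Uspace n : space K :=
  @full_space R K (gridfun n) (fun z =>
    ((\sum_r `|z r| `^ pexp R n) / (mesh n)%:R ^+ n) `^ (pexp R n)^-1).

Definition sampA n (x : tensor K n) : gridfun n :=
  [ffun r => @ffn R K M n x (grid_point r)].

Definition sampB n (z : gridfun n) : tensor K n :=
  (mesh n)%:R ^- n *: \sum_r z r *: @Wvec R K M n (grid_point r).

(* The isometry from Uspace n onto the unnormalised l_p space is multiplication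
   by #|grid n| ^ (-1/p). *)
Definition rescale n : R := #|grid n|%:R `^ (- (pexp R n)^-1).

Variable (n : nat -> nat).

Definition realA j (x : Ej M n j) :
    @lp_space R K (pj R n j) (grid (n j)) := rescale (n j) *: sampA x.
Definition realB j (z : @lp_space R K (pj R n j) (grid (n j))) :
    Ej M n j := sampB ((rescale (n j))^-1 *: z).

Definition partB_real (rho : R) (eps : nat -> R -> R) : Prop :=
  sequence_conditions M n eps (DB M n) /\
  factorisation_conditions realA realB rho.

Definition Z_real : space K := Zspace realA realB.

Definition sampR m (z : gridfun m) : gridfun m := sampA (sampB z).
Definition sampR_compl m (z : gridfun m) : gridfun m := z - sampR z.

Definition DC j : R :=
  \big[Num.max/2]_(i < j)
     Num.max (alpha M (pj R n i) ^+ n i)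
             (#|grid (n i)|%:R `^ (1 / 2 - 1 / pj R n i)).

Definition partC (rho : R) (eps : nat -> R -> R) : Prop :=
  sequence_conditions M n eps DC /\
  forall j,
  [/\ (@opnorm R K (Uspace (n j)) (Uspace (n j)) (@sampR (n j))
         <= (1 + rho / 2)%:E)%E,
      (@opnorm R K (Uspace (n j)) (Uspace (n j)) (@sampR_compl (n j))
         <= (1 + rho / 2)%:E)%E,
      (@opnorm R K (Ej M n j) (Uspace (n j)) (@sampA (n j)) <= 2%:E)%E &
      (@opnorm R K (Uspace (n j)) (Ej M n j) (@sampB (n j)) <= 2%:E)%E].

Definition Xspace : space K := l2sum (fun j => Uspace (n j)).

(* Counting from 1, the odd positions are the even indices here. *)
Definition Qop : Xspace -> Xspace :=
  @diag_op R K (fun j => Uspace (n j)) (fun j => Uspace (n j))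
    (fun j z => if odd j then sampR_compl z else sampR z).

Definition QX : space K := subspace_of (Qop @` @mem _ _ Xspace).
Definition IQX : space K :=
  @subspace_of R K Xspace ((fun x => x - Qop x) @` @mem _ _ Xspace).

End sampling.

Section complex_construction.
Variables (R : realType).
Notation K := (complex_scalars R).
Variable M : model K.
Variables (n N : nat -> nat).
Notation U := (fun j => @lp_space R K (pj R n j) 'I_(N j)).
Variables (a : forall j, {linear Ej M n j -> U j})
          (b : forall j, {linear U j -> Ej M n j}).

Definition partB_complex (rho : R) (eps : nat -> R -> R) : Prop :=
  [/\ sequence_conditions M n eps (DB M n),
      @factorisation_conditions R K M n (fun j => 'I_(N j)) a b rho &
      exists delta : nat -> R,
      [/\ forall j, 0 < delta j < 1,
          delta @ \oo --> (0 : R),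
          forall j, cconst M (pj R n j) ^+ n j / (1 - delta j) <= 1 + rho / 2,
          forall j, (@opnorm R K (Ej M n j) (U j) (a j) <= 1%:E)%E &
          forall j, (@opnorm R K (U j) (Ej M n j) (b j) <=
             (cconst M (pj R n j) ^+ n j / (1 - delta j))%:E)%E]].

Definition Z_complex : space K :=
  @Zspace R K M n (fun j => 'I_(N j)) a b.

End complex_construction.

Definition good_basis (R : realType) (K : scalars R) (S : space K)
    (b : nat -> S) : Prop :=
  [/\ schauder_basis b, ~ unconditional b, shrinking b & boundedly_complete b].

Definition has_good_bases (R : realType) (K : scalars R) (S : space K) : Prop :=
  (exists b : nat -> S, good_basis b) /\
  (exists b : nat -> S, good_basis b /\ asymptotically_monotone b).

(* Main.v *)
From mathcomp Require Import all_boot all_order all_algebra.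
From mathcomp Require Import all_classical all_reals all_analysis.
From mathcomp Require Import measurable_realfun complex ring lra.
Require Import Defs.

(** Each of the spaces is an l_2-sum of finite-dimensional blocks F_j, where F_j
    is a subspace of a weighted l_p-space U_j with p = p_j tending to 2.  A basis
    is obtained by writing one after another bases of the blocks.  If the partial
    sum projections of the basis of F_j have norm at most kappa_j, a partial sum
    projection of the concatenation is the identity on the blocks to the left,
    zero on those to the right, and a partial sum projection on one block, so its
    norm is at most max(1, kappa_j); hence kappa_j -> 1 gives a Schauder basis that
    is asymptotically monotone.  It is shrinking because a functional on an
    l_2-sum is small on all far blocks, and boundedly complete because a sequence
    of blocks with bounded partial l_2-sums is an element.  These properties pass
    to the biorthogonal functionals ([dual_basis_system]), whence the assertion
    for the dual spaces ([concatenation_good_bases]).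

    The basis is conditional.  For F = E(n,p) and H = 0 the projection R_F is the
    identity, so theta(F) = 1, and admissibility bounds Lambda(n) by 80 C^3 when
    F has a C-unconditional basis ([admissible_conditional]).  On the other hand
    Lambda_j >= D_j^8, and D_(j+1) >= Lambda_j because tau >= 1, so that Lambda_j
    tends to infinity ([Lambda_unbounded]).

    The substance is to find bases of the blocks with kappa_j -> 1.  For s = p - 2
    and kappa = 1 + 14 s the function
      U(x, y) = (|y|^2 - kappa |x|^2) (|x|^2 + |y|^2)^(s/2)
    is concave in every direction (h, k) with |k| <= |h| ([bell_tangent]); this is
    the mechanism behind Burkholder's inequality for martingale transforms, and
    near p = 2 it comes with a constant close to 1.  It bounds the partial sums,
    in the order of the binary codes, of Walsh sums with arbitrary scalar
    coefficients, up to the factor bell_kappa / bell_lambda -> 1 ([walsh_powR]).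
    The spaces have enough sign symmetries to reduce to Walsh sums.

    For complex scalars, changing the sign of the second coordinate of t_s in
    W(t) multiplies the coordinates of W(t) by Walsh signs and preserves the
    measure, so the coordinate basis of E(n,p) has partial sums bounded by
    bell_kappa / bell_lambda ([nrm_trunc]).  Transport to U_j costs the factor
    c_p^n / (1 - delta_j), and c_p <= 1 + 8 (p - 2)^2 ([cconst_le]) while
    n (p - 2)^2 = n^(-1/2), so this factor tends to 1.

    For real scalars the projection R = A_j B_j is only bounded by 1 + rho/2, and
    the bases are built in U_j itself.  The reflections of the coordinates of the grid
    form a sign group acting on U_j, and W sampled at the grid has exactly one
    coordinate function phi_i in the isotypic component of each character.  The
    range of the projection R is spanned by the phi_i ([range_basis]).  The kernel
    consists, component by component, of the functions orthogonal to phi_i; each of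
    these hyperplanes is exhausted by a chain of conditional expectations for a
    changed density, which satisfy the same inequality for U as a truncation does
    ([kernel_basis], [tail_avg_bell]). *)

Set Implicit Arguments.
Unset Strict Implicit.
Unset Printing Implicit Defensive.

Import Order.TTheory GRing.Theory Num.Theory.
Import numFieldNormedType.Exports.

Local Open Scope classical_set_scope.
Local Open Scope ring_scope.

(** * The two scalar fields *)

(** The facts by which one argument serves both scalar fields.  Completeness and
    the Cauchy--Schwarz computations go through real and imaginary parts; [simT]
    separates the field in which the imaginary part is void from the one in which
    it is arbitrary. *)
Record scalars_ok (R : realType) (K : scalars R) : Prop := ScalarsOk {
  sreD : forall x y : K, sre (x + y) = sre x + sre y;
  simD : forall x y : K, sim (x + y) = sim x + sim y;
  sreM : forall x y : K, sre (x * y) = sre x * sre y - sim x * sim y;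
  simM : forall x y : K, sim (x * y) = sre x * sim y + sim x * sre y;
  sreJ : forall x : K, sre (sconj x) = sre x;
  simJ : forall x : K, sim (sconj x) = - sim x;
  sre_inj : forall r, sre (sinj K r) = r;
  sim_inj : forall r, sim (sinj K r) = 0;
  sre1 : sre (1 : K) = 1;
  sim1 : sim (1 : K) = 0;
  smodE : forall x : K, smod x = Num.sqrt (sre x ^+ 2 + sim x ^+ 2);
  sext : forall x y : K, sre x = sre y -> sim x = sim y -> x = y;
  simT : (forall x : K, sim x = 0) \/
         (forall a b, exists x : K, sre x = a /\ sim x = b) }.

Lemma real_scalars_ok (R : realType) : scalars_ok (real_scalars R).
Proof.
split=> //= *; rewrite ?addr0 ?oppr0 ?mulr0 ?mul0r ?subr0 ?addr0//.
  by rewrite expr0n/= addr0 sqrtr_sqr.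
by left.
Qed.

Lemma complex_scalars_ok (R : realType) : scalars_ok (complex_scalars R).
Proof.
split=> //=; try by move=> [a b] [c d].
- by case.
- by case.
- by case.
- by move=> [a b] [c d] /= -> ->.
- by right=> a b; exists (Complex a b).
Qed.

Section scalar_theory.
Context {R : realType} {K : scalars R}.
Hypothesis ok : scalars_ok K.
Implicit Types (x y : K) (r : R).

Lemma sre0 : sre (0 : K) = 0.
Proof. by have := sreD ok 0 0; rewrite addr0 => /eqP; rewrite -subr_eq0 opprD addrA subrr sub0r oppr_eq0 => /eqP. Qed.

Lemma sim0 : sim (0 : K) = 0.
Proof. by have := simD ok 0 0; rewrite addr0 => /eqP; rewrite -subr_eq0 opprD addrA subrr sub0r oppr_eq0 => /eqP. Qed.

Lemma sreN x : sre (- x) = - sre x.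
Proof. by apply/eqP; rewrite -addr_eq0 -(sreD ok) addNr sre0. Qed.

Lemma simN x : sim (- x) = - sim x.
Proof. by apply/eqP; rewrite -addr_eq0 -(simD ok) addNr sim0. Qed.

Lemma smod_sqr x : smod x ^+ 2 = sre x ^+ 2 + sim x ^+ 2.
Proof. by rewrite (smodE ok) sqr_sqrtr// addr_ge0 ?sqr_ge0. Qed.

Lemma smod_ge0 x : 0 <= smod x.
Proof. by rewrite (smodE ok) sqrtr_ge0. Qed.

Lemma smod0 : smod (0 : K) = 0.
Proof. by rewrite (smodE ok) sre0 sim0 expr0n/= addr0 sqrtr0. Qed.

Lemma smod_eq0 x : smod x = 0 -> x = 0.
Proof.
move=> x0; have := smod_sqr x; rewrite x0 expr0n/= => /esym/eqP.
rewrite paddr_eq0 ?sqr_ge0// !sqrf_eq0 => /andP[/eqP a /eqP b].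
by apply: (sext ok); rewrite ?sre0 ?sim0.
Qed.

Lemma smodM x y : smod (x * y) = smod x * smod y.
Proof.
rewrite !(smodE ok) -sqrtrM ?addr_ge0 ?sqr_ge0//; congr Num.sqrt.
by rewrite (sreM ok) (simM ok); ring.
Qed.

Lemma smodN x : smod (- x) = smod x.
Proof. by rewrite !(smodE ok) sreN simN !sqrrN. Qed.

Lemma smod1 : smod (1 : K) = 1.
Proof. by rewrite (smodE ok) (sre1 ok) (sim1 ok) expr0n/= addr0 expr1n sqrtr1. Qed.

Lemma smod_inj r : smod (sinj K r) = `|r|.
Proof. by rewrite (smodE ok) (sre_inj ok) (sim_inj ok) expr0n/= addr0 sqrtr_sqr. Qed.

Lemma ler_smodD x y : smod (x + y) <= smod x + smod y.
Proof.
rewrite -(@ler_pXn2r _ 2) ?nnegrE ?addr_ge0 ?smod_ge0//.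
have h : sre x * sre y + sim x * sim y <= smod x * smod y.
  rewrite -smodM; apply: le_trans (ler_norm _) _.
  rewrite -(@ler_pXn2r _ 2) ?nnegrE ?smod_ge0// real_normK ?num_real//.
  rewrite smodM exprMn !smod_sqr -subr_ge0.
  rewrite (_ : _ - _ = (sre x * sim y - sim x * sre y) ^+ 2) ?sqr_ge0//; ring.
rewrite smod_sqr (sreD ok) (simD ok) [leRHS]sqrrD.
rewrite -subr_ge0 !smod_sqr.
by rewrite (_ : _ - _ = 2 * (smod x * smod y - (sre x * sre y + sim x * sim y)));
  [rewrite mulr_ge0// subr_ge0|ring].
Qed.

Lemma ler_smod_sum (I : Type) (r : seq I) (P : pred I) (F : I -> K) :
  smod (\sum_(i <- r | P i) F i) <= \sum_(i <- r | P i) smod (F i).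
Proof.
elim/big_ind2 : _ => //; first by rewrite smod0.
by move=> x a y b xa yb; apply: le_trans (ler_smodD _ _) (lerD xa yb).
Qed.

Lemma smodB x y : smod (x - y) = smod (y - x).
Proof. by rewrite -opprB smodN. Qed.

Lemma sinjD r r' : sinj K (r + r') = sinj K r + sinj K r'.
Proof. by apply: (sext ok); rewrite ?(sreD ok) ?(simD ok) ?(sre_inj ok) ?(sim_inj ok) ?addr0. Qed.

Lemma sinjM r r' : sinj K (r * r') = sinj K r * sinj K r'.
Proof.
apply: (sext ok); rewrite ?(sreM ok) ?(simM ok) !(sre_inj ok, sim_inj ok).
  by rewrite mulr0 subr0.
by rewrite mulr0 mul0r addr0.
Qed.

Lemma sinj0 : sinj K 0 = 0.
Proof. by apply: (sext ok); rewrite ?(sre_inj ok) ?(sim_inj ok) ?sre0 ?sim0. Qed.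

Lemma sinj_sum (I : Type) (r : seq I) (P : pred I) (F : I -> R) :
  sinj K (\sum_(i <- r | P i) F i) = \sum_(i <- r | P i) sinj K (F i).
Proof. exact: (big_morph _ sinjD sinj0). Qed.

Lemma mul_sconj x : sconj x * x = sinj K (smod x ^+ 2).
Proof.
apply: (sext ok); rewrite smod_sqr ?(sreM ok) ?(simM ok) !(sreJ ok, simJ ok) ?(sre_inj ok, sim_inj ok); ring.
Qed.

Lemma smodJ x : smod (sconj x) = smod x.
Proof. by rewrite !(smodE ok) (sreJ ok) (simJ ok) sqrrN. Qed.

Lemma sconj0 : sconj (0 : K) = 0.
Proof. by apply: smod_eq0; rewrite smodJ smod0. Qed.

Lemma smodV x : smod x^-1 = (smod x)^-1.
Proof.
have [->|x0] := eqVneq x 0; first by rewrite invr0 smod0 invr0.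
have xx : smod x != 0 by apply: contra_neq x0 => /smod_eq0.
by apply: (mulIf xx); rewrite -smodM mulVf// smod1 mulVf.
Qed.

Lemma sre_le x : `|sre x| <= smod x.
Proof.
rewrite -(@ler_pXn2r _ 2) ?nnegrE ?smod_ge0// real_normK ?num_real//.
by rewrite smod_sqr lerDl sqr_ge0.
Qed.

Lemma sim_le x : `|sim x| <= smod x.
Proof.
rewrite -(@ler_pXn2r _ 2) ?nnegrE ?smod_ge0// real_normK ?num_real//.
by rewrite smod_sqr lerDr sqr_ge0.
Qed.

Lemma smod_le x : smod x <= `|sre x| + `|sim x|.
Proof.
rewrite -(@ler_pXn2r _ 2) ?nnegrE ?smod_ge0 ?addr_ge0//.
rewrite smod_sqr sqrrD !real_normK ?num_real// addrAC lerDl.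
by rewrite mulrn_wge0// mulr_ge0.
Qed.

Lemma real_cauchy_cvg (u : nat -> R) :
  (forall e, 0 < e -> exists N, forall m n, (N <= m)%N -> (N <= n)%N ->
     `|u m - u n| <= e) ->
  exists l, forall e, 0 < e -> exists N, forall m, (N <= m)%N -> `|l - u m| <= e.
Proof.
move=> cu; have : cvg (u @ \oo).
  apply/cauchy_cvgP/cauchy_ballP => e e0.
  have e2 : 0 < e / 2 by rewrite divr_gt0.
  have [N Nu] := cu _ e2.
  pose U := u @` [set n | (N <= n)%N].
  exists (U, U); first by split; exists N => // n Nn; exists n.
  move=> [_ _] [[m Nm <-] [n Nn <-]]; rewrite /= -ball_normE/=.
  apply: (@le_lt_trans _ _ (e / 2)); first exact: Nu.
  by rewrite ltr_pdivrMr// ltr_pMr// ltr1n.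
move/cvgrPdist_le => h; exists (lim (u @ \oo)) => e /h[N _ Nu].
by exists N => m Nm; exact: Nu.
Qed.

Lemma scalar_cauchy_cvg (u : nat -> K) :
  (forall e, 0 < e -> exists N, forall m n, (N <= m)%N -> (N <= n)%N ->
     smod (u m - u n) <= e) ->
  exists l, forall e, 0 < e -> exists N, forall m, (N <= m)%N -> smod (l - u m) <= e.
Proof.
move=> cu.
have [a ha] : exists l, forall e, 0 < e -> exists N, forall m, (N <= m)%N -> `|l - sre (u m)| <= e.
  apply: real_cauchy_cvg => e /cu[N h]; exists N => m n Nm Nn.
  by rewrite -sreN -(sreD ok) (le_trans (sre_le _))// h.
have [b hb] : exists l, forall e, 0 < e -> exists N, forall m, (N <= m)%N -> `|l - sim (u m)| <= e.
  apply: real_cauchy_cvg => e /cu[N h]; exists N => m n Nm Nn.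
  by rewrite -simN -(simD ok) (le_trans (sim_le _))// h.
have [l [la lb]] : exists l : K, sre l = a /\ sim l = b.
  case: (simT ok) => [h|//]; exists (sinj K a); rewrite (sre_inj ok) (sim_inj ok); split=> //.
  apply/eqP; rewrite eq_sym -normr_eq0 eq_le normr_ge0 andbT; apply/ler_addgt0Pl => e e0.
  by have [N /(_ N (leqnn _))] := hb e e0; rewrite h subr0 addr0.
exists l => e e0; have e2 : 0 < e / 2 by rewrite divr_gt0.
have [N1 h1] := ha _ e2; have [N2 h2] := hb _ e2.
exists (maxn N1 N2) => m; rewrite geq_max => /andP[m1 m2].
rewrite (le_trans (smod_le _))// (sreD ok) (simD ok) sreN simN la lb.
by rewrite [leRHS]splitr lerD ?h1 ?h2.
Qed.

End scalar_theory.

(** * The Bellman function *)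

Section bellman.
Variable R : realType.
Implicit Types (s e t : R).

Lemma concave_tangent (f f' f'' : R -> R) :
  (forall t, is_derive t 1 f (f' t)) -> (forall t, is_derive t 1 f' (f'' t)) ->
  (forall t, f'' t <= 0) -> f 1 <= f 0 + f' 0.
Proof.
move=> d1 d2 c.
have cont (g g' : R -> R) (dg : forall t, is_derive t 1 g (g' t)) (a b : R) :
    {within `[a, b], continuous g}.
  by apply: derivable_within_continuous => x _; exact: (@ex_derive _ _ _ _ _ _ _ (dg x)).
have [x] := @MVT_segment R f f' 0 1 ler01 (fun x _ => d1 x) (cont _ _ d1 0 1).
rewrite in_itv/= => /andP[x0 _] E1.
have [y _ E2] := @MVT_segment R f' f'' 0 x x0 (fun x _ => d2 x) (cont _ _ d2 0 x).
have : f'' y * (x - 0) <= 0 by rewrite subr0 mulr_le0_ge0.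
by rewrite -E2; rewrite subr0 mulr1 in E1; lra.
Qed.

(** The arguments are the squared moduli A = |x|^2 and B = |y|^2. *)
Definition bell s (A B : R) : R :=
  (B - (1 + 14 * s) * A) * (A + B) `^ (s / 2).

(** The derivative of (x, y) |-> bell s |x|^2 |y|^2 in the direction (h, k), for
    x = (x1, x2) and so on in the plane.  Real scalars are the case of vanishing
    second components. *)
Definition bell_D s (x1 x2 y1 y2 h1 h2 k1 k2 : R) : R :=
  let a := x1 ^+ 2 + x2 ^+ 2 + (y1 ^+ 2 + y2 ^+ 2) in
  (2 * (y1 * k1 + y2 * k2) - 2 * (1 + 14 * s) * (x1 * h1 + x2 * h2))
    * a `^ (s / 2)
  + (y1 ^+ 2 + y2 ^+ 2 - (1 + 14 * s) * (x1 ^+ 2 + x2 ^+ 2))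
    * (s / 2) * a `^ (s / 2 - 1) * (2 * (x1 * h1 + x2 * h2 + (y1 * k1 + y2 * k2))).

(** Along the line (x + t h, y + t k) the function is q a^(s/2) with quadratic
    polynomials q and a, and the left-hand side is its second derivative divided by
    a^(s/2 - 2).  The term q'' a^2 is at most -28 s |h|^2 a^2 because |k| <= |h|;
    by the Cauchy--Schwarz inequality the three other terms are at most
    8 s kp |h|^2 a^2, 4 s kp |h|^2 a^2 and 2 s kp |h|^2 a^2, and 14 kp <= 28 for
    s <= 1/14.  The summand e keeps a positive. *)
Lemma bell_hessian s e (x1 x2 y1 y2 h1 h2 k1 k2 : R) :
  0 < s -> s <= 14^-1 -> 0 < e -> k1 ^+ 2 + k2 ^+ 2 <= h1 ^+ 2 + h2 ^+ 2 ->
  let kp := 1 + 14 * s in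
  let a := x1 ^+ 2 + x2 ^+ 2 + (y1 ^+ 2 + y2 ^+ 2) + e in
  let q := y1 ^+ 2 + y2 ^+ 2 - kp * (x1 ^+ 2 + x2 ^+ 2) in
  let q' := 2 * (y1 * k1 + y2 * k2) - 2 * kp * (x1 * h1 + x2 * h2) in
  let a' := 2 * (x1 * h1 + x2 * h2 + (y1 * k1 + y2 * k2)) in
  let q'' := 2 * (k1 ^+ 2 + k2 ^+ 2) - 2 * kp * (h1 ^+ 2 + h2 ^+ 2) in
  let a'' := 2 * (h1 ^+ 2 + h2 ^+ 2 + (k1 ^+ 2 + k2 ^+ 2)) in
  (q'' * a ^+ 2 + s * q' * a' * a + s / 2 * (s / 2 - 1) * q * a' ^+ 2
    + s / 2 * q * a * a'' <= 0 : Prop).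
Proof.
move=> s0 s1 e0 LH kp a q q' a' q'' a''.
set H := h1 ^+ 2 + h2 ^+ 2 in LH q'' a'' *.
set L := k1 ^+ 2 + k2 ^+ 2 in LH q'' a'' *.
set X := x1 ^+ 2 + x2 ^+ 2 in a q *; set Y := y1 ^+ 2 + y2 ^+ 2 in a q *.
set P := x1 * h1 + x2 * h2 in q' a' *; set Q := y1 * k1 + y2 * k2 in q' a' *.
have X0 : 0 <= X by rewrite addr_ge0 ?sqr_ge0.
have Y0 : 0 <= Y by rewrite addr_ge0 ?sqr_ge0.
have L0 : 0 <= L by rewrite addr_ge0 ?sqr_ge0.
have H0 : 0 <= H := le_trans L0 LH.
have PX : P ^+ 2 <= X * H.
  rewrite -subr_ge0 (_ : _ - _ = (x1 * h2 - x2 * h1) ^+ 2) ?sqr_ge0//.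
  by rewrite /P /X /H; ring.
have QY : Q ^+ 2 <= Y * H.
  apply: (@le_trans _ _ (Y * L)); last by rewrite ler_wpM2l.
  rewrite -subr_ge0 (_ : _ - _ = (y1 * k2 - y2 * k1) ^+ 2) ?sqr_ge0//.
  by rewrite /Q /Y /L; ring.
clearbody P Q X Y H L.
have kp1 : 1 <= kp by rewrite /kp; lra.
have kp2 : kp <= 2 by rewrite /kp; lra.
have a0 : 0 < a by rewrite /a; lra.
have PQ : P ^+ 2 + Q ^+ 2 <= a * H.
  have eH := mulr_ge0 (ltW e0) H0.
  by rewrite (_ : a * H = X * H + Y * H + e * H); [lra | rewrite /a; ring].
have a'2 : a' ^+ 2 <= 8 * (a * H).
  have := sqr_ge0 (P - Q).
  rewrite (_ : a' ^+ 2 = 8 * (P ^+ 2 + Q ^+ 2) - 4 * (P - Q) ^+ 2); last first.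
    by rewrite /a'; ring.
  by lra.
have qa : `|q| <= kp * a.
  have ? : 0 <= kp * X by rewrite mulr_ge0// (le_trans _ kp1).
  have ? : Y <= kp * Y by rewrite ler_peMl.
  have ? : 0 <= kp * e by rewrite mulr_ge0 ?(ltW e0) ?(le_trans _ kp1).
  by rewrite ler_norml; apply/andP; split; rewrite /q /a !mulrDr; lra.
have q'a' : q' * a' <= 8 * kp * (a * H).
  have ? := sqr_ge0 (P + Q); have ? := sqr_ge0 (P - Q).
  have E : q' * a' = 4 * (Q * Q - kp * (P * P) + (1 - kp) * (P * Q)).
    by rewrite /q' /a'; ring.
  rewrite E; have F : (1 - kp) * (P * Q) <= (kp - 1) * (P ^+ 2 + Q ^+ 2).
    rewrite -[1 - kp]opprB mulNr -mulrN ler_wpM2l ?subr_ge0//.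
    have := sqr_ge0 (P + Q); rewrite sqrrD => ?.
    by have := sqr_ge0 P; have := sqr_ge0 Q; lra.
  have ? : 0 <= kp * (P * P) by rewrite mulr_ge0 ?(le_trans _ kp1)// -expr2 sqr_ge0.
  have ? : Q * Q <= P ^+ 2 + Q ^+ 2 by rewrite -expr2 lerDr sqr_ge0.
  have G : kp * (P ^+ 2 + Q ^+ 2) <= kp * (a * H).
    by rewrite ler_wpM2l ?(le_trans _ kp1).
  have ? : 0 <= kp * (a * H) by rewrite !mulr_ge0 ?(ltW a0)// (le_trans _ kp1).
  by rewrite mulrBl mul1r in F; lra.
have T1 : q'' * a ^+ 2 <= - (28 * s) * (H * a ^+ 2).
  rewrite (_ : _ * (H * _) = - (28 * s) * H * a ^+ 2); last by ring.
  have ? : kp * H = H + 14 * s * H by rewrite /kp; ring.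
  by rewrite ler_wpM2r ?sqr_ge0// /q'' -mulrA; lra.
have aaH : 0 <= H * a ^+ 2 by rewrite mulr_ge0 ?sqr_ge0.
have T2 : s * q' * a' * a <= 8 * s * kp * (H * a ^+ 2).
  rewrite (_ : s * q' * a' * a = s * a * (q' * a')); last by ring.
  rewrite (_ : 8 * s * kp * (H * a ^+ 2) = s * a * (8 * kp * (a * H))); last by ring.
  by rewrite ler_wpM2l// mulr_ge0 ?ltW.
have T3 : s / 2 * (s / 2 - 1) * q * a' ^+ 2 <= 4 * s * kp * (H * a ^+ 2).
  apply: (@le_trans _ _ (s / 2 * `|q| * a' ^+ 2)).
    apply: ler_wpM2r; first exact: sqr_ge0.
    rewrite -[X in X <= _]mulrA; apply: ler_wpM2l; first by rewrite divr_ge0 ?ltW.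
    apply: (le_trans (ler_norm _)); rewrite normrM; apply: ler_piMl => //.
    by rewrite ler_norml; apply/andP; split; lra.
  rewrite (_ : 4 * s * kp * (H * a ^+ 2) = s / 2 * (kp * a) * (8 * (a * H))); last by field.
  apply: ler_pM; rewrite ?sqr_ge0// ?mulr_ge0 ?invr_ge0 ?(ltW s0)//.
  by rewrite ler_wpM2l// divr_ge0 ?ltW.
have T4 : s / 2 * q * a * a'' <= 2 * s * kp * (H * a ^+ 2).
  have a''0 : 0 <= a'' by rewrite /a''; lra.
  apply: (@le_trans _ _ (s / 2 * (kp * a) * a * (4 * H))); last by rewrite le_eqVlt; apply/orP; left; apply/eqP; field.
  apply: (@le_trans _ _ (s / 2 * (kp * a) * a * a'')).
    apply: ler_wpM2r => //; apply: ler_wpM2r; first exact: ltW.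
    apply: ler_wpM2l; first by rewrite divr_ge0 ?ltW.
    exact: le_trans (ler_norm _) qa.
  rewrite ler_wpM2l//; last by rewrite /a''; lra.
  by rewrite !mulr_ge0 ?invr_ge0 ?(ltW s0) ?(ltW a0)// (le_trans _ kp1).
have : 14 * s * kp * (H * a ^+ 2) <= 28 * s * (H * a ^+ 2).
  by rewrite ler_wpM2r// -mulrA (_ : 28 * s = 14 * (s * 2)) ?ler_wpM2l ?(ltW s0)//; ring.
lra.
Qed.

End bellman.

Section bellman_tangents.
Variable R : realType.
Implicit Types (s e t : R).
Lemma powR_split (x u v : R) : 0 < x -> x `^ (u + v) = x `^ u * x `^ v.
Proof. by move=> x0; apply: powRD; apply/implyP => _; rewrite gt_eqF. Qed.

Lemma is_derive_quad (c0 c1 c2 t : R) :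
  is_derive t 1 (fun t : R => c0 + c1 * t + c2 * t ^+ 2) (c1 + 2 * c2 * t).
Proof.
apply: is_derive_eq; rewrite ?/GRing.scale/= ?expr1; ring.
Qed.

Lemma is_derive_quad_powR (a0 a1 a2 r t : R) : 0 < a0 + a1 * t + a2 * t ^+ 2 ->
  is_derive t 1 (fun t : R => (a0 + a1 * t + a2 * t ^+ 2) `^ r)
    (r * (a0 + a1 * t + a2 * t ^+ 2) `^ (r - 1) * (a1 + 2 * a2 * t)).
Proof.
move=> a_gt0.
exact: (@is_derive1_comp R (fun x : R => x `^ r)
  (fun t : R => a0 + a1 * t + a2 * t ^+ 2) t _ _
  (is_derive1_powR r a_gt0) (is_derive_quad a0 a1 a2 t)).
Qed.

Lemma quad_powR_tangent (q0 q1 q2 a0 a1 a2 r : R) :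
  (forall t, 0 < a0 + a1 * t + a2 * t ^+ 2) ->
  (forall t, let a := a0 + a1 * t + a2 * t ^+ 2 in
     let q := q0 + q1 * t + q2 * t ^+ 2 in
     let q' := q1 + 2 * q2 * t in let a' := a1 + 2 * a2 * t in
     ((2 * q2) * a ^+ 2 + 2 * r * q' * a' * a + r * (r - 1) * q * a' ^+ 2
      + r * q * a * (2 * a2) <= 0 : Prop)) ->
  (q0 + q1 + q2) * (a0 + a1 + a2) `^ r <=
  (q0 + q1) * a0 `^ r + q0 * r * a0 `^ (r - 1) * a1.
Proof.
move=> a_gt0 neg.
pose a t := a0 + a1 * t + a2 * t ^+ 2; pose a' t := a1 + 2 * a2 * t.
pose q t := q0 + q1 * t + q2 * t ^+ 2; pose q' t := q1 + 2 * q2 * t.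
have da r' t : is_derive t 1 (fun t => a t `^ r') (r' * a t `^ (r' - 1) * a' t).
  exact: is_derive_quad_powR.
have dq t : is_derive t 1 q (q' t) by exact: is_derive_quad.
have lin (c d t : R) : is_derive t 1 (fun t : R => c + d * t) d.
  by apply: is_derive_eq; rewrite /GRing.scale/=; ring.
have da' t : is_derive t 1 a' (2 * a2) by exact: lin.
have dq' t : is_derive t 1 q' (2 * q2) by exact: lin.
have := @concave_tangent _ (fun t => q t * a t `^ r)
  (fun t => q' t * a t `^ r + r * (q t * (a t `^ (r - 1) * a' t)))
  (fun t => a t `^ (r - 2) * ((2 * q2) * a t ^+ 2 + 2 * r * q' t * a' t * a t
     + r * (r - 1) * q t * a' t ^+ 2 + r * q t * a t * (2 * a2))).
have E0 : a 0 = a0 by rewrite /a; ring.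
have E1 : a 1 = a0 + a1 + a2 by rewrite /a; ring.
have -> : a' 0 = a1 by rewrite /a'; ring.
have -> : q 0 = q0 by rewrite /q; ring.
have -> : q 1 = q0 + q1 + q2 by rewrite /q; ring.
have -> : q' 0 = q1 by rewrite /q'; ring.
rewrite E0 E1 => H; apply: le_trans (H _ _ _) _; last by rewrite le_eqVlt; apply/orP; left; apply/eqP; ring.
- by move=> t; apply: is_derive_eq; rewrite /GRing.scale/=; ring.
- move=> t; apply: is_derive_eq; rewrite /GRing.scale/=.
  have ta := a_gt0 t; rewrite -/(a t) in ta.
  have P1 : a t `^ (r - 1) = a t `^ (r - 2) * a t.
    have -> : r - 1 = (r - 2) + 1 by ring.
    by rewrite powR_split// powRr1// ltW.
  have P2 : a t `^ r = a t `^ (r - 2) * a t ^+ 2.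
    have {1}-> : r = (r - 2) + 2%:R by ring.
    by rewrite powR_split// powR_mulrn// ltW.
  rewrite (_ : r - 1 - 1 = r - 2); last by ring.
  by rewrite P1 P2; ring.
- by move=> t; rewrite mulr_ge0_le0 ?powR_ge0//; exact: neg.
Qed.

(** Concavity along lines, integrated from t = 0 to t = 1.  The power a^(s/2) need
    not be differentiable where a vanishes, so the inequality is proved with a + e
    in place of a and e tends to 0. *)
Lemma bell_tangent s (x1 x2 y1 y2 h1 h2 k1 k2 : R) :
  0 < s -> s <= 14^-1 -> k1 ^+ 2 + k2 ^+ 2 <= h1 ^+ 2 + h2 ^+ 2 ->
  bell s ((x1 + h1) ^+ 2 + (x2 + h2) ^+ 2) ((y1 + k1) ^+ 2 + (y2 + k2) ^+ 2) <=
  bell s (x1 ^+ 2 + x2 ^+ 2) (y1 ^+ 2 + y2 ^+ 2) + bell_D s x1 x2 y1 y2 h1 h2 k1 k2.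
Proof.
move=> s0 s1 kh; rewrite /bell /bell_D /=.
set a := x1 ^+ 2 + x2 ^+ 2 + (y1 ^+ 2 + y2 ^+ 2).
set b := (x1 + h1) ^+ 2 + (x2 + h2) ^+ 2 + ((y1 + k1) ^+ 2 + (y2 + k2) ^+ 2).
set kp := 1 + 14 * s; set r := s / 2.
set qb := _ - kp * _; set qa := y1 ^+ 2 + y2 ^+ 2 - _.
set q1 := 2 * (y1 * k1 + y2 * k2) - _; set a1 := 2 * (x1 * h1 + _ + _).
have a0 : 0 <= a by rewrite !addr_ge0 ?sqr_ge0.
have b0 : 0 <= b by rewrite !addr_ge0 ?sqr_ge0.
have reg e : 0 < e ->
  qb * (b + e) `^ r <= (qa + q1) * (a + e) `^ r + qa * r * (a + e) `^ (r - 1) * a1.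
  move=> e0.
  pose a2 := h1 ^+ 2 + h2 ^+ 2 + (k1 ^+ 2 + k2 ^+ 2).
  pose q2 := k1 ^+ 2 + k2 ^+ 2 - kp * (h1 ^+ 2 + h2 ^+ 2).
  have Ea t : a + e + a1 * t + a2 * t ^+ 2 = (x1 + t * h1) ^+ 2 + (x2 + t * h2) ^+ 2
      + ((y1 + t * k1) ^+ 2 + (y2 + t * k2) ^+ 2) + e.
    by rewrite /a /a1 /a2; ring.
  have Eq t : qa + q1 * t + q2 * t ^+ 2 = (y1 + t * k1) ^+ 2 + (y2 + t * k2) ^+ 2
      - kp * ((x1 + t * h1) ^+ 2 + (x2 + t * h2) ^+ 2).
    by rewrite /qa /q1 /q2; ring.
  have := @quad_powR_tangent qa q1 q2 (a + e) a1 a2 r.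
  rewrite (_ : a + e + a1 + a2 = b + e); last by rewrite /a /a1 /a2 /b; ring.
  rewrite (_ : qa + q1 + q2 = qb); last by rewrite /qa /q1 /q2 /qb; ring.
  apply=> t; first by rewrite Ea ltr_wpDl ?addr_ge0 ?sqr_ge0.
  rewrite Ea Eq.
  have := @bell_hessian _ s e (x1 + t * h1) (x2 + t * h2) (y1 + t * k1) (y2 + t * k2)
    h1 h2 k1 k2 s0 s1 e0 kh.
  move=> /= H; apply: le_trans H; rewrite le_eqVlt; apply/orP; left; apply/eqP.
  by rewrite /q1 /a1 /q2 /a2 /r -/kp; field.
(* If a = 0, the base point is the origin, and bell is nonpositive at (h, k). *)
have [a_eq0|a_neq0] := eqVneq a 0.
  have S0 (u v : R) : u ^+ 2 + v = 0 -> 0 <= v -> u = 0.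
    move=> uv v0; apply/eqP; rewrite -sqrf_eq0 eq_le sqr_ge0 andbT.
    by rewrite -uv lerDl.
  have x10 : x1 = 0 by apply: (S0 _ (x2 ^+ 2 + (y1 ^+ 2 + y2 ^+ 2))); [rewrite -a_eq0 /a; ring|rewrite !addr_ge0 ?sqr_ge0].
  have x20 : x2 = 0 by apply: (S0 _ (x1 ^+ 2 + (y1 ^+ 2 + y2 ^+ 2))); [rewrite -a_eq0 /a; ring|rewrite !addr_ge0 ?sqr_ge0].
  have y10 : y1 = 0 by apply: (S0 _ (x1 ^+ 2 + (x2 ^+ 2 + y2 ^+ 2))); [rewrite -a_eq0 /a; ring|rewrite !addr_ge0 ?sqr_ge0].
  have y20 : y2 = 0 by apply: (S0 _ (x1 ^+ 2 + (x2 ^+ 2 + y1 ^+ 2))); [rewrite -a_eq0 /a; ring|rewrite !addr_ge0 ?sqr_ge0].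
  have -> : a1 = 0 by rewrite /a1 x10 x20 y10 y20; ring.
  have -> : q1 = 0 by rewrite /q1 x10 x20 y10 y20; ring.
  have -> : qa = 0 by rewrite /qa x10 x20 y10 y20; ring.
  rewrite !mul0r !addr0 mulr_le0_ge0 ?powR_ge0//.
  rewrite /qb x10 x20 y10 y20 !add0r subr_le0 (le_trans kh)//.
  by rewrite ler_peMl ?addr_ge0 ?sqr_ge0// /kp lerDl mulr_ge0// ltW.
have a_gt0 : 0 < a by rewrite lt_neqAle eq_sym a_neq0.
have cvgp (c u : R) : 0 < c -> (c + e) `^ u @[e --> 0^'+] --> c `^ u.
  move=> c0; apply: cvg_at_right_filter; rewrite -{2}[c]addr0.
  apply: (@continuous_comp _ _ _ (fun e => c + e) (fun x => x `^ u)).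
    by apply: continuousD; [exact: cst_continuous|exact: id].
  apply/differentiable_continuous/derivable1_diffP.
  have c0' : 0 < c + 0 by rewrite addr0.
  exact: (@ex_derive _ _ _ _ _ _ _ (is_derive1_powR u c0')).
have qbb : b = 0 -> qb = 0.
  move=> bz; have Y0 : 0 <= (y1 + k1) ^+ 2 + (y2 + k2) ^+ 2 by rewrite addr_ge0 ?sqr_ge0.
  have X0 : 0 <= (x1 + h1) ^+ 2 + (x2 + h2) ^+ 2 by rewrite addr_ge0 ?sqr_ge0.
  have Yz : (y1 + k1) ^+ 2 + (y2 + k2) ^+ 2 = 0.
    by apply/eqP; rewrite eq_le Y0 andbT -bz lerDr.
  have Xz : (x1 + h1) ^+ 2 + (x2 + h2) ^+ 2 = 0.
    by apply/eqP; rewrite eq_le X0 andbT -bz lerDl.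
  by rewrite /qb Yz Xz; ring.
have lhs : qb * (b + e) `^ r @[e --> 0^'+] --> qb * b `^ r.
  have [bz|bnz] := eqVneq b 0.
    by rewrite qbb// mul0r; under eq_fun do rewrite mul0r; exact: cvg_cst.
  by apply: cvgM; [exact: cvg_cst|apply: cvgp; rewrite lt_neqAle eq_sym bnz].
have rhs : (qa + q1) * (a + e) `^ r + qa * r * (a + e) `^ (r - 1) * a1 @[e --> 0^'+]
    --> (qa + q1) * a `^ r + qa * r * a `^ (r - 1) * a1.
  apply: cvgD; first by apply: cvgM; [exact: cvg_cst|exact: cvgp].
  apply: cvgM; last exact: cvg_cst.
  by apply: cvgM; [exact: cvg_cst|exact: cvgp].
apply: (@le_trans _ _ ((qa + q1) * a `^ r + qa * r * a `^ (r - 1) * a1)); last first.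
  by rewrite le_eqVlt; apply/orP; left; apply/eqP; ring.
apply: (ler_cvg_to lhs rhs); near=> e; apply: reg.
by near: e; exact: nbhs_right_gt.
Unshelve. all: by end_near. Qed.
End bellman_tangents.

(** * Normed spaces, operator norms and duals *)

Section normed_spaces.
Context {R : realType} {K : scalars R}.
Hypothesis ok : scalars_ok K.

Record normed (S : space K) : Prop := Normed {
  nmem : linear_subspace (@mem _ _ S);
  nrmD : forall x y : S, mem x -> mem y -> nrm (x + y) <= nrm x + nrm y;
  nrmZ : forall (a : K) (x : S), mem x -> nrm (a *: x) = smod a * nrm x;
  nrm_eq0 : forall x : S, mem x -> nrm x = 0 -> x = 0 }.

Section one_space.
Variable S : space K.
Hypothesis nS : normed S.
Implicit Types (x y : S) (a : K).

Lemma mem0 : mem (0 : S).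
Proof. by case: (nmem nS). Qed.

Lemma memZD a x y : mem x -> mem y -> mem (a *: x + y).
Proof. by case: (nmem nS) => _; apply. Qed.

Lemma memD x y : mem x -> mem y -> mem (x + y).
Proof. by move=> mx my; rewrite -[x]scale1r; exact: memZD. Qed.

Lemma memZ a x : mem x -> mem (a *: x).
Proof. by move=> mx; rewrite -[X in mem X]addr0; apply: memZD => //; exact: mem0. Qed.

Lemma memN x : mem x -> mem (- x).
Proof. by move=> mx; rewrite -scaleN1r; exact: memZ. Qed.

Lemma memB x y : mem x -> mem y -> mem (x - y).
Proof. by move=> mx my; apply: memD => //; exact: memN. Qed.

Lemma mem_sum (I : Type) (r : seq I) (P : pred I) (F : I -> S) :
  (forall i, mem (F i)) -> mem (\sum_(i <- r | P i) F i).
Proof. by move=> mF; elim/big_ind : _ => //; [exact: mem0|exact: memD]. Qed.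

Lemma nrm0 : nrm (0 : S) = 0.
Proof. by rewrite -(scale0r (0 : S)) nrmZ ?smod0 ?mul0r//; exact: mem0. Qed.

Lemma nrmN x : mem x -> nrm (- x) = nrm x.
Proof. by move=> mx; rewrite -scaleN1r nrmZ// smodN// smod1// mul1r. Qed.

Lemma nrm_ge0 x : mem x -> 0 <= nrm x.
Proof.
move=> mx; have := nrmD nS mx (memN mx); rewrite subrr nrm0 nrmN//.
by rewrite -mulr2n pmulrn_lge0.
Qed.

Lemma nrm_gt0 x : mem x -> x <> 0 -> 0 < nrm x.
Proof.
move=> mx x0; rewrite lt_neqAle nrm_ge0// andbT eq_sym; apply/eqP => h.
by apply: x0; exact: nrm_eq0.
Qed.

Lemma nrmB x y : mem x -> mem y -> nrm (x - y) <= nrm x + nrm y.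
Proof. by move=> mx my; rewrite -(nrmN my); apply: nrmD => //; exact: memN. Qed.

Lemma nrm_sum (I : Type) (r : seq I) (F : I -> S) :
  (forall i, mem (F i)) -> nrm (\sum_(i <- r) F i) <= \sum_(i <- r) nrm (F i).
Proof.
move=> mF; elim: r => [|i r ih]; first by rewrite !big_nil nrm0.
by rewrite !big_cons; apply: le_trans (nrmD nS _ _) _ => //; [exact: mem_sum|rewrite lerD2l].
Qed.

Lemma converges_toP (u : nat -> S) x : (forall m, mem (u m)) -> mem x ->
  converges_to u x <->
  forall e : R, 0 < e -> exists N, forall m, (N <= m)%N -> nrm (x - u m) <= e.
Proof.
move=> mu mx.
have h m : `|0 - nrm (x - u m)| = nrm (x - u m).
  by rewrite sub0r normrN ger0_norm// nrm_ge0//; exact: memB.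
split=> [/cvgrPdist_le cu e /cu[N _ Nu]|cu].
  by exists N => m Nm; rewrite -h; exact: Nu.
apply/cvgrPdist_le => e /cu[N Nu]; exists N => // m Nm /=.
by rewrite h; exact: Nu.
Qed.

End one_space.

Lemma le_opnorm (S T : space K) (f : S -> T) (C : R) : 0 <= C ->
  (forall x, mem x -> nrm (f x) <= C * nrm x) -> (opnorm f <= C%:E)%E.
Proof.
move=> C0 h; apply: ge_ereal_sup => _ [x [mx x1] <-]; rewrite lee_fin.
by rewrite (le_trans (h _ mx))// ler_piMr.
Qed.

(** What turns a bound for an operator norm into an inequality for all vectors; for
    E(n,p) this is read off from the integral. *)
Definition seminormed_scaling (S : space K) : Prop :=
  forall (a : K) (x : S), mem x ->
    [/\ mem (a *: x), nrm (a *: x) = smod a * nrm x & 0 <= nrm x].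

Lemma normed_scaling (S : space K) : normed S -> seminormed_scaling S.
Proof. by move=> nS a x mx; split; [exact: memZ|exact: nrmZ|exact: nrm_ge0]. Qed.

Lemma opnorm_le (S T : space K) (f : S -> T) (C : R) :
  seminormed_scaling S -> seminormed_scaling T ->
  (forall x, mem x -> mem (f x)) ->
  (forall (a : K) x, mem x -> f (a *: x) = a *: f x) ->
  (opnorm f <= C%:E)%E -> forall x, mem x -> nrm (f x) <= C * nrm x.
Proof.
move=> sS sT mf fZ fC x mx.
have key (a : K) : smod a * nrm x <= 1 -> smod a * nrm (f x) <= C.
  move=> a1; have [max nax _] := sS a x mx; have [_ nafx _] := sT a _ (mf _ mx).
  rewrite -nafx -fZ// -lee_fin; apply: le_trans fC; apply: ereal_sup_ubound.
  by exists (a *: x) => //; split=> //; rewrite nax.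
have [_ _ x0] := sS 1 x mx; have [_ _ fx0] := sT 1 _ (mf _ mx).
have [xz|xnz] := eqVneq (nrm x) 0.
  rewrite xz mulr0 leNgt; apply/negP => fx_gt0.
  have C0 : 0 <= C.
    by have := key 0; rewrite smod0// !mul0r; apply.
  have := key (sinj K ((C + 1) / nrm (f x))).
  rewrite xz mulr0 smod_inj// ger0_norm ?divr_ge0 ?addr_ge0//.
  by rewrite divfK ?gt_eqF// => /(_ ler01); rewrite gerDl leNgt ltr01.
have x_gt0 : 0 < nrm x by rewrite lt_neqAle eq_sym xnz.
have := key (sinj K (nrm x)^-1); rewrite smod_inj// ger0_norm ?invr_ge0//.
by rewrite mulVf// => /(_ (lexx _)); rewrite mulrC ler_pdivrMr.
Qed.

Section dual_space.
Variable S : space K.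
Hypothesis nS : normed S.
Implicit Types (f g : dual S) (x y : S).

Lemma dual_lin f (a : K) x y : mem f -> mem x -> mem y ->
  f (a *: x + y) = a * f x + f y.
Proof. by move=> [fl _ _]; exact: fl. Qed.

Lemma dualD f x y : mem f -> mem x -> mem y -> f (x + y) = f x + f y.
Proof. by move=> mf mx my; rewrite -[x]scale1r dual_lin// mul1r scale1r. Qed.

Lemma dual0 f : mem f -> f 0 = 0.
Proof.
move=> mf; have := dualD mf (mem0 nS) (mem0 nS); rewrite addr0 => /eqP.
by rewrite -subr_eq0 opprD addrA subrr sub0r oppr_eq0 => /eqP.
Qed.

Lemma dualZ f (a : K) x : mem f -> mem x -> f (a *: x) = a * f x.
Proof.
move=> mf mx; rewrite -[X in f X]addr0 dual_lin// ?dual0// ?addr0//.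
exact: mem0.
Qed.

Lemma dualB f x y : mem f -> mem x -> mem y -> f (x - y) = f x - f y.
Proof.
move=> mf mx my; rewrite dualD//; last exact: memN.
by rewrite -scaleN1r dualZ// mulN1r.
Qed.

Lemma dual_sum f (I : Type) (r : seq I) (F : I -> S) : mem f ->
  (forall i, mem (F i)) -> f (\sum_(i <- r) F i) = \sum_(i <- r) (f (F i) : K).
Proof.
move=> mf mF; elim: r => [|i r ih]; first by rewrite !big_nil dual0.
by rewrite !big_cons dualD// ?ih//; exact: mem_sum.
Qed.

Lemma le_dual_nrm f (C : R) : 0 <= C ->
  (forall x, mem x -> smod (f x) <= C * nrm x) -> nrm f <= C.
Proof.
move=> C0 h; apply: ge_sup.
  by exists (smod (f 0)), 0 => //; split; [exact: mem0|rewrite nrm0].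
by move=> _ [x [mx x1] <-]; rewrite (le_trans (h _ mx))// ler_piMr.
Qed.

Lemma smod_dual_le f x : mem f -> mem x -> smod (f x) <= nrm f * nrm x.
Proof.
move=> mf mx; have [fl f0 [C hC]] := mf.
have ub : has_ubound [set smod (f y) | y in @unit_ball _ _ S].
  exists `|C| => _ [y [my y1] <-]; rewrite (le_trans (hC _ my))//.
  rewrite (le_trans (ler_norm _))// normrM (ger0_norm (nrm_ge0 nS my)).
  by rewrite ler_piMr.
have [->|x0] := eqVneq x 0; first by rewrite dual0// smod0// nrm0// mulr0.
have x_gt0 : 0 < nrm x by apply: nrm_gt0 => //; exact/eqP.
rewrite -ler_pdivrMr//; apply: (ub_le_sup ub).
have mz : mem (sinj K (nrm x)^-1 *: x) by exact: memZ.
have zE : smod (sinj K (nrm x)^-1) = (nrm x)^-1.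
  by rewrite smod_inj// ger0_norm// invr_ge0 ltW.
exists (sinj K (nrm x)^-1 *: x).
  by split=> //; rewrite nrmZ// zE mulVf// gt_eqF.
by rewrite dualZ// smodM// zE mulrC.
Qed.

Lemma dual_nrm_ge0 f : mem f -> 0 <= nrm f.
Proof.
move=> mf; have [fl f0 [C hC]] := mf.
apply: ub_le_sup; last first.
  exists 0; first by split; [exact: mem0|rewrite nrm0].
  by rewrite dual0// smod0.
exists `|C| => _ [y [my y1] <-]; rewrite (le_trans (hC _ my))//.
rewrite (le_trans (ler_norm _))// normrM (ger0_norm (nrm_ge0 nS my)).
by rewrite ler_piMr.
Qed.

Lemma dual_out f x : mem f -> ~ mem x -> f x = 0.
Proof. by move=> [_ + _]; apply. Qed.

Lemma dual_ext f g : mem f -> mem g -> (forall x, mem x -> f x = g x) -> f = g.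
Proof.
move=> mf mg h; apply/funext => x.
by have [/h//|nx] := pselect (mem x); rewrite !dual_out.
Qed.

Lemma dual_ev0 x : (0 : dual S) x = 0. Proof. by []. Qed.

Lemma dual_evD f g x : (f + g) x = f x + g x. Proof. by []. Qed.

Lemma dual_evZ (a : K) f x : (a *: f) x = a * f x. Proof. by []. Qed.

Lemma dual_ev_sum (I : Type) (r : seq I) (F : I -> dual S) x :
  (\sum_(i <- r) F i) x = \sum_(i <- r) (F i x : K).
Proof.
by elim: r => [|i r ih]; rewrite ?big_nil// !big_cons dual_evD ih.
Qed.

Lemma normed_dual : normed (dual S).
Proof.
have lin : linear_subspace (@mem _ _ (dual S)).
  split.
    split=> //; first by move=> a x y _ _; rewrite !dual_ev0 scaler0 addr0.
    by exists 0 => x mx; rewrite dual_ev0 smod0// mul0r.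
  move=> a f g mf mg; split.
  - move=> b x y mx my; rewrite !dual_evD !dual_evZ !dual_lin//.
    rewrite /GRing.scale/= !mulrDr !addrA; congr (_ + _).
    by rewrite addrAC; congr (_ + _ + _); rewrite mulrCA.
  - by move=> x nx; rewrite dual_evD dual_evZ !dual_out// mulr0 addr0.
  - exists (smod a * nrm f + nrm g) => x mx; rewrite dual_evD dual_evZ.
    rewrite (le_trans (ler_smodD ok _ _))// mulrDl lerD ?smod_dual_le//.
    by rewrite smodM// -mulrA ler_wpM2l ?smod_ge0 ?smod_dual_le.
split=> //.
- move=> f g mf mg; apply: le_dual_nrm; first by rewrite addr_ge0 ?dual_nrm_ge0.
  move=> x mx; rewrite dual_evD (le_trans (ler_smodD ok _ _))// mulrDl lerD//;
  exact: smod_dual_le.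
- move=> a f mf.
  have maf : mem (a *: f : dual S).
    by rewrite -[X in mem X]addr0; case: lin => l0 l1; exact: l1.
  apply/eqP; rewrite eq_le; apply/andP; split.
    apply: le_dual_nrm; first by rewrite mulr_ge0 ?smod_ge0 ?dual_nrm_ge0.
    move=> x mx; rewrite dual_evZ smodM// -mulrA ler_wpM2l ?smod_ge0//.
    exact: smod_dual_le.
  have [->|a0] := eqVneq a 0; first by rewrite smod0// mul0r scale0r dual_nrm_ge0//; case: lin.
  have sa : 0 < smod a.
    rewrite lt_neqAle smod_ge0// andbT eq_sym; apply/eqP => h.
    by move: a0; rewrite (smod_eq0 ok h) eqxx.
  rewrite mulrC -ler_pdivlMr//; apply: le_dual_nrm.
    by rewrite divr_ge0 ?dual_nrm_ge0// ltW.
  move=> x mx; rewrite mulrAC ler_pdivlMr// mulrC -smodM//.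
  exact: (smod_dual_le maf).
- move=> f mf f0; apply: dual_ext => //; first by case: lin.
  move=> x mx; apply: (smod_eq0 ok); apply/eqP; rewrite eq_le smod_ge0// andbT.
  by rewrite (le_trans (smod_dual_le mf mx))// f0 mul0r.
Qed.

End dual_space.
End normed_spaces.

(** * Bases and their duals *)

Section basis_systems.
Context {R : realType} {K : scalars R}.
Hypothesis ok : scalars_ok K.

Definition psum (S : space K) (b : nat -> S) (c : nat -> S -> K^o) (m : nat) (x : S) : S :=
  \sum_(i < m) c i x *: b i.

(** The clauses are quantitative forms of the properties of a good basis, chosen so
    that the dual system satisfies them as well: [bs_shrink] on S is [bs_cvg] on
    the dual, [bs_bdd] together with [bs_shrink] makes the space reflexive and so
    gives [bs_shrink] on the dual, and [bs_cond] asks for finite multipliers of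
    modulus at most 1, which act on the dual by the same coefficients. *)
Record basis_system (S : space K) (b : nat -> S) (c : nat -> S -> K^o) : Prop :=
  BasisSystem {
  bs_normed : normed S;
  bs_mem : forall i, mem (b i);
  bs_lin : forall i, linear_on (@mem _ _ S) (c i);
  bs_bio : forall i k, c i (b k) = (i == k)%:R;
  bs_bound : exists2 C : R, 0 <= C & forall m x, mem x -> nrm (psum b c m x) <= C * nrm x;
  bs_asym : forall e : R, 0 < e -> exists N, forall m, (N <= m)%N ->
    forall x, mem x -> nrm (psum b c m x) <= (1 + e) * nrm x;
  bs_cvg : forall x, mem x -> forall e : R, 0 < e ->
    exists N, forall m, (N <= m)%N -> nrm (x - psum b c m x) <= e;
  bs_shrink : forall f : dual S, mem f -> forall e : R, 0 < e ->
    exists N, forall m, (N <= m)%N ->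
    forall x, mem x -> smod (f (x - psum b c m x)) <= e * nrm x;
  bs_bdd : forall a : nat -> K,
    (exists C : R, forall m, nrm (\sum_(i < m) a i *: b i) <= C) ->
    exists2 x, mem x & forall i, c i x = a i;
  bs_cond : forall C : R, exists (s : seq nat) (t : nat -> K) (x : S),
    [/\ uniq s, forall i, smod (t i) <= 1, mem x &
        C * nrm x < nrm (\sum_(i <- s) (t i * c i x) *: b i)] }.

Section good.
Variables (S : space K) (b : nat -> S) (c : nat -> S -> K^o).
Hypothesis bs : basis_system b c.
Let nS := bs_normed bs.
Let mb := bs_mem bs.

Lemma mem_psum m x : mem (psum b c m x).
Proof. by apply: mem_sum => // i; exact: memZ. Qed.

Lemma coordD i x y : mem x -> mem y -> c i (x + y) = c i x + c i y.
Proof. by move=> mx my; rewrite -[x]scale1r (bs_lin bs)// scale1r -[1 *: _]/(1 * _) mul1r. Qed.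

Lemma coord0 i : c i 0 = 0.
Proof.
have := coordD i (mem0 nS) (mem0 nS); rewrite addr0 => /eqP.
by rewrite -subr_eq0 opprD addrA subrr sub0r oppr_eq0 => /eqP.
Qed.

Lemma coordZ i (a : K) x : mem x -> c i (a *: x) = a * c i x.
Proof.
move=> mx; rewrite -[X in c i X]addr0 (bs_lin bs)// ?coord0 ?addr0//.
exact: mem0.
Qed.

Lemma coordB i x y : mem x -> mem y -> c i (x - y) = c i x - c i y.
Proof.
move=> mx my; rewrite coordD//; last exact: memN.
by rewrite -scaleN1r coordZ// mulN1r.
Qed.

Lemma coord_sum i (s : seq nat) (a : nat -> K) : uniq s ->
  c i (\sum_(k <- s) a k *: b k) = if i \in s then a i else 0.
Proof.
elim: s => [|k s ih]; first by rewrite big_nil coord0.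
rewrite big_cons /= => /andP[ks us]; rewrite coordD ?coordZ//.
- rewrite ih// (bs_bio bs) inE; have [->|ik] := eqVneq i k.
    by rewrite (negPf ks) mulr1 addr0.
  by rewrite mulr0 add0r.
- exact: memZ.
- by apply: mem_sum => // l; exact: memZ.
Qed.

Lemma coord_sum_ord i m (a : nat -> K) :
  c i (\sum_(k < m) a k *: b k) = if (i < m)%N then a i else 0.
Proof.
rewrite -(big_mkord xpredT (fun k => a k *: b k)) coord_sum ?iota_uniq//.
by rewrite mem_index_iota.
Qed.

Lemma basis_neq0 i : b i <> 0.
Proof.
move=> bi; have := bs_bio bs i i; rewrite bi coord0 eqxx => /esym/eqP.
by rewrite oner_eq0.
Qed.

Lemma coord_bounded i : exists2 C : R, 0 <= C & forall x, mem x -> smod (c i x) <= C * nrm x.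
Proof.
have [C C0 hC] := bs_bound bs.
have bi0 : 0 < nrm (b i) by apply: nrm_gt0 => //; exact: basis_neq0.
exists ((C + C) / nrm (b i)); first by rewrite divr_ge0 ?addr_ge0 ?(ltW bi0).
move=> x mx; rewrite mulrAC ler_pdivlMr// -nrmZ//.
have -> : c i x *: b i = psum b c i.+1 x - psum b c i x.
  by rewrite /psum big_ord_recr/= addrAC subrr add0r.
rewrite (le_trans (nrmB ok nS _ _))//; try exact: mem_psum.
by rewrite mulrDl lerD ?hC.
Qed.

Lemma expands_coord x : mem x -> expands b (fun i => c i x) x.
Proof.
move=> mx; apply/(converges_toP ok nS) => //; first by move=> m; exact: mem_psum.
exact: bs_cvg.
Qed.

(** The biorthogonal functionals are bounded, so they may be applied to the
    convergent partial sums. *)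
Lemma expands_inj x (a : nat -> K) : mem x -> expands b a x -> forall i, a i = c i x.
Proof.
move=> mx ax i; have [C C0 hC] := coord_bounded i.
have mp m : mem (\sum_(i < m) a i *: b i).
  by apply: mem_sum => // k; exact: memZ.
apply/esym/eqP; rewrite -subr_eq0; apply/eqP/(smod_eq0 ok)/eqP.
rewrite eq_le smod_ge0// andbT; apply/ler_addgt0Pl => e e0; rewrite addr0.
have C1 : 0 < C + 1 by rewrite ltr_wpDl.
move/(converges_toP ok nS mp mx)/(_ _ (divr_gt0 e0 C1)) : ax => [N hN].
have := hN (maxn N i.+1) (leq_maxl _ _).
set m := maxn _ _ => h; have im : (i < m)%N by rewrite leq_maxr.
have -> : c i x - a i = c i (x - \sum_(i < m) a i *: b i).
  by rewrite coordB// coord_sum_ord im.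
rewrite (le_trans (hC _ _))//; first exact: memB.
rewrite (le_trans (ler_wpM2l C0 h))// mulrA ler_pdivrMr// mulrC ler_wpM2l ?(ltW e0)//.
by rewrite lerDl.
Qed.

Lemma coordfE i x : mem x -> coordf b i x = c i x.
Proof.
move=> mx; rewrite /coordf asboolT//.
case: xgetP => [a _ /= ax|/(_ (fun k => c k x))/=]; last by case; exact: expands_coord.
exact: expands_inj.
Qed.

Lemma coordf_out i x : ~ mem x -> coordf b i x = 0.
Proof. by move=> mx; rewrite /coordf asboolF. Qed.

Lemma mem_coordf i : mem (coordf b i : dual S).
Proof.
split.
- by move=> a x y mx my; rewrite !coordfE ?(bs_lin bs)//; exact: memZD.
- by move=> x nx; exact: coordf_out.
- by have [C _ hC] := coord_bounded i; exists C => x mx; rewrite coordfE// hC.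
Qed.

Lemma partial_sumE m x : mem x -> partial_sum b m x = psum b c m x.
Proof. by move=> mx; apply: eq_bigr => i _; rewrite coordfE. Qed.

Lemma dual_psum (f : dual S) m x : mem f -> mem x ->
  f (psum b c m x) = \sum_(i < m) c i x * f (b i).
Proof.
move=> mf mx; rewrite /psum (dual_sum nS)//.
- by apply: eq_bigr => i _; rewrite (dualZ nS).
- by move=> i; exact: memZ.
Qed.

Lemma schauder_system : schauder_basis b.
Proof.
split=> // x mx; exists (fun i => c i x); split; first exact: expands_coord.
by move=> a ax; apply/funext => i; rewrite (expands_inj mx ax).
Qed.

Lemma conditional_system : ~ unconditional b.
Proof.
move=> [C hC]; have [s [t [x [us t1 mx]]]] := bs_cond bs (Num.max C 0).
rewrite ltNge => /negP; apply.
have h := hC s t us t1.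
have hmx : (@opnorm _ _ S S (multiplier b (coordf b) s t) <= (Num.max C 0)%:E)%E.
  by rewrite (le_trans h)// lee_fin le_max lexx.
have := opnorm_le ok (normed_scaling ok nS) (normed_scaling ok nS) _ _ hmx mx.
have -> : multiplier b (coordf b) s t x = \sum_(i <- s) (t i * c i x) *: b i.
  by apply: eq_bigr => i _; rewrite coordfE.
apply.
- by move=> y my; apply: mem_sum => // i; exact: memZ.
- move=> a y my; rewrite /multiplier scaler_sumr; apply: eq_bigr => i _.
  by rewrite !coordfE//; [rewrite coordZ// mulrCA scalerA|exact: memZ].
Qed.

Lemma shrinking_system : shrinking b.
Proof.
move=> f mf e e0; have e2 : 0 < e / 2 by rewrite divr_gt0.
have [N /(_ N (leqnn N)) hN] := bs_shrink bs mf e2.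
exists N, (fun i => f (b i)); apply: (@le_lt_trans _ _ (e / 2)); last first.
  by rewrite ltr_pdivrMr// ltr_pMr// ltr1n.
apply: (le_dual_nrm ok nS); first exact: ltW.
move=> x mx; rewrite (le_trans _ (hN _ mx))// (dualB nS)//; last exact: mem_psum.
rewrite dual_psum// -scaleN1r dual_evD dual_evZ mulN1r dual_ev_sum.
rewrite le_eqVlt; apply/orP; left; apply/eqP; congr (smod (_ - _)).
by apply: eq_bigr => i _; rewrite dual_evZ coordfE// mulrC.
Qed.

Lemma boundedly_complete_system : boundedly_complete b.
Proof.
move=> a /(bs_bdd bs)[x mx xa]; exists x; split=> //.
have -> : a = fun i => c i x by apply/funext.
exact: expands_coord.
Qed.

(** The norms are at least 1 from the index 1 on, since the first basis vector is
    fixed; the upper bound is [bs_asym]. *)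
Lemma asymptotically_monotone_system : asymptotically_monotone b.
Proof.
have mem_ps m x : mem x -> mem (partial_sum b m x).
  by move=> mx; rewrite partial_sumE//; exact: mem_psum.
have b00 : 0 < nrm (b 0%N) by apply: nrm_gt0 => //; exact: basis_neq0.
have lb m : (1 <= m)%N -> (1%E <= @opnorm _ _ S S (partial_sum b m))%E.
  move=> m1; rewrite leNgt; apply/negP => h.
  pose z := sinj K (nrm (b 0%N))^-1 *: b 0%N.
  have mz : mem z by exact: memZ.
  have nz : nrm z = 1.
    by rewrite nrmZ// smod_inj// ger0_norm ?invr_ge0 ?(ltW b00)// mulVf// gt_eqF.
  have : ((nrm (partial_sum b m z))%:E <= @opnorm _ _ S S (partial_sum b m))%E.
    by apply: ereal_sup_ubound; exists z => //; split=> //; rewrite nz.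
  move=> /le_lt_trans/(_ h); rewrite lte_fin partial_sumE//.
  suff -> : psum b c m z = z by rewrite nz ltxx.
  rewrite /psum (bigD1 (Ordinal m1))//= big1 ?addr0.
    by rewrite /z coordZ// (bs_bio bs) eqxx mulr1.
  move=> i i0; rewrite /z coordZ// (bs_bio bs) (_ : (nat_of_ord i == 0)%N = false) ?mulr0 ?scale0r//.
  by apply/negbTE; move: i0; apply: contra => /eqP i0; apply/eqP/val_inj.
have ub (e : R) : 0 < e -> exists N, forall m, (N <= m)%N ->
    (@opnorm _ _ S S (partial_sum b m) <= (1 + e)%:E)%E.
  move=> e0; have [N hN] := bs_asym bs e0; exists N => m Nm.
  apply: le_opnorm; first by rewrite addr_ge0// ltW.
  by move=> x mx; rewrite partial_sumE// hN.
have fin : \forall m \near \oo, @opnorm _ _ S S (partial_sum b m) \is a fin_num.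
  have [N hN] := ub 1 ltr01; exists (maxn N 1) => // m; rewrite /= geq_max => /andP[Nm m1].
  rewrite fin_numElt (lt_le_trans _ (lb m m1)) ?ltNyr//=.
  exact: le_lt_trans (hN m Nm) (ltry _).
apply/fine_cvgP; split=> //; apply/cvgrPdist_le => e e0.
have [N hN] := ub e e0; near=> m.
have m1 : (1 <= m)%N by near: m; exists 1%N.
have Nm : (N <= m)%N by near: m; exists N.
have fm : @opnorm _ _ S S (partial_sum b m) \is a fin_num by near: m.
have := lb m m1; have := hN m Nm; rewrite /= -(fineK fm) !lee_fin => h1 h2.
by rewrite distrC ger0_norm ?subr_ge0// lerBlDl.
Unshelve. all: by end_near. Qed.

Theorem good_system : has_good_bases S.
Proof.
have g : good_basis b.
  split; [exact: schauder_system|exact: conditional_system|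
          exact: shrinking_system|exact: boundedly_complete_system].
by split; exists b => //; split=> //; exact: asymptotically_monotone_system.
Qed.

End good.

Section dual_system.
Variables (S : space K) (b : nat -> S) (c : nat -> S -> K^o).
Hypothesis bs : basis_system b c.
Hypothesis norming : forall (s : seq nat) (a : nat -> K),
  let y := \sum_(i <- s) a i *: b i in
  exists f : dual S, [/\ mem f, nrm f <= 1 & smod (f y) = nrm y].
Let nS := bs_normed bs.
Let mb := bs_mem bs.
Let b' i : dual S := coordf b i.
Let c' i : dual S -> K^o := fun f => f (b i).

Lemma dual_psumE m (f : dual S) x : mem f -> mem x ->
  psum b' c' m f x = f (psum b c m x).
Proof.
move=> mf mx; rewrite (dual_psum bs)// /psum dual_ev_sum; apply: eq_bigr => i _.
by rewrite dual_evZ /b' (coordfE bs)// mulrC.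
Qed.

(** Reflexivity: the coefficients phi(b'_i) have bounded partial sums in S, since
    these are normed by functionals of the dual, and by bounded completeness they
    define x; phi and x agree on all functionals because the basis is shrinking. *)
Lemma bidual_bdd (phi : dual (dual S)) : mem phi ->
  exists2 x, mem x & forall f : dual S, mem f -> phi f = f x.
Proof.
move=> mphi; have nD := normed_dual ok nS; have mb' := mem_coordf bs.
have [C C0 hC] := bs_bound bs.
have phi_psum m f : mem f ->
    phi (psum b' c' m f) = f (\sum_(i < m) phi (b' i) *: b i).
  move=> mf; rewrite /psum (dual_sum nD)//; last by move=> i; exact: memZ.
  rewrite (dual_sum nS)//; last by move=> i; exact: memZ.
  by apply: eq_bigr => i _; rewrite (dualZ nD)// (dualZ nS)// mulrC.
have psum_le m f : mem f -> nrm (psum b' c' m f) <= C * nrm f.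
  move=> mf; apply: (le_dual_nrm ok nS); first by rewrite mulr_ge0// (dual_nrm_ge0 ok nS).
  move=> x mx; rewrite dual_psumE// (le_trans (smod_dual_le ok nS mf (mem_psum bs m x)))//.
  rewrite [C * _]mulrC -mulrA ler_wpM2l ?(dual_nrm_ge0 ok nS)//; exact: hC.
have mem_psum' m f : mem (psum b' c' m f) by apply: mem_sum => // i; exact: memZ.
have [|x mx hx] := bs_bdd bs (a := fun i => phi (b' i)).
  exists (nrm phi * C) => m.
  have [f [mf f1]] := norming (index_iota 0 m) (fun i => phi (b' i)).
  rewrite big_mkord => <-; rewrite -phi_psum//.
  rewrite (le_trans (smod_dual_le ok nD mphi (mem_psum' m f)))//.
  rewrite ler_wpM2l ?(dual_nrm_ge0 ok nD)// (le_trans (psum_le m f mf))//.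
  by rewrite ler_piMr.
exists x => // f mf; apply/eqP; rewrite -subr_eq0; apply/eqP/(smod_eq0 ok)/eqP.
rewrite eq_le smod_ge0// andbT; apply/ler_addgt0Pl => e e0; rewrite addr0.
pose e' := e / (nrm phi + nrm x + 1).
have p0 := dual_nrm_ge0 ok nD mphi; have x0 := nrm_ge0 ok nS mx.
have d0 : 0 < nrm phi + nrm x + 1 by rewrite ltr_wpDl// addr_ge0.
have e'0 : 0 < e' by rewrite divr_gt0.
have [N /(_ N (leqnn N)) hN] := bs_shrink bs mf e'0.
have E : phi (psum b' c' N f) = f (psum b c N x).
  rewrite phi_psum// /psum; congr (f _).
  by apply: eq_bigr => i _; rewrite hx.
have -> : phi f - f x = phi (f - psum b' c' N f) - f (x - psum b c N x).
  rewrite (dualB nD)// (dualB nS)//; last exact: (mem_psum bs).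
  by rewrite E opprB addrA subrK.
rewrite (le_trans (ler_smodD ok _ _))// smodN//.
have h1 : smod (phi (f - psum b' c' N f)) <= nrm phi * e'.
  rewrite (le_trans (smod_dual_le ok nD mphi (memB nD mf (mem_psum' N f))))//.
  rewrite ler_wpM2l//; apply: (le_dual_nrm ok nS); first exact: ltW.
  move=> y my; rewrite (le_trans _ (hN _ my))// (dualB nS)//; last exact: (mem_psum bs).
  by rewrite -scaleN1r dual_evD dual_evZ mulN1r dual_psumE.
rewrite (le_trans (lerD h1 (hN _ mx)))// [e' * _]mulrC -mulrDl /e' mulrCA.
by rewrite ger_pMr// ler_pdivrMr// mul1r lerDl.
Qed.

(** The partial sums g_m are bounded, and eventually constant on finite sums of basis
    vectors, which are dense; so they converge pointwise, and the limit is f. *)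
Lemma dual_bdd (a : nat -> K) :
  (exists C : R, forall m, nrm (\sum_(i < m) a i *: b' i) <= C) ->
  exists2 f, mem f & forall i, c' i f = a i.
Proof.
move=> [C hC]; have nD := normed_dual ok nS; have mb' := mem_coordf bs.
pose g m : dual S := \sum_(i < m) a i *: b' i.
have mg m : mem (g m) by apply: mem_sum => // i; exact: memZ.
have C0 : 0 <= C := le_trans (dual_nrm_ge0 ok nS (mg 0)) (hC 0).
have gE m x : mem x -> g m x = \sum_(i < m) a i * c i x.
  move=> mx; rewrite /g dual_ev_sum; apply: eq_bigr => i _.
  by rewrite dual_evZ /b' (coordfE bs).
have gP m M x : (m <= M)%N -> mem x -> g m x = g m (psum b c M x).
  move=> mM mx; rewrite !gE//; last exact: (mem_psum bs).
  apply: eq_bigr => i _; rewrite /psum (coord_sum_ord bs i M (fun k => c k x)).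
  by rewrite (leq_trans (ltn_ord i)).
have gmM m M x : (m <= M)%N -> mem x -> g M (psum b c m x) = g m x.
  move=> mM mx; rewrite gE//; last exact: (mem_psum bs).
  rewrite gE// (big_ord_widen M (fun i => a i * c i x) mM) [RHS]big_mkcond/=.
  apply: eq_bigr => i _; rewrite /psum (coord_sum_ord bs i m (fun k => c k x)).
  by case: ifP => //; rewrite mulr0.
have lim x : exists l : K, (mem x -> forall e : R, 0 < e ->
    exists N, forall m, (N <= m)%N -> smod (l - g m x) <= e) /\ (~ mem x -> l = 0).
  have [mx|nx] := pselect (mem x); last by exists 0; split=> // /nx.
  suff [l hl] : exists l : K, forall e : R, 0 < e ->
    exists N, forall m, (N <= m)%N -> smod (l - g m x) <= e by exists l.
  apply: (scalar_cauchy_cvg ok) => e e0.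
  have C1 : 0 < C + 1 by rewrite ltr_wpDl.
  have [N hN] := bs_cvg bs mx (divr_gt0 e0 C1).
  have main m n : (N <= m)%N -> (m <= n)%N -> smod (g m x - g n x) <= e.
    move=> Nm mn; rewrite -(gmM _ _ _ mn mx) -smodN// opprB -(dualB nS)//; last exact: (mem_psum bs).
    rewrite (le_trans (smod_dual_le ok nS (mg n) (memB nS mx (mem_psum bs m x))))//.
    apply: (@le_trans _ _ (C * (e / (C + 1)))).
      apply: ler_pM => //; [exact: (dual_nrm_ge0 ok nS)|exact: (nrm_ge0 ok nS (memB nS mx (mem_psum bs m x)))|exact: hC|exact: hN].
    by rewrite mulrCA ger_pMr// ler_pdivrMr// mul1r lerDl.
  exists N => m n Nm Nn; have [mn|/ltnW nm] := leqP m n; first exact: main.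
  by rewrite smodB//; exact: main.
have [f hf] := choice lim.
have fl x : mem x -> forall e : R, 0 < e ->
    exists N, forall m, (N <= m)%N -> smod (f x - g m x) <= e by case: (hf x).
have smod_small (z : K) : (forall e : R, 0 < e -> smod z <= e) -> z = 0.
  move=> h; apply/(smod_eq0 ok)/eqP; rewrite eq_le smod_ge0// andbT.
  by apply/ler_addgt0Pl => e e0; rewrite addr0; exact: h.
exists (f : dual S).
  split.
  - move=> k x y mx my; apply/eqP; rewrite -subr_eq0; apply/eqP/smod_small => e e0.
    have mxy := memZD nS k mx my.
    pose e' := e / (smod k + 2).
    have k2 : 0 < smod k + 2 by rewrite ltr_wpDl// smod_ge0.
    have e'0 : 0 < e' by rewrite divr_gt0.
    have [N1 h1] := fl _ mx _ e'0; have [N2 h2] := fl _ my _ e'0.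
    have [N3 h3] := fl _ mxy _ e'0; pose N := maxn N1 (maxn N2 N3).
    have E : (f (k *: x + y) : K) - (k * f x + f y) =
      (f (k *: x + y) - g N (k *: x + y)) - (k * (f x - g N x) + (f y - g N y)).
      by rewrite (dual_lin k (mg N) mx my); ring.
    rewrite E (le_trans (ler_smodD ok _ _))// smodN//.
    rewrite (le_trans (lerD (lexx _) (ler_smodD ok _ _)))// smodM//.
    have := h1 N (leq_maxl _ _); have := h2 N.
    rewrite !leq_max leqnn orbT => /(_ isT) y2; have := h3 N.
    rewrite !leq_max leqnn !orbT => /(_ isT) z3 x1.
    have := ler_wpM2l (smod_ge0 ok k) x1 => x2.
    rewrite (le_trans (lerD z3 (lerD x2 y2)))//.
    rewrite [leRHS](_ : e = e' * (smod k + 2)); last by rewrite divfK// gt_eqF.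
    by rewrite le_eqVlt; apply/orP; left; apply/eqP; ring.
  - by move=> x; case: (hf x).
  - exists C => x mx; apply/ler_addgt0Pl => e e0.
    have [N /(_ N (leqnn N)) h] := fl _ mx _ e0.
    rewrite -[f x](subrK (g N x)) (le_trans (ler_smodD ok _ _))// lerD//.
    rewrite (le_trans (smod_dual_le ok nS (mg N) mx))//.
    by apply: ler_wpM2r; [exact: (nrm_ge0 ok nS mx)|exact: hC].
move=> i; apply/eqP; rewrite -subr_eq0; apply/eqP/smod_small => e e0.
have [N hN] := fl _ (mb i) _ e0.
have := hN (maxn N i.+1) (leq_maxl _ _); rewrite gE//.
rewrite (bigD1 (Ordinal (leq_maxr N i.+1)))//= (bs_bio bs) eqxx mulr1 big1 ?addr0//.
move=> k ki; rewrite (bs_bio bs) (_ : (nat_of_ord k == i) = false) ?mulr0//.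
by apply/negbTE; move: ki; apply: contra => /eqP ki; apply/eqP/val_inj.
Qed.

(** The partial sum projections of the dual system are the adjoints of those of the
    system, so norm bounds carry over. *)
Theorem dual_basis_system : basis_system b' c'.
Proof.
have nD := normed_dual ok nS; have mb' := mem_coordf bs.
have bd m (B : R) (f : dual S) : 0 <= B -> mem f ->
    (forall x, mem x -> nrm (psum b c m x) <= B * nrm x) ->
    nrm (psum b' c' m f) <= B * nrm f.
  move=> B0 mf h; apply: (le_dual_nrm ok nS); first by rewrite mulr_ge0// (dual_nrm_ge0 ok nS).
  move=> x mx; rewrite dual_psumE// (le_trans (smod_dual_le ok nS mf (mem_psum bs m x)))//.
  by rewrite [B * _]mulrC -mulrA ler_wpM2l ?(dual_nrm_ge0 ok nS)// h.
have dif m (f : dual S) x : mem f -> mem x ->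
    (f - psum b' c' m f) x = f (x - psum b c m x).
  move=> mf mx; rewrite (dualB nS)//; last exact: (mem_psum bs).
  by rewrite -scaleN1r dual_evD dual_evZ mulN1r dual_psumE.
have mem_psum' m f : mem (psum b' c' m f) by apply: mem_sum => // i; exact: memZ.
split.
- by [].
- by [].
- by [].
- by move=> i k; rewrite /c' /b' (coordfE bs)// (bs_bio bs) eq_sym.
- have [C C0 hC] := bs_bound bs; exists C => // m f mf.
  by apply: bd => // x; exact: hC.
- move=> e e0; have [N hN] := bs_asym bs e0; exists N => m Nm f mf.
  by apply: bd => //; [rewrite addr_ge0// ltW|exact: hN].
- move=> f mf e e0; have [N hN] := bs_shrink bs mf e0; exists N => m Nm.
  apply: (le_dual_nrm ok nS); first exact: ltW.
  by move=> x mx; rewrite dif// hN.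
- move=> phi mphi e e0; have [x mx hx] := bidual_bdd mphi.
  have [N hN] := bs_cvg bs mx e0; exists N => m Nm f mf.
  rewrite hx ?dif//; last exact: memB.
  rewrite (le_trans (smod_dual_le ok nS mf (memB nS mx (mem_psum bs m x))))//.
  by rewrite mulrC ler_wpM2r ?(dual_nrm_ge0 ok nS)// hN.
- exact: dual_bdd.
- move=> C; have [s [t [x [us t1 mx lt]]]] := bs_cond bs (Num.max C 0).
  have [f [mf f1 fy]] := norming s (fun i => t i * c i x).
  exists s, t, f; split=> //; rewrite ltNge; apply/negP => le.
  move: lt; rewrite -fy ltNge => /negP; apply.
  rewrite (dual_sum nS)//; last by move=> i; exact: memZ.
  have -> : \sum_(i <- s) f ((t i * c i x) *: b i) =
      (\sum_(i <- s) (t i * c' i f) *: b' i) x.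
    rewrite dual_ev_sum; apply: eq_bigr => i _; rewrite (dualZ nS)// dual_evZ.
    by rewrite /b' (coordfE bs)// -!mulrA; congr (_ * _); rewrite mulrC.
  rewrite (le_trans (smod_dual_le ok nS _ mx))//.
    by apply: mem_sum => // i; exact: memZ.
  rewrite ler_wpM2r ?(nrm_ge0 ok nS)// (le_trans le)//.
  apply: (@le_trans _ _ (Num.max C 0 * nrm f)).
    by rewrite ler_wpM2r ?(dual_nrm_ge0 ok nS)// le_max lexx.
  by rewrite ler_piMr// le_max lexx orbT.
Qed.

End dual_system.
End basis_systems.

(** * Sums in the sense of l_2 *)

Section l2_sums.
Context {R : realType} {K : scalars R}.
Hypothesis ok : scalars_ok K.
Variable U : nat -> space K.
Notation L := (l2sum U).
Implicit Types x y : L.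

Definition sqs x (J : nat) : R := \sum_(j < J) nrm (x j) ^+ 2.

Lemma sqs_ge0 x J : 0 <= sqs x J.
Proof. by apply: sumr_ge0 => j _; exact: sqr_ge0. Qed.

Lemma sqs_esum x : (\esum_(i in [set: nat]) ((nrm (x i)) ^+ 2)%:E)%E =
  (limn (fun J => (sqs x J)%:E))%E.
Proof.
rewrite -nneseries_esumT; last by move=> n; rewrite lee_fin sqr_ge0.
congr (limn _); apply/funext => J.
by rewrite sumEFin big_mkord.
Qed.

Lemma sqs_mono x : {homo (fun J => (sqs x J)%:E) : m n / (m <= n)%N >-> (m <= n)%E}.
Proof.
move=> m n mn; rewrite lee_fin /sqs.
rewrite (big_ord_widen n (fun j => nrm (x j) ^+ 2) mn) [leLHS]big_mkcond/=.
by apply: ler_sum => j _; case: ifP => // _; exact: sqr_ge0.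
Qed.

Lemma l2_le x (C : R) : 0 <= C -> (forall j, mem (x j)) ->
  (forall J, sqs x J <= C ^+ 2) -> mem x /\ nrm x <= C.
Proof.
move=> C0 mx h.
have le : (\esum_(i in [set: nat]) ((nrm (x i)) ^+ 2)%:E <= (C ^+ 2)%:E)%E.
  rewrite sqs_esum; apply: lime_le.
    by apply: ereal_nondecreasing_is_cvgn; exact: sqs_mono.
  by apply: nearW => J; rewrite lee_fin.
split; first by split=> //; apply: le_lt_trans le _; rewrite ltry.
rewrite /nrm/= -[leRHS](ger0_norm C0) -sqrtr_sqr ler_wsqrtr//.
rewrite -lee_fin fineK// ge0_fin_numE; first exact: le_lt_trans le (ltry _).
by apply: esum_ge0 => i _; rewrite lee_fin sqr_ge0.
Qed.

Lemma l2_sqs_le x J : mem x -> sqs x J <= nrm x ^+ 2.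
Proof.
move=> [_ fin]; have e0 : (0%E <= \esum_(i in [set: nat]) ((nrm (x i)) ^+ 2)%:E)%E.
  by apply: esum_ge0 => i _; rewrite lee_fin sqr_ge0.
rewrite /nrm/= sqr_sqrtr ?fine_ge0// -lee_fin fineK ?ge0_fin_numE//.
rewrite sqs_esum; have := ereal_nondecreasing_cvgn (@sqs_mono x) => cv.
rewrite (cvg_lim _ cv)//; apply: ereal_sup_ubound; by exists J.
Qed.

Lemma l2_nrm_ge0 x : 0 <= nrm x.
Proof. exact: sqrtr_ge0. Qed.

Lemma l2_coord_le x j : (forall i, 0 <= nrm (x i)) -> mem x -> nrm (x j) <= nrm x.
Proof.
move=> x0 mx; rewrite -(@ler_pXn2r _ 2) ?nnegrE ?l2_nrm_ge0//.
apply: le_trans (l2_sqs_le j.+1 mx).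
by rewrite /sqs big_ord_recr/= lerDr sumr_ge0// => i _; exact: sqr_ge0.
Qed.

Lemma l2_cauchy_schwarz (a b : nat -> R) (A B : R) J : 0 <= A -> 0 <= B ->
  (forall j, 0 <= a j) -> (forall j, 0 <= b j) ->
  \sum_(j < J) a j ^+ 2 <= A ^+ 2 -> \sum_(j < J) b j ^+ 2 <= B ^+ 2 ->
  \sum_(j < J) a j * b j <= A * B.
Proof.
move=> A0 B0 a0 b0 hA hB.
have nul (c d : nat -> R) (C : R) : C = 0 -> \sum_(j < J) c j ^+ 2 <= C ^+ 2 ->
    \sum_(j < J) c j * d j = 0.
  move=> ->; rewrite expr0n/= => h; apply: big1 => j _.
  have : c j ^+ 2 <= 0.
    rewrite (le_trans _ h)// (bigD1 j)//= lerDl; apply: sumr_ge0 => i _; exact: sqr_ge0.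
  by rewrite le_eqVlt ltNge sqr_ge0 orbF sqrf_eq0 => /eqP ->; rewrite mul0r.
have [Az|Anz] := eqVneq A 0; first by rewrite (nul a b A)// Az mul0r.
have [Bz|Bnz] := eqVneq B 0.
  by under eq_bigr do rewrite mulrC; rewrite (nul b a B)// Bz mulr0.
have A_gt0 : 0 < A by rewrite lt_neqAle eq_sym Anz.
have B_gt0 : 0 < B by rewrite lt_neqAle eq_sym Bnz.
have AB : 0 < A * B by rewrite mulr_gt0.
rewrite -[leRHS]mul1r -ler_pdivrMr// mulr_suml.
apply: (@le_trans _ _ (\sum_(j < J) (a j ^+ 2 / A ^+ 2 + b j ^+ 2 / B ^+ 2) / 2)).
  apply: ler_sum => j _.
  have -> : a j * b j / (A * B) = (a j / A) * (b j / B) by field; rewrite Anz Bnz.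
  rewrite -!expr_div_n ler_pdivlMr//.
  by have := sqr_ge0 (a j / A - b j / B); rewrite sqrrB; lra.
rewrite -mulr_suml big_split/= -!mulr_suml ler_pdivrMr// mul1r.
have : (\sum_(j < J) a j ^+ 2) / A ^+ 2 <= 1 by rewrite ler_pdivrMr ?exprn_gt0// mul1r.
have : (\sum_(j < J) b j ^+ 2) / B ^+ 2 <= 1 by rewrite ler_pdivrMr ?exprn_gt0// mul1r.
lra.
Qed.

Hypothesis nU : forall j, normed (U j).

Let cge0 x j : mem x -> 0 <= nrm (x j).
Proof. by move=> [mx _]; exact: (nrm_ge0 ok (nU j)). Qed.

Lemma l2D_le x y (A B : R) : 0 <= A -> 0 <= B ->
  (forall j, mem (x j)) -> (forall j, mem (y j)) ->
  (forall J, sqs x J <= A ^+ 2) -> (forall J, sqs y J <= B ^+ 2) ->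
  forall J, sqs (x + y) J <= (A + B) ^+ 2.
Proof.
move=> A0 B0 mx my hx hy J.
have x0 j : 0 <= nrm (x j) := nrm_ge0 ok (nU j) (mx j).
have y0 j : 0 <= nrm (y j) := nrm_ge0 ok (nU j) (my j).
have := l2_cauchy_schwarz A0 B0 x0 y0 (hx J) (hy J) => cs.
apply: (@le_trans _ _ (\sum_(j < J) (nrm (x j) + nrm (y j)) ^+ 2)).
  apply: ler_sum => j _; rewrite ler_pXn2r ?nnegrE ?addr_ge0//.
    exact: (nrmD (nU j)).
  by apply: (nrm_ge0 ok (nU j)); exact: (memD (nU j)).
under eq_bigr do rewrite sqrrD.
rewrite !big_split/= sqrrD lerD ?hy//; rewrite lerD ?hx//.
by rewrite mulr2n lerD.
Qed.

Lemma normed_l2sum : normed L.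
Proof.
have memxD x y : mem x -> mem y -> mem (x + y) /\ nrm (x + y) <= nrm x + nrm y.
  move=> mx my; have [mx1 _] := mx; have [my1 _] := my.
  apply: l2_le; first by rewrite addr_ge0 ?l2_nrm_ge0.
    by move=> j; exact: (memD (nU j)).
  by apply: l2D_le => //; rewrite ?l2_nrm_ge0// => J; exact: l2_sqs_le.
have memxZ (a : K) x : mem x -> mem (a *: x) /\ nrm (a *: x) <= smod a * nrm x.
  move=> mx; have [mx1 _] := mx; apply: l2_le.
  - by rewrite mulr_ge0 ?smod_ge0 ?l2_nrm_ge0.
  - by move=> j; exact: (memZ (nU j)).
  - move=> J; rewrite exprMn; apply: (@le_trans _ _ (smod a ^+ 2 * sqs x J)).
      rewrite /sqs mulr_sumr; apply: ler_sum => j _.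
      by rewrite -exprMn -(nrmZ (nU j)).
    by rewrite ler_wpM2l ?sqr_ge0// l2_sqs_le.
have mem00 : mem (0 : L).
  have [] // := @l2_le 0 0 (lexx 0) => [j|J]; first exact: (mem0 (nU j)).
  by rewrite /sqs big1 ?expr0n//= => j _; rewrite (nrm0 ok (nU j)) expr0n.
split.
- split=> // a x y mx my.
  by have [h _] := memxZ a _ mx; have [] := memxD _ _ h my.
- by move=> x y mx my; have [] := memxD _ _ mx my.
- move=> a x mx; have [max le] := memxZ a _ mx.
  apply/eqP; rewrite eq_le le/=.
  have [->|a0] := eqVneq a 0; first by rewrite smod0// mul0r l2_nrm_ge0.
  have sa : 0 < smod a.
    rewrite lt_neqAle smod_ge0// andbT eq_sym; apply/eqP => h.
    by move: a0; rewrite (smod_eq0 ok h) eqxx.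
  rewrite -ler_pdivlMl//; have [_] := memxZ a^-1 _ max.
  by rewrite scalerA mulVf// scale1r (smodV ok).
- move=> x mx x0; apply: functional_extensionality_dep => j.
  have [mx1 _] := mx; apply: (nrm_eq0 (nU j)) => //.
  apply/eqP; rewrite eq_le (cge0 j mx) andbT -x0.
  by apply: l2_coord_le => // i; exact: cge0.
Qed.

Lemma dprod_sumE (I : Type) (r : seq I) (P : pred I) (G : I -> L) j :
  (\sum_(i <- r | P i) G i : L) j = \sum_(i <- r | P i) G i j.
Proof.
elim: r => [|i r ih]; first by rewrite !big_nil.
by rewrite !big_cons; case: (P i) => //; rewrite -ih.
Qed.

End l2_sums.

(** * Concatenation of bases of blocks *)

(** A basis of the subspace F of V, numbered by l < d, with basis constant kappa. *)
Record local_basis (R : realType) (K : scalars R) (V : space K) (F : set V) (kappa : R)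
    (d : nat) (beta : nat -> V) (gamma : nat -> V -> K^o) : Prop := LocalBasis {
  lb_sub : linear_subspace F;
  lb_pos : (0 < d)%N;
  lb_mem : forall l, (l < d)%N -> F (beta l);
  lb_lin : forall l, (l < d)%N -> linear_on F (gamma l);
  lb_bio : forall l l', (l < d)%N -> (l' < d)%N -> gamma l (beta l') = (l == l')%:R;
  lb_full : forall x, F x -> \sum_(l < d) gamma l x *: beta l = x;
  lb_bound : forall k x, (k <= d)%N -> F x ->
    nrm (\sum_(l < k) gamma l x *: beta l) <= kappa * nrm x }.

Section concatenation.
Context {R : realType} {K : scalars R}.
Hypothesis ok : scalars_ok K.
Variable U : nat -> space K.
Notation L := (l2sum U).
Hypothesis nU : forall j, normed (U j).
Hypothesis memU : forall j (x : U j), mem x.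
Hypothesis normU : forall j (y : U j), exists f : U j -> K^o,
  [/\ forall (a : K) x z, f (a *: x + z) = a * f x + f z,
      forall z, smod (f z) <= nrm z & f y = sinj K (nrm y)].
Variables (F : forall j, set (U j)) (kappa : nat -> R) (d : nat -> nat).
Variables (beta : forall j, nat -> U j) (gamma : forall j, nat -> U j -> K^o).
Arguments F : clear implicits.
Arguments gamma : clear implicits.
Hypothesis lb : forall j, local_basis (F j) (kappa j) (d j) (beta j) (gamma j).
Hypothesis kappa1 : forall e : R, 0 < e ->
  exists J, forall j, (J <= j)%N -> kappa j <= 1 + e.
Hypothesis cond : forall C : R, exists j (t : nat -> K) (x : U j),
  [/\ F j x, forall l, smod (t l) <= 1 &
      C * nrm x < nrm (\sum_(l < d j) (t l * gamma j l x) *: beta j l)].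
Variable Y : set L.
Hypothesis YE : forall x, Y x <-> mem x /\ forall j, F j (x j).
Let S := subspace_of Y.
Let nL := normed_l2sum ok nU.

Let U0 j (x : U j) : 0 <= nrm x. Proof. exact: (nrm_ge0 ok (nU j)). Qed.
Let F0 j : F j 0. Proof. by case: (lb_sub (lb j)). Qed.
Let FZD j (a : K) x y : F j x -> F j y -> F j (a *: x + y).
Proof. by case: (lb_sub (lb j)) => _; apply. Qed.
Let FZ j (a : K) x : F j x -> F j (a *: x).
Proof. by move=> Fx; rewrite -[X in F j X]addr0; exact: FZD. Qed.
Let FD j x y : F j x -> F j y -> F j (x + y).
Proof. by move=> Fx Fy; rewrite -[x]scale1r; exact: FZD. Qed.

Lemma normed_Y : normed S.
Proof.
have Ym x : Y x -> @mem _ _ L x by case/YE.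
split.
- split; first by apply/YE; split; [exact: mem0|move=> j; exact: F0].
  move=> a x y /YE[mx Fx] /YE[my Fy]; apply/YE; split; first exact: memZD.
  by move=> j; exact: FZD.
- by move=> x y mx my; apply: (nrmD nL); exact: Ym.
- by move=> a x mx; apply: (nrmZ nL); exact: Ym.
- by move=> x mx; apply: (nrm_eq0 nL); exact: Ym.
Qed.
Let nS := normed_Y.

(** Block j occupies the indices from off j to off j.+1 of the global basis. *)
Definition off (J : nat) : nat := \sum_(j < J) d j.

Lemma offS j : off j.+1 = (off j + d j)%N.
Proof. by rewrite /off big_ord_recr. Qed.

Lemma ltn_offS j : (off j < off j.+1)%N.
Proof. by rewrite offS -{1}[off j]addn0 ltn_add2l (lb_pos (lb j)). Qed.

Lemma leq_off i j : (i <= j)%N -> (off i <= off j)%N.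
Proof.
move=> /subnK <-; elim: (j - i)%N => // k ih.
by rewrite addSn (leq_trans ih)// ltnW// ltn_offS.
Qed.

Lemma leq_off_id j : (j <= off j)%N.
Proof. by elim: j => // j ih; exact: leq_ltn_trans ih (ltn_offS j). Qed.

Lemma blk_ex m : exists j, (m < off j.+1)%N.
Proof. by exists m; exact: leq_off_id. Qed.

Definition blk m := ex_minn (blk_ex m).

Lemma blkP m : (off (blk m) <= m < off (blk m).+1)%N.
Proof.
rewrite /blk; case: ex_minnP => j mj jmin; rewrite mj andbT.
case: j mj jmin => [|j] mj jmin; first by rewrite /off big_ord0.
by rewrite leqNgt; apply/negP => /jmin; rewrite ltnn.
Qed.

Lemma blk_uniq m j : (off j <= m < off j.+1)%N -> blk m = j.
Proof.
have /andP[b1 b2] := blkP m; move=> /andP[j1 j2]; apply/eqP; rewrite eqn_leq.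
apply/andP; split; rewrite leqNgt; apply/negP => h.
  by have := leq_ltn_trans (leq_trans (leq_off h) b1) j2; rewrite ltnn.
by have := leq_ltn_trans (leq_trans (leq_off h) j1) b2; rewrite ltnn.
Qed.

Lemma blk_off j l : (l < d j)%N -> blk (off j + l) = j.
Proof. by move=> lj; apply: blk_uniq; rewrite leq_addr offS ltn_add2l. Qed.

Lemma leq_blk m J : (off J <= m)%N -> (J <= blk m)%N.
Proof.
move=> h; rewrite leqNgt; apply/negP => /leq_off h2.
by have /andP[_] := blkP m; rewrite ltnNge (leq_trans h2 h).
Qed.

Definition gb m : S := fun j =>
  if (off j <= m < off j.+1)%N then beta j (m - off j) else 0.

Definition gc m (x : S) : K^o := gamma (blk m) (m - off (blk m)) (x (blk m)).

Lemma gb_sumE (a : nat -> K) m j :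
  (\sum_(i < m) a i *: gb i : S) j =
  \sum_(l < minn (d j) (m - off j)) a (off j + l)%N *: beta j l.
Proof.
elim: m => [|m ih]; first by rewrite !big_ord0.
rewrite big_ord_recr/=.
have -> : (\sum_(i < m) a i *: gb i + a m *: gb m : S) j =
  (\sum_(i < m) a i *: gb i : S) j + a m *: gb m j by [].
rewrite ih /gb offS; case: ifP => [/andP[jm mj]|].
  have mj' : (m - off j < d j)%N by rewrite ltn_subLR.
  rewrite subSn// (minn_idPr (ltnW mj')) (minn_idPr mj') big_ord_recr/=.
  by rewrite subnKC.
rewrite scaler0 addr0 => h.
suff -> : minn (d j) (m - off j) = minn (d j) (m.+1 - off j) by [].
have [jm|mj] := leqP (off j) m.
  move: h; rewrite jm/= => /negbT; rewrite -leqNgt => h.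
  have h' : (d j <= m - off j)%N by rewrite leq_subRL.
  by rewrite subSn// (minn_idPl h') (minn_idPl (leqW h')).
rewrite (_ : (m - off j = 0)%N); last by apply/eqP; rewrite subn_eq0 ltnW.
by rewrite (_ : (m.+1 - off j = 0)%N)//; apply/eqP; rewrite subn_eq0.
Qed.

Lemma gb_sum_iota (a : nat -> K) j i :
  (\sum_(l < d j) a l *: gb (off j + l) : S) i =
  if i == j then \sum_(l < d i) a l *: beta i l else 0.
Proof.
rewrite dprod_sumE; case: eqVneq => [->|ij].
  apply: eq_bigr => l _; rewrite -[LHS]/(a l *: gb (off j + l) j) /gb offS.
  by rewrite leq_addr ltn_add2l ltn_ord/= addKn.
apply: big1 => l _; rewrite -[LHS]/(a l *: gb (off j + l) i) /gb.
case: ifP => [/blk_uniq|]; last by rewrite scaler0.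
by rewrite blk_off// => ji; case/eqP: ij.
Qed.

Let beta_sum_F j k (a : nat -> K) : (k <= d j)%N ->
  F j (\sum_(l < k) a l *: beta j l).
Proof.
elim: k => [|k ih] kd; first by rewrite big_ord0.
rewrite big_ord_recr/=; apply: FD; first exact: ih (ltnW kd).
by apply: FZ; exact: (lb_mem (lb j)).
Qed.

(** With finitely many nonzero blocks the defining series is a finite sum. *)
Lemma fin_supp_Y (x : L) J : (forall j, F j (x j)) -> (forall j, (J <= j)%N -> x j = 0) ->
  Y x /\ nrm x <= Num.sqrt (sqs x J).
Proof.
move=> Fx xJ.
have [] := @l2_le _ _ U x (Num.sqrt (sqs x J)) (sqrtr_ge0 _) => [j|J'|mx lex].
- exact: memU.
- rewrite sqr_sqrtr ?sqs_ge0//.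
  have [JJ'|J'J] := leqP J J'; last by have := sqs_mono x (ltnW J'J); rewrite lee_fin.
  elim: J' JJ' => [|J' ih]; first by rewrite leqn0 => /eqP ->.
  rewrite leq_eqVlt => /predU1P[->//|JJ'].
  rewrite /sqs big_ord_recr/= xJ// (nrm0 ok (nU _)) expr0n/= addr0.
  exact: ih.
- by split=> //; apply/YE.
Qed.

Lemma mem_gb m : mem (gb m : S).
Proof.
have [] // := @fin_supp_Y (gb m) (blk m).+1.
  move=> j; rewrite /gb; case: ifP => // /andP[jm mj].
  by apply: (lb_mem (lb j)); rewrite ltn_subLR// -offS.
move=> j bj; rewrite /gb; case: ifP => // /blk_uniq jE.
by move: bj; rewrite jE ltnn.
Qed.

Lemma gc_ord m : (m - off (blk m) < d (blk m))%N.
Proof. by have /andP[b1 b2] := blkP m; rewrite ltn_subLR// -offS. Qed.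

Lemma gc_off j l x : (l < d j)%N -> gc (off j + l) x = gamma j l (x j).
Proof. by move=> lj; rewrite /gc blk_off// addKn. Qed.

Lemma gc_lin m : linear_on (@mem _ _ S) (gc m).
Proof.
move=> a x y /YE[_ Fx] /YE[_ Fy]; rewrite /gc.
exact: (lb_lin (lb _) (gc_ord m)).
Qed.

Let gamma0 j l : (l < d j)%N -> gamma j l 0 = 0.
Proof.
move=> lj; have := @lb_lin _ _ _ _ _ _ _ _ (lb j) l lj 1 0 0 (F0 j) (F0 j).
rewrite scale1r addr0 scale1r => /eqP.
by rewrite -subr_eq0 opprD addrA subrr sub0r oppr_eq0 => /eqP.
Qed.

Lemma gc_bio i k : gc i (gb k) = (i == k)%:R.
Proof.
rewrite /gc /gb; case: ifP => [/andP[k1 k2]|h].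
  rewrite (lb_bio (lb _)) ?gc_ord//; last by rewrite ltn_subLR// -offS.
  congr (_%:R); have /andP[i1 i2] := blkP i.
  by rewrite -(eqn_add2r (off (blk i))) !subnK.
rewrite gamma0 ?gc_ord//; case: eqVneq => // ik.
by move: h; rewrite -ik blkP.
Qed.

Lemma psum_comp m x j : (psum gb gc m x : S) j =
  \sum_(l < minn (d j) (m - off j)) gamma j l (x j) *: beta j l.
Proof.
rewrite /psum (gb_sumE (fun i => gc i x)); apply: eq_bigr => l _.
by rewrite gc_off// (leq_trans (ltn_ord l))// geq_minl.
Qed.

Lemma psum_lt m x j : mem x -> (j < blk m)%N -> (psum gb gc m x : S) j = x j.
Proof.
move=> /YE[_ Fx] jm; rewrite psum_comp.
have h : (d j <= m - off j)%N.
  have /andP[b1 _] := blkP m.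
  have jm' : (off j.+1 <= m)%N := leq_trans (leq_off jm) b1.
  by rewrite leq_subRL -?offS// (leq_trans _ jm')// leq_off.
by rewrite (minn_idPl h) (lb_full (lb j)).
Qed.

Lemma psum_gt m x j : (blk m < j)%N -> (psum gb gc m x : S) j = 0.
Proof.
move=> mj; rewrite psum_comp; have /andP[_ b2] := blkP m.
rewrite (_ : (m - off j = 0)%N) ?minn0 ?big_ord0//.
by apply/eqP; rewrite subn_eq0 ltnW// (leq_trans b2)// leq_off.
Qed.

Lemma psum_comp_le m x j (C : R) : mem x -> 1 <= C -> kappa (blk m) <= C ->
  nrm ((psum gb gc m x : S) j) <= C * nrm (x j).
Proof.
move=> mx C1 kC; have [jm|mj|jE] := ltngtP j (blk m).
- by rewrite psum_lt// ler_peMl.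
- by rewrite psum_gt// (nrm0 ok (nU j)) mulr_ge0// (le_trans _ C1).
- rewrite psum_comp; case/YE: mx => _ Fx.
  rewrite (le_trans (lb_bound (lb j) (geq_minl _ _) (Fx j)))//.
  by rewrite ler_wpM2r// jE.
Qed.

(** One block at most is cut, and in that block the local basis constant applies. *)
Lemma psum_le m x (C : R) : mem x -> 1 <= C -> kappa (blk m) <= C ->
  nrm (psum gb gc m x : S) <= C * nrm x.
Proof.
move=> mx C1 kC; have C0 : 0 <= C := le_trans ler01 C1.
have [|||//] := @l2_le _ _ U (psum gb gc m x) (C * nrm x).
- by rewrite mulr_ge0 ?l2_nrm_ge0.
- by move=> j; exact: memU.
- move=> J; rewrite exprMn; apply: (@le_trans _ _ (C ^+ 2 * sqs x J)); last first.
    by rewrite ler_wpM2l ?sqr_ge0// l2_sqs_le//; case/YE: mx.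
  rewrite /sqs mulr_sumr; apply: ler_sum => j _; rewrite -exprMn.
  by rewrite ler_pXn2r ?nnegrE ?mulr_ge0//; exact: psum_comp_le.
Qed.

Lemma kappa_bounded : exists2 C : R, 1 <= C & forall j, kappa j <= C.
Proof.
have [J hJ] := kappa1 ltr01; exists (2 + \sum_(j < J) `|kappa j|).
  by rewrite ler_wpDr ?sumr_ge0// ler1n.
move=> j; have [/hJ h|jJ] := leqP J j.
  by rewrite (le_trans h)// ler_wpDr ?sumr_ge0//.
rewrite (le_trans (ler_norm _))// (bigD1 (Ordinal jJ))//= addrCA.
by rewrite lerDl addr_ge0// sumr_ge0.
Qed.

Lemma sqs_tail (x : L) : mem x -> forall e : R, 0 < e ->
  exists J0, forall J, (J0 <= J)%N -> nrm x ^+ 2 - sqs x J <= e.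
Proof.
move=> mx e e0; have [h|h] := leP (nrm x ^+ 2) e.
  by exists 0%N => J _; rewrite (le_trans _ h)// gerBl sqs_ge0.
suff [J0 hJ] : exists J0, nrm x ^+ 2 - e < sqs x J0.
  exists J0 => J JJ; have := sqs_mono x JJ; rewrite lee_fin => ?.
  by rewrite lerBlDr addrC -lerBlDr (le_trans (ltW hJ)).
apply/not_existsP => nJ.
have he : 0 <= nrm x ^+ 2 - e by rewrite subr_ge0 ltW.
have [|J|_ le] := @l2_le _ _ U x (Num.sqrt (nrm x ^+ 2 - e)) (sqrtr_ge0 _).
- by move=> j; exact: memU.
- by rewrite sqr_sqrtr// leNgt; apply/negP/nJ.
have : nrm x ^+ 2 <= Num.sqrt (nrm x ^+ 2 - e) ^+ 2.
  by rewrite ler_pXn2r ?nnegrE ?sqrtr_ge0 ?l2_nrm_ge0.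
by rewrite sqr_sqrtr// lerBrDr gerDl leNgt e0.
Qed.

Lemma psum_cvg x : mem x -> forall e : R, 0 < e ->
  exists N, forall m, (N <= m)%N -> nrm (x - psum gb gc m x : S) <= e.
Proof.
move=> mx e e0; have [C C1 hC] := kappa_bounded.
have C2 : 0 < 1 + C by rewrite ltr_wpDr// (le_trans _ C1).
have mxL : @mem _ _ L x by case/YE: mx.
have e2 : 0 < (e / (1 + C)) ^+ 2 by rewrite exprn_gt0// divr_gt0.
have [J0 hJ] := sqs_tail mxL e2.
exists (off J0) => m /leq_blk h.
have [|||//] := @l2_le _ _ U (x - psum gb gc m x) e; first exact: ltW.
  by move=> j; exact: memU.
have comp j : nrm ((x - psum gb gc m x) j) <=
    if (j < blk m)%N then 0 else (1 + C) * nrm (x j).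
  rewrite -[(x - _) j]/(x j - (psum gb gc m x : S) j); case: ifP => [jm|_].
    by rewrite psum_lt// subrr (nrm0 ok (nU j)).
  rewrite (le_trans (nrmB ok (nU j) (memU _) (memU _)))// mulrDl mul1r lerD2l.
  exact: psum_comp_le.
have main J : (blk m <= J)%N ->
    sqs (x - psum gb gc m x) J <= (1 + C) ^+ 2 * (sqs x J - sqs x (blk m)).
  elim: J => [|J ih].
    rewrite leqn0 => /eqP ->; rewrite subrr mulr0 /sqs big_ord0//.
  rewrite leq_eqVlt => /predU1P[<-|]; last rewrite ltnS => bJ.
    rewrite subrr mulr0 /sqs big1// => j _.
    have := comp j; rewrite ltn_ord => c0; apply/eqP; rewrite sqrf_eq0.
    by rewrite eq_le c0 U0.
  rewrite /sqs !big_ord_recr/= -!/(sqs _ _) addrAC mulrDr lerD ?ih//.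
  have := comp J; rewrite ltnNge bJ/= => c0.
  by rewrite -exprMn ler_pXn2r ?nnegrE ?U0 ?mulr_ge0 ?(ltW C2).
move=> J; apply: (@le_trans _ _ (sqs (x - psum gb gc m x) (maxn J (blk m)))).
  by have := sqs_mono (x - psum gb gc m x) (leq_maxl J (blk m)); rewrite lee_fin.
rewrite (le_trans (main _ (leq_maxr _ _)))//.
have -> : e ^+ 2 = (1 + C) ^+ 2 * (e / (1 + C)) ^+ 2.
  by rewrite -exprMn mulrCA mulfV ?mulr1// gt_eqF.
rewrite ler_wpM2l ?sqr_ge0// (le_trans _ (hJ _ h))//.
by rewrite lerD2r l2_sqs_le.
Qed.

(** Evaluate f at the combination of z and y for which the Cauchy--Schwarz inequality
    for the pair of coefficients is an equality: as the supports are disjoint, the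
    squares of the norms of its two parts add up. *)
Lemma dual_disjoint (f : dual S) (z y : S) J : mem f -> mem z -> mem y ->
  (forall j, (J <= j)%N -> z j = 0) -> (forall j, (j < J)%N -> y j = 0) ->
  (smod (f z) * nrm y) ^+ 2 + (smod (f y) * nrm z) ^+ 2
  <= (nrm f * (nrm z * nrm y)) ^+ 2.
Proof.
move=> mf mz my zJ yJ.
set A := smod (f z); set B := smod (f y); set X := nrm z; set V := nrm y.
set T := (A * V) ^+ 2 + (B * X) ^+ 2.
have T0 : 0 <= T by rewrite addr_ge0 ?sqr_ge0.
have X0 : 0 <= X by exact: l2_nrm_ge0.
have V0 : 0 <= V by exact: l2_nrm_ge0.
have A0 : 0 <= A by exact: smod_ge0.
have B0 : 0 <= B by exact: smod_ge0.
pose al : K := sconj (f z) * sinj K (V ^+ 2).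
pose be : K := sconj (f y) * sinj K (X ^+ 2).
pose v : S := al *: z + be *: y.
have mv : mem v by apply: memZD => //; exact: memZ.
have fv : f v = sinj K T.
  rewrite (dual_lin al mf mz) ?(dualZ nS be mf my)//; last exact: memZ.
  rewrite /al /be /T !exprMn (sinjD ok) (sinjM ok (A ^+ 2)) (sinjM ok (B ^+ 2)).
  rewrite -!(mul_sconj ok).
  by rewrite [_ * f z]mulrAC [_ * f y]mulrAC.
have sal : smod al = A * V ^+ 2.
  by rewrite (smodM ok) (smodJ ok) (smod_inj ok) ger0_norm ?sqr_ge0.
have sbe : smod be = B * X ^+ 2.
  by rewrite (smodM ok) (smodJ ok) (smod_inj ok) ger0_norm ?sqr_ge0.
have nv : nrm v <= Num.sqrt T * (X * V).
  have [|||//] := @l2_le _ _ U v (Num.sqrt T * (X * V)).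
  - by rewrite !mulr_ge0 ?sqrtr_ge0.
  - by move=> j; exact: memU.
  - move=> J'; rewrite exprMn sqr_sqrtr//.
    apply: (@le_trans _ _ ((A * V ^+ 2) ^+ 2 * sqs z J' + (B * X ^+ 2) ^+ 2 * sqs y J')).
      rewrite /sqs !mulr_sumr -big_split/=; apply: ler_sum => j _.
      rewrite -[v j]/(al *: z j + be *: y j); have [Jj|jJ] := leqP J j.
        rewrite zJ// scaler0 add0r (nrmZ (nU j))// (nrm0 ok (nU j)) expr0n/= mulr0 add0r.
        by rewrite sbe exprMn.
      rewrite yJ// scaler0 addr0 (nrmZ (nU j))// (nrm0 ok (nU j)) expr0n/= mulr0 addr0.
      by rewrite sal exprMn.
    have hz : sqs z J' <= X ^+ 2 by apply: l2_sqs_le; case/YE: mz.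
    have hy : sqs y J' <= V ^+ 2 by apply: l2_sqs_le; case/YE: my.
    rewrite (le_trans (lerD (ler_wpM2l (sqr_ge0 _) hz) (ler_wpM2l (sqr_ge0 _) hy)))//.
    by rewrite le_eqVlt; apply/orP; left; apply/eqP; rewrite /T; ring.
have : T <= nrm f * (Num.sqrt T * (X * V)).
  have {1}-> : T = smod (f v) by rewrite fv (smod_inj ok) ger0_norm.
  apply: le_trans (smod_dual_le ok nS mf mv) _.
  by apply: ler_wpM2l => //; exact: (dual_nrm_ge0 ok nS).
have [->|Tn] := eqVneq T 0; first by rewrite sqr_ge0.
have sT : 0 < Num.sqrt T by rewrite sqrtr_gt0 lt_neqAle eq_sym Tn.
rewrite -{1}[T]sqr_sqrtr// mulrCA expr2 ler_pM2l// => h.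
by rewrite -[T]sqr_sqrtr// ler_pXn2r ?nnegrE ?sqrtr_ge0// (le_trans _ h) ?ltW.
Qed.

(** If f nearly attains its norm on z, supported in the first J blocks, then
    [dual_disjoint] leaves f a small norm on the remaining blocks: the square of it
    is at most |f|^2 - (|f| - 2 de)^2 <= 4 |f| de. *)
Lemma dual_tail (f : dual S) : mem f -> forall e : R, 0 < e ->
  exists J, forall y : S, mem y -> (forall j, (j < J)%N -> y j = 0) ->
  smod (f y) <= e * nrm y.
Proof.
move=> mf e e0; set M := nrm f.
have M0 : 0 <= M := dual_nrm_ge0 ok nS mf.
have [Mz|Mn] := eqVneq M 0.
  exists 0%N => y my _; rewrite (le_trans (smod_dual_le ok nS mf my))// -/M Mz mul0r.
  by rewrite mulr_ge0 ?(ltW e0)// (nrm_ge0 ok nS).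
have M_gt0 : 0 < M by rewrite lt_neqAle eq_sym Mn.
pose de := Num.min (M / 4) (e ^+ 2 / (4 * M)).
have de0 : 0 < de.
  by rewrite lt_min !divr_gt0// ?exprn_gt0// mulr_gt0.
have deM : de <= M / 4 by rewrite ge_min lexx.
have dee : 4 * M * de <= e ^+ 2.
  by rewrite mulrC -ler_pdivlMr ?mulr_gt0// ge_min lexx orbT.
have [x0 [mx0 fx0]] : exists x0, mem x0 /\ (M - de) * nrm x0 < smod (f x0).
  apply: contrapT => h; have : M <= M - de.
    apply: (le_dual_nrm ok nS); first by lra.
    move=> x mx; rewrite leNgt; apply/negP => lt; apply: h; by exists x.
  by rewrite lerBrDr gerDl leNgt de0.
have X0 : 0 < nrm x0.
  rewrite lt_neqAle (nrm_ge0 ok nS)// andbT eq_sym; apply/eqP => h.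
  move: fx0; rewrite h mulr0; have := smod_dual_le ok nS mf mx0.
  by rewrite h mulr0 leNgt => /negP.
have [N hN] := psum_cvg mx0 (divr_gt0 (mulr_gt0 de0 X0) M_gt0).
pose m := off N; pose z := psum gb gc m x0.
have blkm : blk m = N by rewrite /m -[off N]addn0 blk_off// (lb_pos (lb N)).
have mz : mem z by apply: mem_sum => // i; apply: memZ => //; exact: mem_gb.
have z0 j : (N <= j)%N -> z j = 0.
  rewrite /z psum_comp => /leq_off h.
  by rewrite (_ : (m - off j = 0)%N) ?minn0 ?big_ord0//; apply/eqP; rewrite subn_eq0.
have nz : nrm z <= nrm x0.
  have [|||//] := @l2_le _ _ U z (nrm x0); first exact: l2_nrm_ge0.
    by move=> j; exact: memU.
  move=> J; apply: (@le_trans _ _ (sqs x0 J)); last by apply: l2_sqs_le; case/YE: mx0.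
  apply: ler_sum => j _; have [Nj|jN] := leqP N j.
    by rewrite z0// (nrm0 ok (nU j)) expr0n/= sqr_ge0.
  by rewrite /z psum_lt// blkm.
have fz : (M - 2 * de) * nrm x0 <= smod (f z).
  have : smod (f x0) <= smod (f z) + de * nrm x0.
    have -> : f x0 = f z + f (x0 - z) by rewrite (dualB nS)// addrC subrK.
    rewrite (le_trans (ler_smodD ok _ _))// lerD2l.
    rewrite (le_trans (smod_dual_le ok nS mf (memB nS mx0 mz)))//.
    rewrite mulrC -ler_pdivlMr//; apply: hN; exact: leq_off_id.
  lra.
exists N => y my yN; have yge0 := nrm_ge0 ok nS my.
have := dual_disjoint mf mz my z0 yN; rewrite -/M => h.
have zge0 := nrm_ge0 ok nS mz.
rewrite -(@ler_pXn2r _ 2) ?nnegrE ?smod_ge0// ?mulr_ge0 ?(ltW e0)//.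
have fz0 : 0 < smod (f z) by apply: lt_le_trans fz; rewrite mulr_gt0//; lra.
have z_gt0 : 0 < nrm z.
  rewrite lt_neqAle zge0 andbT eq_sym; apply/eqP => h0.
  by move: fz0; rewrite ltNge (le_trans (smod_dual_le ok nS mf mz))// h0 mulr0.
have h2 : smod (f z) >= (M - 2 * de) * nrm z.
  by rewrite (le_trans _ fz)// ler_wpM2l//; lra.
rewrite -(ler_pM2r (exprn_gt0 2 z_gt0)) -[leLHS]exprMn.
have h3 : ((M - 2 * de) * nrm z * nrm y) ^+ 2 <= (smod (f z) * nrm y) ^+ 2.
  have Mde : 0 <= M - 2 * de by lra.
  by rewrite ler_pXn2r ?nnegrE; [rewrite ler_wpM2r|done|rewrite !mulr_ge0|
    rewrite mulr_ge0// smod_ge0].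
have h4 : (M * (nrm z * nrm y)) ^+ 2 - ((M - 2 * de) * nrm z * nrm y) ^+ 2
    <= (e * nrm y) ^+ 2 * nrm z ^+ 2.
  have -> : (M * (nrm z * nrm y)) ^+ 2 - ((M - 2 * de) * nrm z * nrm y) ^+ 2 =
    (4 * M * de - 4 * de ^+ 2) * (nrm z * nrm y) ^+ 2 by ring.
  rewrite (_ : (e * nrm y) ^+ 2 * nrm z ^+ 2 = e ^+ 2 * (nrm z * nrm y) ^+ 2); last by ring.
  rewrite ler_wpM2r ?sqr_ge0// (le_trans _ dee)// gerBl mulr_ge0 ?sqr_ge0//.
lra.
Qed.

(** Norming functionals of the finitely many nonzero blocks are combined with the
    weights |y_j| / |y|. *)
Lemma norming_Y (s : seq nat) (a : nat -> K) :
  let y := \sum_(i <- s) a i *: gb i in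
  exists f : dual S, [/\ mem f, nrm f <= 1 & smod (f y) = nrm y].
Proof.
move=> y; have my : mem y.
  by apply: mem_sum => // i; apply: memZ => //; exact: mem_gb.
have nD := normed_dual ok nS.
have [yz|yn] := eqVneq (nrm y) 0.
  exists 0; split; first exact: mem0.
    by rewrite (nrm0 ok nD).
  by rewrite dual_ev0 (smod0 ok) yz.
have y0 : 0 < nrm y by rewrite lt_neqAle eq_sym yn l2_nrm_ge0.
have [J yJ] : exists J, forall j, (J <= j)%N -> y j = 0.
  exists (\max_(i <- s) (blk i).+1)%N => j Jj.
  rewrite /y dprod_sumE big_seq; apply: big1 => i si.
  rewrite -[LHS]/(a i *: gb i j) /gb; case: ifP => [/blk_uniq bi|]; last by rewrite scaler0.
  have := @leq_bigmax_seq _ s xpredT (fun i => (blk i).+1) i si isT.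
  by rewrite bi => /leq_trans/(_ Jj); rewrite ltnn.
have nyJ : nrm y ^+ 2 = sqs y J.
  apply/eqP; rewrite eq_le; apply/andP; split; last by apply: l2_sqs_le; case/YE: my.
  case/YE: (my) => _ Fy; have [_ le] := fin_supp_Y Fy yJ.
  rewrite -[sqs y J]sqr_sqrtr ?sqs_ge0//.
  by rewrite ler_pXn2r ?nnegrE ?sqrtr_ge0 ?l2_nrm_ge0.
have [g hg] : exists g : forall j, U j -> K^o, forall j,
  [/\ forall (a : K) x z, g j (a *: x + z) = a * g j x + g j z,
      forall z, smod (g j z) <= nrm z & g j (y j) = sinj K (nrm (y j))].
  exists (fun j => sval (cid (normU (y j)))) => j; exact: (svalP (cid (normU (y j)))).
pose h (z : S) : K := sinj K (nrm y)^-1 * \sum_(j < J) sinj K (nrm (y j)) * g j (z j).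
have hle z : mem z -> smod (h z) <= 1 * nrm z.
  move=> mz; rewrite mul1r /h (smodM ok) (smod_inj ok) ger0_norm ?invr_ge0 ?(ltW y0)//.
  rewrite ler_pdivrMl//; apply: le_trans (ler_smod_sum ok _ _ _) _.
  apply: (@le_trans _ _ (\sum_(j < J) nrm (y j) * nrm (z j))).
    apply: ler_sum => j _; rewrite (smodM ok) (smod_inj ok) ger0_norm//.
    by rewrite ler_wpM2l//; case: (hg j).
  apply: (l2_cauchy_schwarz (a := fun j => nrm (y j)) (b := fun j => nrm (z j))) => //.
  - exact: l2_nrm_ge0.
  - exact: l2_nrm_ge0.
  - by rewrite nyJ.
  - by apply: (l2_sqs_le (x := z)); case/YE: mz.
pose f : dual S := fun z => if `[< mem z >] then h z else 0.
have fE z : mem z -> f z = h z by move=> mz; rewrite /f asboolT.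
have mf : mem f.
  split.
  - move=> k x z mx mz; rewrite !fE//; last exact: memZD.
    have hD : \sum_(j < J) sinj K (nrm (y j)) * g j ((k *: x + z) j) =
        k * (\sum_(j < J) sinj K (nrm (y j)) * g j (x j)) +
        \sum_(j < J) sinj K (nrm (y j)) * g j (z j).
      rewrite mulr_sumr -big_split/=; apply: eq_bigr => j _.
      have [hl _ _] := hg j; rewrite -[(k *: x + z) j]/(k *: x j + z j) hl.
      by rewrite mulrDr mulrCA.
    by rewrite /h hD /GRing.scale/= mulrDr mulrCA.
  - by move=> x nx; rewrite /f asboolF.
  - by exists 1 => x mx; rewrite fE// hle.
exists f; split=> //.
  by apply: (le_dual_nrm ok nS) => // x mx; rewrite fE// hle.
rewrite fE// /h.
have -> : \sum_(j < J) sinj K (nrm (y j)) * g j (y j) = sinj K (nrm y ^+ 2).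
  rewrite nyJ /sqs (sinj_sum ok); apply: eq_bigr => j _.
  by have [_ _ ->] := hg j; rewrite -(sinjM ok) expr2.
rewrite -(sinjM ok) (smod_inj ok) expr2 mulKf ?gt_eqF//.
by rewrite ger0_norm// l2_nrm_ge0.
Qed.

Theorem concatenation_system : basis_system (gb : nat -> S) gc.
Proof.
have [C C1 hC] := kappa_bounded.
have C0 : 0 <= C := le_trans ler01 C1.
split.
- exact: nS.
- exact: mem_gb.
- exact: gc_lin.
- exact: gc_bio.
- by exists C => // m x mx; exact: psum_le.
- move=> e e0; have [J hJ] := kappa1 e0; exists (off J) => m /leq_blk Jm x mx.
  by apply: psum_le => //; [rewrite lerDl ltW|exact: hJ].
- exact: psum_cvg.
- move=> f mf e e0; have C2 : 0 < 1 + C by rewrite ltr_wpDr.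
  have [J hJ] := dual_tail mf (divr_gt0 e0 C2).
  exists (off J) => m /leq_blk Jm x mx.
  have mp : mem (psum gb gc m x : S).
    by apply: mem_sum => // i; apply: memZ => //; exact: mem_gb.
  rewrite (le_trans (hJ _ (memB nS mx mp) _))//.
    move=> j jJ; rewrite -[LHS]/(x j - (psum gb gc m x : S) j).
    by rewrite psum_lt ?subrr// (leq_trans jJ).
  rewrite mulrAC ler_pdivrMr// -mulrA ler_wpM2l ?(ltW e0)//.
  rewrite mulrDr mulr1 [nrm x * C]mulrC (le_trans (nrmB ok nS mx mp))// lerD2l.
  exact: psum_le.
- move=> a [B hB].
  pose x : L := fun j => \sum_(l < d j) a (off j + l)%N *: beta j l.
  have B0 : 0 <= B by apply: le_trans (hB 0%N); exact: l2_nrm_ge0.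
  have xE J j : (j < J)%N -> (\sum_(i < off J) a i *: gb i : S) j = x j.
    move=> jJ; rewrite gb_sumE /x.
    suff h : (d j <= off J - off j)%N by rewrite (minn_idPl h).
    have jJ' : (off j.+1 <= off J)%N := leq_off jJ.
    by rewrite leq_subRL -?offS// leq_off// ltnW.
  have [|||mx _] := @l2_le _ _ U x B => //.
    move=> J; apply: (@le_trans _ _ (sqs (\sum_(i < off J) a i *: gb i : S) J)).
      by apply: ler_sum => j _; rewrite xE.
    have mp : mem (\sum_(i < off J) a i *: gb i : S).
      by apply: mem_sum => // i; apply: memZ => //; exact: mem_gb.
    apply: le_trans (l2_sqs_le _ _) _; first by case/YE: mp.
    by rewrite ler_pXn2r ?nnegrE ?l2_nrm_ge0//; exact: hB.
  exists x; first by apply/YE; split=> // j; exact: (beta_sum_F (fun l => a (off j + l)%N)).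
  move=> i; have /andP[i1 _] := blkP i; rewrite /gc /x.
  have lin := lb_lin (lb (blk i)) (gc_ord i).
  have sumE k : (k <= d (blk i))%N -> gamma (blk i) (i - off (blk i))
     (\sum_(l < k) a (off (blk i) + l)%N *: beta (blk i) l) =
     \sum_(l < k) a (off (blk i) + l)%N * (i - off (blk i) == l)%N%:R.
    elim: k => [|k ih] kd; first by rewrite !big_ord0 gamma0// gc_ord.
    rewrite !big_ord_recr/= addrC lin; last 2 first.
    - exact: (lb_mem (lb _)).
    - exact: (beta_sum_F (fun l => a (off (blk i) + l)%N) (ltnW kd)).
    by rewrite (lb_bio (lb _)) ?gc_ord// ih 1?ltnW// addrC.
  rewrite sumE// (bigD1 (Ordinal (gc_ord i)))//= eqxx mulr1 subnKC// big1 ?addr0//.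
  move=> l li; rewrite (_ : (i - off (blk i) == l)%N = false) ?mulr0//.
  by apply/negbTE; move: li; apply: contra => /eqP li; apply/eqP/val_inj.
- move=> D; have [j [t [x [Fx t1 lt]]]] := cond D.
  pose X : S := \sum_(l < d j) gamma j l x *: gb (off j + l).
  have Xi i : X i = if i == j then \sum_(l < d i) gamma j l x *: beta i l else 0.
    exact: (gb_sum_iota (fun l => gamma j l x)).
  have Xj : X j = x by rewrite Xi eqxx (lb_full (lb j)).
  have mX : mem X by apply: mem_sum => // l; apply: memZ => //; exact: mem_gb.
  have single (Z : S) : mem Z -> (forall i, i != j -> Z i = 0) -> nrm Z = nrm (Z j).
    move=> mZ Zi; apply/eqP; rewrite eq_le; apply/andP; split; last first.
      by apply: l2_coord_le; [by []|case/YE: mZ].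
    case/YE: (mZ) => _ FZ'; have [|_ le] := @fin_supp_Y Z j.+1 FZ'.
      by move=> i ji; apply: Zi; rewrite gt_eqF.
    apply: le_trans le _; rewrite -[leRHS]ger0_norm// -sqrtr_sqr ler_wsqrtr//.
    rewrite /sqs big_ord_recr/= big1 ?add0r// => i _.
    by rewrite Zi ?(nrm0 ok (nU _)) ?expr0n// ltn_eqF.
  pose s := [seq off j + l | l <- iota 0 (d j)]%N.
  pose t' i := t (i - off j)%N.
  exists s, t', X; split.
  - by rewrite map_inj_uniq ?iota_uniq// => u v /addnI.
  - by move=> i; exact: t1.
  - exact: mX.
  have -> : \sum_(i <- s) (t' i * gc i X) *: gb i =
      \sum_(l < d j) (t l * gamma j l x) *: gb (off j + l).
    rewrite /s big_map -{1}[d j]subn0 big_mkord.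
    by apply: eq_bigr => l _; rewrite gc_off// /t' addKn Xj.
  rewrite (single X mX) ?Xj; last by move=> i ij; rewrite Xi (negPf ij).
  rewrite single.
  - by rewrite (gb_sum_iota (fun l => t l * gamma j l x)) eqxx.
  - by apply: mem_sum => // l; apply: memZ => //; exact: mem_gb.
  - by move=> i ij; rewrite (gb_sum_iota (fun l => t l * gamma j l x)) (negPf ij).
Qed.

Theorem concatenation_good_bases : has_good_bases S /\ has_good_bases (dual S).
Proof.
split; first exact: (good_system ok concatenation_system).
exact: (good_system ok (dual_basis_system ok concatenation_system norming_Y)).
Qed.

End concatenation.

(** * Weighted spaces l_p of finite dimension *)

Section weighted_lp.
Context {R : realType} {K : scalars R}.
Hypothesis ok : scalars_ok K.
Variables (I : finType) (omega p : R).
Hypotheses (omega_gt0 : 0 < omega) (p_gt1 : 1 < p).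
Notation V := {ffun I -> K^o}.
Implicit Types y z : V.

(** A constant weight omega covers both the counting measure and the normalised
    one. *)
Definition wlp z : R := (omega * \sum_i smod (z i) `^ p) `^ p^-1.

Let p_gt0 : 0 < p := lt_trans ltr01 p_gt1.
Let p_neq0 : p != 0. Proof. by rewrite gt_eqF. Qed.

Lemma wlp_ge0 z : 0 <= wlp z. Proof. exact: powR_ge0. Qed.

Let sum_ge0 z : 0 <= omega * \sum_i smod (z i) `^ p.
Proof. by rewrite mulr_ge0 ?(ltW omega_gt0)// sumr_ge0// => i _; exact: powR_ge0. Qed.

Lemma wlp_powR z : wlp z `^ p = omega * \sum_i smod (z i) `^ p.
Proof. by rewrite /wlp -powRrM mulVf// powRr1. Qed.

Lemma wlpZ (a : K) z : wlp (a *: z) = smod a * wlp z.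
Proof.
have -> : smod a = (smod a `^ p) `^ p^-1.
  by rewrite -powRrM mulfV// powRr1// smod_ge0.
rewrite /wlp -powRM ?powR_ge0//; congr (_ `^ _).
rewrite [RHS]mulrCA [X in _ = _ * X]mulr_sumr; congr (_ * _); apply: eq_bigr => i _.
by rewrite ffunE -[a *: z i]/(a * z i) (smodM ok) powRM ?smod_ge0.
Qed.

Lemma wlp_eq0 z : wlp z = 0 -> z = 0.
Proof.
move=> h; apply/ffunP => i; rewrite ffunE; apply: (smod_eq0 ok).
have /eqP := wlp_powR z; rewrite h powR0// eq_sym mulf_eq0 gt_eqF//=.
rewrite psumr_eq0; last by move=> j _; exact: powR_ge0.
by move=> /allP /(_ i (mem_index_enum i)); rewrite powR_eq0 => /andP[/eqP].
Qed.

Lemma wlp_coord z i : smod (z i) <= (omega^-1) `^ p^-1 * wlp z.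
Proof.
rewrite /wlp -powRM ?invr_ge0 ?(ltW omega_gt0)//.
rewrite mulrA mulVf ?gt_eqF// mul1r.
have {1}-> : smod (z i) = (smod (z i) `^ p) `^ p^-1.
  by rewrite -powRrM mulfV// powRr1// smod_ge0.
apply: ge0_ler_powR; rewrite ?invr_ge0 ?(ltW p_gt0) ?nnegrE ?powR_ge0//.
  by apply: sumr_ge0 => j _; exact: powR_ge0.
by rewrite (bigD1 i)//= lerDl; apply: sumr_ge0 => j _; exact: powR_ge0.
Qed.

Lemma wlp_young y z : wlp y = 1 -> wlp z = 1 ->
  omega * \sum_i smod (y i) `^ (p - 1) * smod (z i) <= 1.
Proof.
move=> y1 z1; have p1 : 0 < p - 1 by rewrite subr_gt0.
have ys : omega * \sum_i smod (y i) `^ p = 1 by rewrite -wlp_powR y1 powR1.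
have zs : omega * \sum_i smod (z i) `^ p = 1 by rewrite -wlp_powR z1 powR1.
have conj : (p / (p - 1))^-1 + p^-1 = 1.
  by rewrite invf_div; field; rewrite p_neq0.
apply: (@le_trans _ _ (omega * \sum_i (smod (y i) `^ p / (p / (p - 1)) + smod (z i) `^ p / p))).
  rewrite ler_wpM2l ?(ltW omega_gt0)//; apply: ler_sum => i _.
  have := @conjugate_powR R (smod (y i) `^ (p - 1)) (smod (z i)) (p / (p - 1)) p
    (powR_ge0 _ _) (smod_ge0 ok _) (divr_gt0 p_gt0 p1) p_gt0 conj.
  by rewrite -powRrM mulrCA mulfV ?mulr1// gt_eqF.
rewrite big_split/= -!mulr_suml mulrDr !mulrA ys zs !mul1r.
by rewrite conj.
Qed.

Lemma wlp_holder y z :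
  omega * \sum_i smod (y i) `^ (p - 1) * smod (z i) <= wlp y `^ (p - 1) * wlp z.
Proof.
have p1 : p - 1 != 0 by rewrite subr_eq0 gt_eqF.
have [y0|yn] := eqVneq (wlp y) 0.
  rewrite (wlp_eq0 y0) big1 ?mulr0 ?mulr_ge0 ?powR_ge0//.
  by move=> i _; rewrite ffunE (smod0 ok) powR0// mul0r.
have [z0|zn] := eqVneq (wlp z) 0.
  rewrite (wlp_eq0 z0) big1 ?mulr0 ?mulr_ge0 ?powR_ge0//.
  by move=> i _; rewrite ffunE (smod0 ok) mulr0.
have y_gt0 : 0 < wlp y by rewrite lt_neqAle eq_sym yn wlp_ge0.
have z_gt0 : 0 < wlp z by rewrite lt_neqAle eq_sym zn wlp_ge0.
have scale x : 0 < wlp x -> wlp (sinj K (wlp x)^-1 *: x) = 1.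
  move=> x0; rewrite wlpZ.
  have -> : smod (sinj K (wlp x)^-1) = (wlp x)^-1.
    by rewrite (smod_inj ok) ger0_norm// invr_ge0 wlp_ge0.
  by apply: mulVf; rewrite gt_eqF.
have := wlp_young (scale _ y_gt0) (scale _ z_gt0).
rewrite (_ : omega * _ = (omega * \sum_i smod (y i) `^ (p - 1) * smod (z i)) /
    (wlp y `^ (p - 1) * wlp z)).
  by rewrite ler_pdivrMr ?mul1r// mulr_gt0// powR_gt0.
rewrite -mulrA; congr (_ * _); rewrite mulr_suml; apply: eq_bigr => i _.
have sc x : 0 < wlp x -> smod ((sinj K (wlp x)^-1 *: x) i) = (wlp x)^-1 * smod (x i).
  move=> x0; rewrite ffunE; apply: etrans (smodM ok _ _) _.
  by rewrite (smod_inj ok) ger0_norm// invr_ge0 wlp_ge0.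
rewrite (sc y y_gt0) (sc z z_gt0) powRM ?(smod_ge0 ok) ?invr_ge0 ?wlp_ge0//.
have -> : (wlp y)^-1 `^ (p - 1) = (wlp y `^ (p - 1))^-1.
  by rewrite -powR_inv1 ?(ltW y_gt0)// -powRrM mulN1r powRN.
by rewrite invfM; ring.
Qed.

(** The functional given by conj(y_i) |y_i|^(p-2), normalised, by Hoelder's
    inequality.  The triangle inequality for wlp is then a consequence
    ([normed_wlp]). *)
Lemma wlp_norming y : exists f : V -> K^o,
  [/\ forall (a : K) x z, f (a *: x + z) = a * f x + f z,
      forall z, smod (f z) <= wlp z & f y = sinj K (wlp y)].
Proof.
have [y0|yn] := eqVneq (wlp y) 0.
  exists (fun=> 0); split; first by move=> a x z; rewrite mulr0 addr0.
    by move=> z; rewrite (smod0 ok) wlp_ge0.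
  by rewrite y0 (sinj0 ok).
have y_gt0 : 0 < wlp y by rewrite lt_neqAle eq_sym yn wlp_ge0.
pose e i : K := sconj (y i) * sinj K (smod (y i) `^ (p - 2)).
have e_smod i : smod (e i) = smod (y i) `^ (p - 1).
  rewrite /e (smodM ok) (smodJ ok) (smod_inj ok) ger0_norm ?powR_ge0//.
  have [->|yi] := eqVneq (smod (y i)) 0.
    by rewrite mul0r powR0// subr_eq0 gt_eqF.
  have {1}-> : smod (y i) = smod (y i) `^ 1 by rewrite powRr1// smod_ge0.
  by rewrite -powRD ?yi ?implybT//; congr (_ `^ _); ring.
have e_y i : e i * y i = sinj K (smod (y i) `^ p).
  rewrite /e mulrAC (mul_sconj ok) -(sinjM ok); congr (sinj K _).
  have [->|yi] := eqVneq (smod (y i)) 0; first by rewrite expr0n/= mul0r powR0.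
  rewrite -powR_mulrn ?smod_ge0// -powRD ?yi ?implybT//; congr (_ `^ _); ring.
pose c := omega / wlp y `^ (p - 1).
have c0 : 0 <= c by rewrite divr_ge0 ?powR_ge0 ?(ltW omega_gt0).
pose S (z : V) : K := \sum_i e i * z i.
have S_le z : smod (S z) <= \sum_i smod (y i) `^ (p - 1) * smod (z i).
  apply: le_trans (ler_smod_sum ok _ _ _) _; apply: ler_sum => i _.
  by rewrite -e_smod; have -> := smodM ok (e i) (z i).
have S_lin (a : K) x z : S (a *: x + z) = a * S x + S z.
  rewrite /S mulr_sumr -big_split/=; apply: eq_bigr => i _.
  by rewrite !ffunE -[a *: x i]/(a * x i) mulrDr mulrCA.
have S_y : S y = sinj K (\sum_i smod (y i) `^ p).
  by rewrite (sinj_sum ok); apply: eq_bigr => i _; rewrite e_y.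
have smod_cS z : smod (sinj K c * S z) = c * smod (S z).
  by rewrite (smodM ok) (smod_inj ok) ger0_norm.
have cS_y : sinj K c * S y = sinj K (wlp y).
  rewrite S_y -(sinjM ok) /c mulrAC -wlp_powR; congr (sinj K _).
  have -> : wlp y `^ p = wlp y `^ ((p - 1) + 1) by rewrite subrK.
  rewrite powRD; last by rewrite yn implybT.
  by rewrite powRr1 ?wlp_ge0// mulrAC divff ?mul1r// gt_eqF// powR_gt0.
have f_lin (a : K) x z : sinj K c * S (a *: x + z) = a * (sinj K c * S x) + sinj K c * S z.
  by rewrite S_lin mulrDr mulrCA.
have f_le z : smod (sinj K c * S z) <= wlp z.
  rewrite smod_cS /c mulrAC (ler_pdivrMr _ _ (powR_gt0 _ y_gt0)).
  rewrite [leRHS]mulrC; apply: le_trans (wlp_holder y z).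
  by rewrite ler_wpM2l ?(ltW omega_gt0).
pose f (z : V) : K^o := sinj K c * S z.
exists f; split.
- exact: f_lin.
- exact: f_le.
- exact: cS_y.
Qed.

Variable N : V -> R.
Hypothesis NE : forall z, N z = wlp z.
Notation S := (@full_space R K V N).

Lemma normed_wlp : normed S.
Proof.
constructor.
- by [].
- move=> x y _ _; rewrite [nrm _]NE [nrm x]NE [nrm y]NE.
  have [f [fl fle fxy]] := wlp_norming (x + y).
  have -> : wlp (x + y) = smod (f (x + y)).
    by rewrite fxy (smod_inj ok) ger0_norm// wlp_ge0.
  have -> : f (x + y) = f x + f y by rewrite -[x]scale1r fl scale1r mul1r.
  by rewrite (le_trans (ler_smodD ok _ _))// lerD.
- by move=> a x _; rewrite [nrm _]NE [nrm x]NE wlpZ.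
- by move=> x _; rewrite [nrm _]NE; exact: wlp_eq0.
Qed.

Lemma norming_wlp (y : S) : exists f : S -> K^o,
  [/\ forall (a : K) (x z : S), f (a *: x + z) = a * f x + f z,
      forall z : S, smod (f z) <= nrm z & f y = sinj K (nrm y)].
Proof.
have [f [fl fle fy]] := wlp_norming y; exists f.
have nE (z : S) : nrm z = wlp z by exact: NE.
by split=> [//|z|]; rewrite nE.
Qed.

(** This gives some finite basis constant for the finitely many blocks in which
    s > 1/14. *)
Lemma wlp_linear_bounded (T : V -> V) :
  (forall (a : K) (x z : V), T (a *: x + z) = a *: T x + T z) ->
  exists2 C : R, 0 <= C & forall z : S, nrm (T z : S) <= C * nrm z.
Proof.
move=> Tl; pose delta i : V := [ffun j => (j == i)%:R].
have T0 : T 0 = 0.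
  have := Tl 1 0 0; rewrite scale1r addr0 scale1r => /eqP.
  by rewrite -subr_eq0 opprD addrA subrr sub0r oppr_eq0 => /eqP.
have zE z : z = \sum_i z i *: delta i.
  apply/ffunP => j; rewrite sum_ffunE (bigD1 j)//= !ffunE eqxx big1 ?addr0.
    by rewrite -[_ *: _]/(_ * _) mulr1.
  by move=> i ij; rewrite !ffunE eq_sym (negPf ij) scaler0.
have T_sum (r : seq I) (a : I -> K) : T (\sum_(i <- r) a i *: delta i) =
    \sum_(i <- r) a i *: T (delta i).
  by elim: r => [|i r ih]; rewrite ?big_nil// !big_cons Tl ih.
have nS := normed_wlp.
exists (\sum_i (omega^-1) `^ p^-1 * nrm (T (delta i) : S)).
  by apply: sumr_ge0 => i _; rewrite mulr_ge0 ?powR_ge0// (nrm_ge0 ok nS).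
move=> z; rewrite {1}(zE z) T_sum.
apply: le_trans (nrm_sum ok nS _ _) _ => //.
rewrite mulr_suml; apply: ler_sum => i _; rewrite (nrmZ nS)//.
rewrite mulrAC ler_wpM2r ?(nrm_ge0 ok nS)// [nrm z]NE; exact: wlp_coord.
Qed.

End weighted_lp.

(** * Partial sums of Walsh sums *)

Section bellman_scalars.
Context {R : realType} {K : scalars R}.
Hypothesis ok : scalars_ok K.
Variable s : R.
Hypotheses (s_gt0 : 0 < s) (s_le : s <= 14^-1).

Definition bellK (x y : K) : R := bell s (smod x ^+ 2) (smod y ^+ 2).

(** [bell_tangent] for scalars.  The derivative enters below only as an additive,
    real homogeneous form D. *)
Lemma bellK_tangent (x y : K) : exists D : K -> K -> R,
  [/\ forall h k h' k', D (h + h') (k + k') = D h k + D h' k',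
      forall h k, D (- h) (- k) = - D h k,
      forall (r : R) h k, D (sinj K r * h) (sinj K r * k) = r * D h k &
      forall h k, smod k <= smod h -> bellK (x + h) (y + k) <= bellK x y + D h k].
Proof.
exists (fun h k => bell_D s (sre x) (sim x) (sre y) (sim y) (sre h) (sim h) (sre k) (sim k)).
split.
- by move=> h k h' k'; rewrite /bell_D !(sreD ok) !(simD ok); ring.
- by move=> h k; rewrite /bell_D !(sreN ok) !(simN ok); ring.
- move=> r h k; rewrite /bell_D !(sreM ok) !(simM ok) !(sre_inj ok) !(sim_inj ok); ring.
- move=> h k kh; rewrite /bellK !(smod_sqr ok) !(sreD ok) !(simD ok).
  apply: bell_tangent => //; rewrite -!(smod_sqr ok).
  by rewrite ler_pXn2r ?nnegrE ?smod_ge0.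
Qed.

Lemma bellK_two_point (x y h k : K) : smod k <= smod h ->
  bellK (x + h) (y + k) + bellK (x - h) (y - k) <= 2 * bellK x y.
Proof.
move=> kh; have [D [DD DN _ Dt]] := bellK_tangent x y.
have := Dt h k kh; have := Dt (- h) (- k); rewrite !(smodN ok) DN => /(_ kh).
lra.
Qed.

Lemma bellK_le0 (x y : K) : smod y <= smod x -> bellK x y <= 0.
Proof.
move=> yx; rewrite /bellK /bell mulr_le0_ge0 ?powR_ge0// subr_le0.
have xy : smod y ^+ 2 <= smod x ^+ 2 by rewrite ler_pXn2r ?nnegrE ?smod_ge0.
by rewrite (le_trans xy)// ler_peMl ?sqr_ge0// lerDl mulr_ge0// ltW.
Qed.

Lemma bellKN (x y : K) : bellK (- x) (- y) = bellK x y.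
Proof. by rewrite /bellK !(smodN ok). Qed.

(** Needed with q = p/2 to compare |x|^p + |y|^p with (|x|^2 + |y|^2)^(p/2). *)
Lemma powR_superadd (A B q : R) : 0 <= A -> 0 <= B -> 1 <= q ->
  A `^ q + B `^ q <= (A + B) `^ q.
Proof.
move=> A0 B0 q1.
have qE x : x != 0 -> 0 <= x -> x `^ q = x * x `^ (q - 1).
  move=> xn x0; have -> : x `^ q = x `^ (1 + (q - 1)) by rewrite addrC subrK.
  rewrite (@powRD _ x 1); last by rewrite xn implybT.
  by rewrite powRr1.
have half x y : 0 <= x -> 0 <= y -> x `^ q <= x * (x + y) `^ (q - 1).
  move=> x0 y0; have [->|xn] := eqVneq x 0.
    by rewrite powR0 ?mul0r// gt_eqF// (lt_le_trans ltr01).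
  rewrite qE// ler_wpM2l//.
  by apply: ge0_ler_powR; rewrite ?nnegrE ?subr_ge0 ?addr_ge0// lerDl.
have [AB|AB] := eqVneq (A + B) 0.
  have q0 : q != 0 by rewrite gt_eqF// (lt_le_trans ltr01).
  have /eqP := AB; rewrite paddr_eq0// => /andP[/eqP -> /eqP ->].
  by rewrite addr0 powR0// addr0.
rewrite (qE (A + B)) ?addr_ge0// mulrDl lerD ?half//.
by rewrite [A + B]addrC half.
Qed.

Definition bell_kappa : R := 1 + 14 * s.
Definition bell_lambda : R := 1 - (1 + bell_kappa) * s / (2 + s).

(** Write r = |x|^2 + |y|^2, so that U = r^(p/2) - (1 + kappa) |x|^2 r^(s/2).
    Young's inequality bounds |x|^2 r^(s/2) by (2/p) |x|^p + (s/p) r^(p/2), and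
    r^(p/2) >= |x|^p + |y|^p. *)
Lemma bellK_lower (x y : K) :
  bell_lambda * smod y `^ (2 + s) <= bellK x y + bell_kappa * smod x `^ (2 + s).
Proof.
have p0 : 0 < 2 + s by rewrite addr_gt0.
set a := smod x; set b := smod y; set r := a ^+ 2 + b ^+ 2.
have a0 : 0 <= a := smod_ge0 ok x; have b0 : 0 <= b := smod_ge0 ok y.
have r0 : 0 <= r by rewrite addr_ge0 ?sqr_ge0.
have sqp u : 0 <= u -> (u ^+ 2) `^ ((2 + s) / 2) = u `^ (2 + s).
  move=> u0; rewrite -powR_mulrn// -powRrM; congr (_ `^ _).
  by rewrite mulrCA mulfV ?mulr1.
have rr : r `^ ((2 + s) / 2) = r * r `^ (s / 2).
  have [->|rn] := eqVneq r 0; first by rewrite mul0r powR0// gt_eqF// divr_gt0.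
  have -> : (2 + s) / 2 = 1 + s / 2 by field.
  by rewrite powRD ?rn ?implybT// powRr1.
have young : a ^+ 2 * r `^ (s / 2) <= 2 / (2 + s) * a `^ (2 + s) + s / (2 + s) * r `^ ((2 + s) / 2).
  have c : ((2 + s) / 2)^-1 + ((2 + s) / s)^-1 = 1.
    by field; rewrite !gt_eqF.
  have := @conjugate_powR R (a ^+ 2) (r `^ (s / 2)) ((2 + s) / 2) ((2 + s) / s)
    (sqr_ge0 _) (powR_ge0 _ _) (divr_gt0 p0 (ltr0n R 2)) (divr_gt0 p0 s_gt0) c.
  rewrite sqp// -powRrM => h; apply: le_trans h _.
  have -> : s / 2 * ((2 + s) / s) = (2 + s) / 2 by field; rewrite gt_eqF.
  by rewrite !invf_div le_eqVlt; apply/orP; left; apply/eqP; ring.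
have super : a `^ (2 + s) + b `^ (2 + s) <= r `^ ((2 + s) / 2).
  rewrite -(sqp a)// -(sqp b)//; apply: powR_superadd; rewrite ?sqr_ge0//.
  by rewrite ler_pdivlMr// mul1r lerDl ltW.
have E : bellK x y = r `^ ((2 + s) / 2) - (1 + bell_kappa) * (a ^+ 2 * r `^ (s / 2)).
  rewrite rr /bellK /bell -/a -/b -/r /bell_kappa /r; ring.
have k0 : 0 <= 1 + bell_kappa by rewrite /bell_kappa !addr_ge0// mulr_ge0// ltW.
have k3 : 1 + bell_kappa <= 3 by move: s_le; rewrite /bell_kappa; lra.
have l0 : 0 <= bell_lambda.
  rewrite /bell_lambda subr_ge0 ler_pdivrMr// mul1r.
  by rewrite (le_trans (ler_wpM2r (ltW s_gt0) k3))//; move: s_le; lra.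
have Y := ler_wpM2l k0 young; have S := ler_wpM2l l0 super.
have le2 : bell_lambda * r `^ ((2 + s) / 2) - (1 + bell_kappa) * (2 / (2 + s)) * a `^ (2 + s) <= bellK x y.
  rewrite E -/(bell_lambda).
  have -> : bell_lambda = 1 - (1 + bell_kappa) * (s / (2 + s)).
    by rewrite /bell_lambda mulrA.
  move: Y; move: (1 + bell_kappa) (s / (2 + s)) (2 / (2 + s)) => k3' c1 c2.
  move: (r `^ _) (a `^ _) (a ^+ 2 * _) => u v w.
  by rewrite mulrDr; lra.
have e2 : bell_lambda + bell_kappa = (1 + bell_kappa) * (2 / (2 + s)).
  by rewrite /bell_lambda; field; rewrite gt_eqF.
move: le2 S; rewrite -e2 mulrDr mulrDl.
move: bell_lambda bell_kappa (bellK x y) (r `^ _) (a `^ _) (b `^ _) => l k' u v t w.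
lra.
Qed.

End bellman_scalars.

Section walsh.

Definition bit (t k : nat) : bool := odd (k %/ 2 ^ t).

Lemma bit_low n t k : (t < n)%N -> bit t (2 ^ n + k) = bit t k.
Proof.
move=> tn; have -> : (2 ^ n = 2 ^ (n - t) * 2 ^ t)%N.
  by rewrite -expnD subnK// ltnW.
by rewrite /bit divnMDl ?expn_gt0// oddD oddX subn_eq0 leqNgt tn.
Qed.

Lemma bit_top n k : (k < 2 ^ n)%N -> bit n (2 ^ n + k).
Proof.
by move=> kn; rewrite /bit -{1}[(2 ^ n)%N]mul1n divnMDl ?expn_gt0// divn_small.
Qed.

Lemma bit_small n k : (k < 2 ^ n)%N -> bit n k = false.
Proof. by move=> kn; rewrite /bit divn_small. Qed.

Lemma bits_inj n k l : (k < 2 ^ n)%N -> (l < 2 ^ n)%N ->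
  (forall t, (t < n)%N -> bit t k = bit t l) -> k = l.
Proof.
have top m j : (j < 2 ^ m.+1)%N -> (2 ^ m <= j)%N -> exists2 i, (i < 2 ^ m)%N & j = (2 ^ m + i)%N.
  move=> jm mj; exists (j - 2 ^ m)%N; last by rewrite subnKC.
  by rewrite ltn_subLR// addnn -mul2n -expnS.
elim: n k l => [|n ih] k l; first by rewrite expn0 !ltnS !leqn0 => /eqP -> /eqP ->.
move=> kn ln h; have hn := h n (ltnSn n).
have [k1|/(top n k kn)[k' k'n kE]] := ltnP k (2 ^ n);
  have [l1|/(top n l ln)[l' l'n lE]] := ltnP l (2 ^ n).
- by apply: ih => // t tn; apply: h; exact: ltnW.
- by move: hn; rewrite lE bit_top// bit_small.
- by move: hn; rewrite kE bit_top// bit_small.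
- rewrite kE lE; congr (_ + _)%N; apply: ih => // t tn.
  by have := h t (ltnW tn); rewrite kE lE !bit_low.
Qed.

Variable K : pzRingType.

(** The characters of the group of n signs, with characters and group elements
    numbered by their binary digits. *)
Definition walsh (n i g : nat) : K := \prod_(t < n) (-1) ^+ (bit t i && bit t g).

Lemma walshS n i g : walsh n.+1 i g = walsh n i g * (-1) ^+ (bit n i && bit n g).
Proof. by rewrite /walsh big_ord_recr. Qed.

Lemma walsh_addl n i g : walsh n (2 ^ n + i) g = walsh n i g.
Proof. by apply: eq_bigr => t _; rewrite bit_low. Qed.

Lemma walsh_addr n i g : walsh n i (2 ^ n + g) = walsh n i g.
Proof. by apply: eq_bigr => t _; rewrite (bit_low _ (ltn_ord t)). Qed.

Lemma sum_pow2 (V : nmodType) n (G : nat -> V) :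
  \sum_(i < 2 ^ n.+1) G i = \sum_(i < 2 ^ n) G i + \sum_(i < 2 ^ n) G (2 ^ n + i)%N.
Proof. by rewrite expnS mul2n -addnn big_split_ord. Qed.

End walsh.

Section walsh_bellman.
Context {R : realType} {K : scalars R}.
Hypothesis ok : scalars_ok K.
Variable s : R.
Hypotheses (s_gt0 : 0 < s) (s_le : s <= 14^-1).
Notation W := (walsh K).
Notation bellK := (bellK s).

(** Induction on the number n of signs.  Fixing the last sign to + or - replaces the
    full sum by A0 + A1 or A0 - A1, where A1 collects the indices with top digit 1.
    If m has top digit 0 the truncated sum does not depend on the last sign, and
    [bellK_two_point] applies to the increments (A1, 0); if m has top digit 1 the
    truncated sum is A0 + T or A0 - T, and after exchanging the roles of centre and
    increment the increments are (A0, A0).  The scalar b replaces the m-th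
    coefficient in the truncated sum: a part of the m-th term may already be
    present. *)
Lemma walsh_bellK n (a : nat -> K) m (b : K) : (m < 2 ^ n)%N ->
  \sum_(g < 2 ^ n) bellK (\sum_(i < 2 ^ n) W n i g * a i)
                         (\sum_(i < m) W n i g * a i + W n m g * b)
  <= (2 ^ n)%:R * bellK (a m) b.
Proof.
elim: n a m b => [|n ih] a m b mn.
  move: mn; rewrite expn0 ltnS leqn0 => /eqP ->.
  by rewrite !big_ord_recr !big_ord0/= /walsh !big_ord0 !mul1r !add0r.
rewrite (sum_pow2 n (fun g => bellK (\sum_(i < 2 ^ n.+1) W n.+1 i g * a i)
  (\sum_(i < m) W n.+1 i g * a i + W n.+1 m g * b))) -big_split/=.
have w00 i g : (i < 2 ^ n)%N -> W n.+1 i g = W n i g.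
  by move=> h; rewrite walshS (bit_small h) mulr1.
have wr0 i g : (i < 2 ^ n)%N -> W n.+1 i (2 ^ n + g) = W n i g.
  by move=> h; rewrite w00// walsh_addr.
have w10 i g : (g < 2 ^ n)%N -> W n.+1 (2 ^ n + i) g = W n i g.
  by move=> h; rewrite walshS (bit_small h) andbF mulr1 walsh_addl.
have w11 i g : (i < 2 ^ n)%N -> (g < 2 ^ n)%N -> W n.+1 (2 ^ n + i) (2 ^ n + g) = - W n i g.
  by move=> h h'; rewrite walshS (bit_top h) (bit_top h') expr1 mulrN1 walsh_addl walsh_addr.
pose A0 g := \sum_(i < 2 ^ n) W n i g * a i.
pose A1 g := \sum_(i < 2 ^ n) W n i g * a (2 ^ n + i)%N.
have X0 g : (g < 2 ^ n)%N -> \sum_(i < 2 ^ n.+1) W n.+1 i g * a i = A0 g + A1 g.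
  move=> gn; rewrite (sum_pow2 n (fun i => W n.+1 i g * a i)).
  congr (_ + _); apply: eq_bigr => i _.
    by rewrite w00.
  by rewrite w10.
have X1 g : (g < 2 ^ n)%N -> \sum_(i < 2 ^ n.+1) W n.+1 i (2 ^ n + g) * a i = A0 g - A1 g.
  move=> gn; rewrite (sum_pow2 n (fun i => W n.+1 i (2 ^ n + g) * a i)).
  congr (_ + _); first by apply: eq_bigr => i _; rewrite wr0.
  by rewrite -sumrN; apply: eq_bigr => i _; rewrite w11// mulNr.
have pow2S : (2 ^ n.+1)%:R = 2 * (2 ^ n)%:R :> R by rewrite expnS natrM.
have [m0|m1] := ltnP m (2 ^ n).
  pose T g := \sum_(i < m) W n i g * a i + W n m g * b.
  have T0 g : \sum_(i < m) W n.+1 i g * a i + W n.+1 m g * b = T g.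
    congr (_ + _); last by rewrite w00.
    by apply: eq_bigr => i _; rewrite w00// (ltn_trans (ltn_ord i)).
  have T1 g : \sum_(i < m) W n.+1 i (2 ^ n + g) * a i + W n.+1 m (2 ^ n + g) * b = T g.
    congr (_ + _); last by rewrite wr0.
    by apply: eq_bigr => i _; rewrite wr0// (ltn_trans (ltn_ord i)).
  rewrite pow2S -mulrA; apply: le_trans (ler_wpM2l _ (ih a m b m0)) => //.
  rewrite mulr_sumr; apply: ler_sum => g _.
  rewrite X0// X1// T0 T1 -/(A0 g) -/(T g).
  rewrite -{1}[T g]addr0 -{2}[T g]subr0; apply: bellK_two_point => //.
  by rewrite (smod0 ok) smod_ge0.
pose m' := (m - 2 ^ n)%N; have mE : m = (2 ^ n + m')%N by rewrite subnKC.
have m'n : (m' < 2 ^ n)%N by rewrite ltn_subLR// addnn -mul2n -expnS.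
pose T g := \sum_(i < m') W n i g * a (2 ^ n + i)%N + W n m' g * b.
have T0 g : (g < 2 ^ n)%N -> \sum_(i < m) W n.+1 i g * a i + W n.+1 m g * b = A0 g + T g.
  move=> gn; rewrite mE big_split_ord/= -addrA; congr (_ + _).
    by apply: eq_bigr => i _; rewrite w00.
  congr (_ + _); last by rewrite w10.
  by apply: eq_bigr => i _; rewrite w10.
have T1 g : (g < 2 ^ n)%N -> \sum_(i < m) W n.+1 i (2 ^ n + g) * a i
    + W n.+1 m (2 ^ n + g) * b = A0 g - T g.
  move=> gn; rewrite mE big_split_ord/= -addrA; congr (_ + _).
    by apply: eq_bigr => i _; rewrite wr0.
  rewrite opprD -sumrN; congr (_ + _); last by rewrite w11// mulNr.
  by apply: eq_bigr => i _; rewrite w11// ?mulNr// (ltn_trans (ltn_ord i)).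
rewrite mE pow2S -mulrA.
apply: le_trans (ler_wpM2l _ (ih (fun i => a (2 ^ n + i)%N) m' b m'n)) => //.
rewrite mulr_sumr -mE; apply: ler_sum => g _.
rewrite X0// X1// T0// T1// -/(A1 g) -/(T g).
rewrite -(bellKN ok s (A0 g - A1 g)) !opprB [A0 g + A1 g]addrC [A0 g + T g]addrC.
exact: bellK_two_point.
Qed.

(** The form in which the Bellman function is used: truncation in the order of
    codes costs a factor close to 1 in L_p, provided that the partial last term
    makes a nonpositive contribution. *)
Lemma walsh_powR n (a : nat -> K) m (b : K) : (m < 2 ^ n)%N ->
  bell_lambda s * \sum_(g < 2 ^ n) smod (\sum_(i < m) W n i g * a i + W n m g * b) `^ (2 + s)
  <= (2 ^ n)%:R * bellK (a m) b
     + bell_kappa s * \sum_(g < 2 ^ n) smod (\sum_(i < 2 ^ n) W n i g * a i) `^ (2 + s).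
Proof.
move=> mn; apply: le_trans (lerD (walsh_bellK a b mn) (lexx _)).
rewrite !mulr_sumr -big_split/=; apply: ler_sum => g _.
exact: bellK_lower.
Qed.

End walsh_bellman.

(** * Bases from chains of projections *)

Section chain.
Context {R : realType} {K : scalars R}.
Variables (V : space K) (F : set V) (E : nat -> V -> V) (T : nat).
Variable lam : nat -> V -> K^o.
Hypothesis subF : linear_subspace F.
Hypothesis E_lin : forall t, linear_on F (E t).
Hypothesis E_F : forall t x, F x -> F (E t x).
Hypothesis E_0 : forall x, F x -> E 0 x = 0.
Hypothesis E_T : forall x, F x -> E T x = x.
Hypothesis E_comp : forall s t x, F x -> E s (E t x) = E (minn s t) x.
Hypothesis lam_lin : forall t, linear_on F (lam t).
Hypothesis lam_ker : forall t x, F x -> lam t x = 0 -> E t.+1 x = E t x.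
Hypothesis F_neq0 : exists2 x, F x & x <> 0.

Let F0 : F 0. Proof. by case: subF. Qed.
Let FZD (a : K) x y : F x -> F y -> F (a *: x + y).
Proof. by case: subF => _; apply. Qed.
Let FZ (a : K) x : F x -> F (a *: x).
Proof. by move=> Fx; rewrite -[X in F X]addr0; exact: FZD. Qed.

Let lin0 (W : lmodType K) (f : V -> W) : linear_on F f -> f 0 = 0.
Proof.
move=> fl; have := fl 1 0 0 F0 F0; rewrite scale1r addr0 scale1r => /eqP.
by rewrite -subr_eq0 opprD addrA subrr sub0r oppr_eq0 => /eqP.
Qed.
Let linZ (W : lmodType K) (f : V -> W) (a : K) x : linear_on F f -> F x -> f (a *: x) = a *: f x.
Proof. by move=> fl Fx; rewrite -[X in f X]addr0 fl// lin0// addr0. Qed.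
Let linB (W : lmodType K) (f : V -> W) x y : linear_on F f -> F x -> F y -> f (x - y) = f x - f y.
Proof.
by move=> fl Fx Fy; rewrite addrC -scaleN1r fl// scaleN1r addrC.
Qed.
Let FB x y : F x -> F y -> F (x - y).
Proof. by move=> Fx Fy; rewrite addrC -scaleN1r; exact: FZD. Qed.

Let lin_sum (f : V -> K^o) (d : nat) (a : nat -> K) (b : nat -> V) : linear_on F f ->
  (forall l, (l < d)%N -> F (b l)) ->
  F (\sum_(l < d) a l *: b l) /\ f (\sum_(l < d) a l *: b l) = \sum_(l < d) a l * f (b l).
Proof.
move=> fl; elim: d => [|d ih] Fb; first by rewrite !big_ord0 lin0.
have [|Fs fs] := ih; first by move=> l ld; apply: Fb; exact: ltnW.
have Fd : F (b d) by exact: Fb.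
rewrite !big_ord_recr/= addrC; split; first exact: FZD.
by rewrite fl// fs addrC.
Qed.

(** E_0 = 0, E_1, ..., E_T is an increasing chain of commuting projections in which
    each step raises the rank by at most one, because the functional lam_t detects
    the increment.  A nonzero increment contributes one basis vector v, with
    coordinate functional lam_t, so that every partial sum of the basis is one of
    the projections. *)
Lemma chain_prefix t : exists (d : nat) (beta : nat -> V) (gamma : nat -> V -> K^o),
  [/\ (forall l, (l < d)%N -> F (beta l) /\ E t (beta l) = beta l),
      (forall l, (l < d)%N -> linear_on F (gamma l)),
      (forall l l', (l < d)%N -> (l' < d)%N -> gamma l (beta l') = (l == l')%:R),
      (forall x, F x -> \sum_(l < d) gamma l x *: beta l = E t x) &
      (forall k, (k <= d)%N -> exists t', forall x, F x ->
         \sum_(l < k) gamma l x *: beta l = E t' x)].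
Proof.
elim: t => [|t [d [beta [gamma [hb hg hbio hsum hpart]]]]].
  exists 0%N, (fun=> 0), (fun=> fun=> 0); split=> //.
    by move=> x Fx; rewrite big_ord0 E_0.
  by move=> k; rewrite leqn0 => /eqP ->; exists 0%N => x Fx; rewrite big_ord0 E_0.
have [same|/existsNP[x0 /not_implyP[Fx0 D0]]] := pselect (forall x, F x -> E t.+1 x = E t x).
  exists d, beta, gamma; split=> // [l ld|x Fx]; last by rewrite hsum// same.
  by have [Fb Eb] := hb l ld; rewrite same.
have l0 : lam t x0 != 0 by apply/eqP => /(lam_ker Fx0).
pose D x := E t.+1 x - E t x.
have DE x : F x -> F (D x) by move=> Fx; apply: FB; exact: E_F.
pose v : V := (lam t x0)^-1 *: D x0.
have Fv : F v by apply: FZ; exact: DE.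
(* The kernel of lam t has codimension one in F, and D vanishes on it. *)
have Dv x : F x -> D x = lam t x *: v.
  move=> Fx; pose y := x - (lam t x / lam t x0) *: x0.
  have Fz : F ((lam t x / lam t x0) *: x0) by exact: FZ.
  have Fy : F y by exact: FB.
  have ly : lam t y = 0.
    by rewrite /y linB// linZ// -[_ *: _]/(_ * _) divfK// subrr.
  have h := lam_ker Fy ly; move: h; rewrite /y.
  rewrite (linB (E_lin t.+1) Fx Fz) (linB (E_lin t) Fx Fz).
  rewrite (linZ _ (E_lin t.+1) Fx0) (linZ _ (E_lin t) Fx0) => h.
  have {}h : D x = (lam t x / lam t x0) *: D x0.
    rewrite /D scalerBr; apply/eqP; rewrite subr_eq.
    move/eqP: h; rewrite subr_eq => /eqP ->.
    by rewrite [X in X == _]addrC [X in _ == X]addrAC addrA.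
  by rewrite h /v scalerA.
have Etv : E t v = 0.
  rewrite /v linZ//; last exact: DE.
  by rewrite /D linB ?E_comp ?minnn ?(minn_idPl (leqnSn t)) ?subrr ?scaler0//; exact: E_F.
have EtSv : E t.+1 v = v.
  rewrite /v linZ//; last exact: DE.
  by rewrite /D linB ?E_comp ?minnn ?(minn_idPr (leqnSn t))//; exact: E_F.
have v0 : v <> 0.
  move=> vz; apply: D0; apply/eqP; rewrite -subr_eq0; apply/eqP.
  by rewrite -/(D x0) Dv// vz scaler0.
have lv : lam t v = 1.
  have := Dv v Fv; rewrite /D EtSv Etv subr0 => h.
  apply/eqP; rewrite -subr_eq0; apply/negPn/negP => n1; apply: v0.
  have : (lam t v - 1) *: v = 0 by rewrite scalerBl -h scale1r subrr.
  by move/eqP; rewrite scaler_eq0 (negPf n1) => /eqP.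
have lb l : (l < d)%N -> lam t (beta l) = 0.
  move=> ld; have [Fb Eb] := hb l ld; have := Dv _ Fb.
  rewrite /D -{1}Eb E_comp// (minn_idPr (leqnSn t)) subrr => /esym/eqP.
  by rewrite scaler_eq0 => /orP[/eqP//|/eqP/v0].
have Eb1 l : (l < d)%N -> E t.+1 (beta l) = beta l.
  by move=> ld; have [Fb Eb] := hb l ld; rewrite -{1}Eb E_comp// (minn_idPr (leqnSn t)).
have gv l : (l < d)%N -> gamma l v = 0.
  move=> ld; have := hsum v Fv; rewrite Etv => h.
  have [|_] := lin_sum (fun l => gamma l v) (hg l ld) (d := d) (b := beta).
    by move=> k kd; case: (hb k kd).
  rewrite h lin0; last exact: hg.
  rewrite (bigD1 (Ordinal ld))//= hbio// eqxx mulr1 big1 ?addr0//.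
  move=> k kl; rewrite hbio// (_ : (l == k :> nat) = false) ?mulr0//.
  by apply/negbTE; move: kl; apply: contra => /eqP kl; apply/eqP/val_inj.
pose beta' l := if (l == d)%N then v else beta l.
pose gamma' l : V -> K^o := if (l == d)%N then lam t else gamma l.
have low k x : (k <= d)%N -> \sum_(l < k) gamma' l x *: beta' l = \sum_(l < k) gamma l x *: beta l.
  move=> kd; apply: eq_bigr => l _; rewrite /gamma' /beta' ltn_eqF//.
  exact: leq_trans (ltn_ord l) kd.
have full x : F x -> \sum_(l < d.+1) gamma' l x *: beta' l = E t.+1 x.
  move=> Fx; rewrite big_ord_recr/= low// hsum// /gamma' /beta' eqxx -Dv//.
  by rewrite /D addrC subrK.
exists d.+1, beta', gamma'; split=> //.
- move=> l; rewrite ltnS leq_eqVlt /beta' => /predU1P[->|ld]; first by rewrite eqxx.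
  by rewrite ltn_eqF//; split; [case: (hb l ld)|exact: Eb1].
- move=> l; rewrite ltnS leq_eqVlt /gamma' => /predU1P[->|ld]; first by rewrite eqxx.
  by rewrite ltn_eqF//; exact: hg.
- have ltS k : (k < d.+1)%N -> k = d \/ (k < d)%N.
    by rewrite ltnS leq_eqVlt => /predU1P.
  move=> l l' /ltS[->|ld] /ltS[->|ld']; rewrite /gamma' /beta'.
  + by rewrite !eqxx lv.
  + by rewrite eqxx (ltn_eqF ld') eq_sym (ltn_eqF ld') lb.
  + by rewrite eqxx (ltn_eqF ld) gv.
  + by rewrite (ltn_eqF ld) (ltn_eqF ld') hbio.
- move=> k; rewrite leq_eqVlt => /predU1P[->|]; first by exists t.+1.
  rewrite ltnS => kd; have [t' ht'] := hpart k kd.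
  by exists t' => x Fx; rewrite low// ht'.
Qed.

Lemma chain_basis : exists (d : nat) (beta : nat -> V) (gamma : nat -> V -> K^o),
  forall kappa : R, (forall t x, F x -> nrm (E t x) <= kappa * nrm x) ->
  local_basis F kappa d beta gamma.
Proof.
have [d [beta [gamma [hb hg hbio hsum hpart]]]] := chain_prefix T.
exists d, beta, gamma => kappa hk; split=> //.
- case: d hb hg hbio hsum hpart => // hb hg hbio hsum hpart.
  have [x Fx x0] := F_neq0; exfalso; apply: x0.
  by rewrite -(E_T Fx) -hsum// big_ord0.
- by move=> l ld; case: (hb l ld).
- by move=> x Fx; rewrite hsum// E_T.
- by move=> k x kd Fx; have [t ht] := hpart k kd; rewrite ht// hk.
Qed.

End chain.

(** * Actions of sign groups *)

Section sign_group.
Variables (R : realType) (n : nat).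
Notation G := {ffun 'I_n -> 'I_2}.
Implicit Types (i g h : G) (k : nat).

Definition chi i g : R := \prod_(t < n) (-1) ^+ ((i t != 0) && (g t != 0)).

Definition dec k : G := [ffun t : 'I_n => if bit t k then 1 else 0 : 'I_2].

Lemma dec_neq0 k t : (dec k t != 0) = bit t k.
Proof. by rewrite ffunE; case: (bit t k). Qed.

Lemma chi_dec k l : chi (dec k) (dec l) = walsh R n k l.
Proof. by apply: eq_bigr => t _; rewrite !dec_neq0. Qed.

Lemma dec_bij : bijective (fun k : 'I_(2 ^ n) => dec k).
Proof.
apply: inj_card_bij; last by rewrite card_ffun !card_ord.
move=> k l kl; apply: val_inj; apply: (@bits_inj n); rewrite ?ltn_ord// => t tn.
by have /ffunP/(_ (Ordinal tn)) := kl; rewrite !ffunE/=; case: (bit t k); case: (bit t l).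
Qed.

Lemma sum_dec (V : nmodType) (F : G -> V) : \sum_i F i = \sum_(k < 2 ^ n) F (dec k).
Proof. by rewrite (reindex _ (onW_bij _ dec_bij)). Qed.

Lemma dec_surj i : exists2 k, (k < 2 ^ n)%N & dec k = i.
Proof. by have [f _ fK] := dec_bij; exists (f i); rewrite ?ltn_ord ?fK. Qed.

Lemma dec_inj k l : (k < 2 ^ n)%N -> (l < 2 ^ n)%N -> dec k = dec l -> k = l.
Proof.
move=> kn ln kl; have := bij_inj dec_bij (x1 := Ordinal kn) (x2 := Ordinal ln) kl.
by move/(congr1 val).
Qed.

Lemma I2_add (a b : 'I_2) : (a + b != 0) = (a != 0) (+) (b != 0).
Proof. by case: a => [[|[|?]] ?]; case: b => [[|[|?]] ?]. Qed.

Lemma I2_opp (a : 'I_2) : - a = a.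
Proof. by apply: val_inj; case: a => [[|[|?]] ?]. Qed.

Lemma addgg g : g + g = 0.
Proof. by apply/ffunP => t; rewrite !ffunE -{2}[g t]I2_opp subrr. Qed.

Lemma chi_sym i g : chi i g = chi g i.
Proof. by apply: eq_bigr => t _; rewrite andbC. Qed.

Lemma chiD i g h : chi i (g + h) = chi i g * chi i h.
Proof.
rewrite /chi -big_split/=; apply: eq_bigr => t _.
rewrite ffunE I2_add -signr_addb; congr (_ ^+ nat_of_bool _).
by case: (i t != 0); case: (g t != 0); case: (h t != 0).
Qed.

Lemma chi0 i : chi i 0 = 1.
Proof. by rewrite /chi big1// => t _; rewrite ffunE eqxx andbF. Qed.

Lemma chi_sqr i g : chi i g * chi i g = 1.
Proof. by rewrite -chiD addgg chi0. Qed.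

Lemma sum_chi g : \sum_i chi i g = if g == 0 then (2 ^ n)%:R else 0.
Proof.
case: eqP => [->|/eqP g0].
  under eq_bigr do rewrite chi0.
  by rewrite sumr_const card_ffun !card_ord.
have [t gt0] : exists t, g t != 0.
  case: (pickP (fun t => g t != 0)) => [t ht|h]; first by exists t.
  case/eqP: g0; apply/ffunP => t; rewrite ffunE.
  by have /negbT/negPn/eqP := h t.
pose e : G := [ffun u => if u == t then 1 else 0].
have e1 : chi e g = -1.
  rewrite /chi (bigD1 t)//= ffunE eqxx gt0 big1 ?mulr1//= => u ut.
  by rewrite ffunE (negPf ut) eqxx.
have : \sum_i chi i g = - \sum_i chi i g.
  rewrite {1}(reindex_inj (addrI e)) -sumrN; apply: eq_bigr => i _ /=.
  by rewrite chi_sym chiD ![chi g _]chi_sym e1 mulN1r.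
by move=> /eqP; rewrite -addr_eq0 -mulr2n mulrn_eq0 => /eqP.
Qed.

Lemma sum_chi2 i j : \sum_g chi i g * chi j g = if i == j then (2 ^ n)%:R else 0.
Proof.
under eq_bigr do rewrite -[chi i _]chi_sym -[chi j _]chi_sym.
have -> : \sum_g chi g i * chi g j = \sum_g chi g (i + j).
  by apply: eq_bigr => g _; rewrite chiD.
rewrite sum_chi; congr (if _ then _ else _).
apply/eqP/eqP => [ij|->]; last exact: addgg.
by rewrite -[j]add0r -ij -addrA addgg addr0.
Qed.

Section action.
Variables (X : finType) (act : G -> X -> X).
Hypothesis actD : forall g h r, act g (act h r) = act (g + h) r.
Hypothesis act0 : forall r, act 0 r = r.
Notation V := {ffun X -> R^o}.
Implicit Types (z w v : V) (r : X).

Lemma act_inj g : injective (act g).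
Proof. by move=> r r' /(congr1 (act g)); rewrite !actD addgg !act0. Qed.

Lemma act_reindex (W : nmodType) g (F : X -> W) : \sum_r F (act g r) = \sum_r F r.
Proof. by rewrite [RHS](reindex_inj (@act_inj g)). Qed.

Let q : R := (2 ^ n)%:R.
Let q_neq0 : q != 0. Proof. by rewrite pnatr_eq0 expn_eq0. Qed.

(** The projection onto the isotypic component of the character chi i. *)
Definition proj i z : V := [ffun r => q^-1 * \sum_g chi i g * z (act g r)].

Definition equivariant i w : Prop := forall g r, w (act g r) = chi i g * w r.

Lemma proj_equivariant i z : equivariant i (proj i z).
Proof.
move=> g r; rewrite !ffunE mulrCA; congr (_ * _).
rewrite (reindex_inj (addIr g)) mulr_sumr; apply: eq_bigr => h _ /=.
by rewrite actD -addrA addgg addr0 chiD mulrA [chi i g * _]mulrC.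
Qed.

Lemma proj_id i w : equivariant i w -> proj i w = w.
Proof.
move=> ew; apply/ffunP => r; rewrite ffunE.
under eq_bigr do rewrite ew mulrA chi_sqr mul1r.
by rewrite sumr_const card_ffun !card_ord -[w r *+ _]mulr_natl mulKf.
Qed.

Lemma proj_other i j w : equivariant i w -> i != j -> proj j w = 0.
Proof.
move=> ew ij; apply/ffunP => r; rewrite !ffunE.
under eq_bigr do rewrite ew mulrA.
by rewrite -mulr_suml sum_chi2 eq_sym (negPf ij) mul0r mulr0.
Qed.

Lemma proj_lin i (a : R) z w : proj i (a *: z + w) = a *: proj i z + proj i w.
Proof.
apply/ffunP => r; rewrite [RHS]ffunE [X in _ = X + _]ffunE ![proj i _ r]ffunE.
rewrite -[X in _ = X + _]/(a * _) [X in _ = X + _]mulrCA -mulrDr; congr (_ * _).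
rewrite mulr_sumr -big_split/=; apply: eq_bigr => g _.
by rewrite !ffunE -[X in _ * (X + _)]/(a * _) mulrDr mulrCA.
Qed.

Lemma proj_adj i z w : \sum_r proj i z r * w r = \sum_r z r * proj i w r.
Proof.
under eq_bigr do rewrite ffunE -mulrA mulr_suml.
under [RHS]eq_bigr do rewrite ffunE mulrCA mulr_sumr.
rewrite -!mulr_sumr; congr (_ * _); rewrite exchange_big [RHS]exchange_big/=.
apply: eq_bigr => g _; rewrite -[RHS](act_reindex g); apply: eq_bigr => r _.
by rewrite actD addgg act0 mulrCA mulrA.
Qed.

(** Along an orbit a function is a Walsh sum, with its isotypic components at the
    base point as coefficients. *)
Lemma proj_decomp z g r : z (act g r) = \sum_i chi i g * proj i z r.
Proof.
under eq_bigr do rewrite ffunE mulrCA mulr_sumr.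
rewrite -mulr_sumr exchange_big/=.
have -> : \sum_h \sum_i chi i g * (chi i h * z (act h r)) =
    \sum_h (if g == h then q else 0) * z (act h r).
  apply: eq_bigr => h _; under eq_bigr do rewrite mulrA.
  rewrite -mulr_suml; congr (_ * _); under eq_bigr do rewrite chi_sym [chi _ h]chi_sym.
  exact: sum_chi2.
rewrite (bigD1 g)//= eqxx big1 ?addr0 ?mulKf// => h hg.
by rewrite eq_sym (negPf hg) mul0r.
Qed.

Lemma proj_sum z : z = \sum_i proj i z.
Proof.
apply/ffunP => r; rewrite sum_ffunE -[r in LHS]act0 (proj_decomp z).
by apply: eq_bigr => i _; rewrite chi0 mul1r.
Qed.

Section bound.
Variable s : R.
Hypotheses (s_gt0 : 0 < s) (s_le : s <= 14^-1).

(** The partial sum consists of all components below m, and of a part w of the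
    component m.  Both sides are averaged over the group, and on each orbit
    [walsh_powR] applies. *)
Lemma lex_partial_sum_le z m (w : V) : (m < 2 ^ n)%N -> equivariant (dec m) w ->
  \sum_r @bellK R (real_scalars R) s (proj (dec m) z r) (w r) <= 0 ->
  bell_lambda s * \sum_r `|(\sum_(k < m) proj (dec k) z + w) r| `^ (2 + s)
  <= bell_kappa s * \sum_r `|z r| `^ (2 + s).
Proof.
move=> mn ew hb; set y := _ + w.
have q0 : 0 < q by rewrite ltr0n expn_gt0.
rewrite -(ler_pM2l q0) mulrCA [leRHS]mulrCA.
have avg (v : V) : q * \sum_r `|v r| `^ (2 + s) =
    \sum_r \sum_(l < 2 ^ n) `|v (act (dec l) r)| `^ (2 + s).
  rewrite exchange_big/=.
  under [RHS]eq_bigr => l _ do rewrite (act_reindex (dec l) (fun r => `|v r| `^ (2 + s))).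
  by rewrite sumr_const card_ord mulr_natl.
rewrite !avg.
have zE r l : z (act (dec l) r) = \sum_(k < 2 ^ n) walsh R n k l * proj (dec k) z r.
  by rewrite proj_decomp sum_dec; apply: eq_bigr => k _; rewrite chi_dec.
have yE r l : y (act (dec l) r) =
    \sum_(k < m) walsh R n k l * proj (dec k) z r + walsh R n m l * w r.
  rewrite /y ffunE ew chi_dec; congr (_ + _); rewrite sum_ffunE.
  by apply: eq_bigr => k _; rewrite (proj_equivariant (dec k)) chi_dec.
rewrite !mulr_sumr.
apply: (@le_trans _ _ (\sum_r (q * @bellK R (real_scalars R) s (proj (dec m) z r) (w r)
   + bell_kappa s * \sum_(l < 2 ^ n) `|z (act (dec l) r)| `^ (2 + s)))).
  apply: ler_sum => r _.
  have := @walsh_powR R (real_scalars R) (real_scalars_ok R) s s_gt0 s_le n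
    (fun k => proj (dec k) z r) m (w r) mn.
  move=> h; apply: le_trans (le_trans _ h) _; rewrite le_eqVlt; apply/orP; left; apply/eqP.
    by congr (_ * _); apply: eq_bigr => l _; rewrite yE.
  by congr (_ + _ * _); apply: eq_bigr => l _; rewrite zE.
rewrite big_split/= -!mulr_sumr gerDr.
by rewrite mulr_ge0_le0// ltW.
Qed.

End bound.
End action.
End sign_group.

(** * Bases adapted to the isotypic components *)

Section wlp_compare.
Context {R : realType} {K : scalars R}.
Variables (I : finType) (omega s : R).
Hypotheses (omega_gt0 : 0 < omega) (s_gt0 : 0 < s).

Lemma bell_kappa_ge1 : 1 <= bell_kappa s.
Proof. by rewrite /bell_kappa lerDl mulr_ge0// ltW. Qed.

Lemma bell_lambda_gt0 : s <= 14^-1 -> 0 < bell_lambda s.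
Proof.
move=> s_le; have p0 : 0 < 2 + s by rewrite addr_gt0.
rewrite /bell_lambda subr_gt0 ltr_pdivrMr// mul1r.
have k3 : 1 + bell_kappa s <= 3 by rewrite /bell_kappa; lra.
by rewrite (le_lt_trans (ler_wpM2r (ltW s_gt0) k3))//; lra.
Qed.

Lemma bell_lambda_le1 : bell_lambda s <= 1.
Proof.
rewrite /bell_lambda gerBl divr_ge0 ?addr_ge0 ?(ltW s_gt0)//.
have := bell_kappa_ge1 => ?; rewrite mulr_ge0 ?(ltW s_gt0)//; lra.
Qed.

(** The p-th root of the constant is bounded by the constant, which is at least 1. *)
Lemma wlp_le_of_powR (y z : {ffun I -> K^o}) : s <= 14^-1 ->
  bell_lambda s * \sum_i smod (y i) `^ (2 + s)
    <= bell_kappa s * \sum_i smod (z i) `^ (2 + s) ->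
  wlp omega (2 + s) y <= bell_kappa s / bell_lambda s * wlp omega (2 + s) z.
Proof.
move=> s_le h; have l0 := bell_lambda_gt0 s_le; have k1 := bell_kappa_ge1.
have p0 : 0 < 2 + s by rewrite addr_gt0.
set c := bell_kappa s / bell_lambda s.
have c1 : 1 <= c by rewrite ler_pdivlMr// mul1r (le_trans bell_lambda_le1).
have c0 : 0 <= c := le_trans ler01 c1.
have S0 (v : {ffun I -> K^o}) : 0 <= \sum_i smod (v i) `^ (2 + s).
  by apply: sumr_ge0 => i _; exact: powR_ge0.
apply: (@le_trans _ _ (c `^ (2 + s)^-1 * wlp omega (2 + s) z)).
  have S1 (v : {ffun I -> K^o}) : 0 <= omega * \sum_i smod (v i) `^ (2 + s).
    by rewrite mulr_ge0 ?(ltW omega_gt0).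
  rewrite /wlp -powRM//; apply: ge0_ler_powR.
  - by rewrite invr_ge0 ltW.
  - by rewrite nnegrE.
  - by rewrite nnegrE mulr_ge0.
  rewrite mulrCA ler_wpM2l ?(ltW omega_gt0)//.
  by rewrite /c mulrAC ler_pdivlMr// mulrC.
rewrite ler_wpM2r ?powR_ge0// -[leRHS]powRr1//.
by apply: ler_powR => //; rewrite invf_le1//; move: s_gt0; lra.
Qed.

End wlp_compare.

Section blockwise_chain.
Variables (R : realType) (n : nat).
Notation G := {ffun 'I_n -> 'I_2}.
Variables (X : finType) (act : G -> X -> X).
Hypothesis actD : forall g h r, act g (act h r) = act (g + h) r.
Hypothesis act0 : forall r, act 0 r = r.
Notation V := {ffun X -> R^o}.
Notation K := (real_scalars R).
Variables (omega s : R).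
Hypotheses (omega_gt0 : 0 < omega) (s_gt0 : 0 < s).
Variable N : V -> R.
Hypothesis NE : forall z, N z = @wlp R K X omega (2 + s) z.
Notation S := (@full_space R K V N).
Notation pr j := (proj act (dec n j)).

Variables (F : set V) (L : nat) (e : nat -> nat -> V -> V) (lam : nat -> nat -> V -> R).
Hypothesis F_lin : forall (a : R) z w, F z -> F w -> F (a *: z + w).
Hypothesis F_neq0 : exists2 z, F z & z <> 0.
Hypothesis F_pr : forall j z, F z -> F (pr j z).
Hypothesis L_gt0 : (0 < L)%N.
Let Fj j w := F w /\ equivariant act (dec n j) w.
Hypothesis e_lin : forall j k (a : R) z w, e j k (a *: z + w) = a *: e j k z + e j k w.
Hypothesis e_F : forall j k w, (k <= L)%N -> Fj j w -> Fj j (e j k w).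
Hypothesis e_0 : forall j w, Fj j w -> e j 0 w = 0.
Hypothesis e_L : forall j w, Fj j w -> e j L w = w.
Hypothesis e_comp : forall j k l w, (k <= L)%N -> (l <= L)%N -> Fj j w ->
  e j k (e j l w) = e j (minn k l) w.
Hypothesis lam_lin : forall j k (a : R) z w, lam j k (a *: z + w) = a * lam j k z + lam j k w.
Hypothesis lam_ker : forall j k w, (k < L)%N -> Fj j w -> lam j k w = 0 -> e j k.+1 w = e j k w.
Hypothesis e_bell : s <= 14^-1 -> forall j k w, (k <= L)%N -> Fj j w ->
  \sum_r @bellK R K s (w r) (e j k w r) <= 0.

Let tau j t := minn L (t - j * L).
Let tau_le j t : (tau j t <= L)%N. Proof. exact: geq_minl. Qed.
Let T := (2 ^ n * L)%N.
Let E t (z : V) : V := \sum_(j < 2 ^ n) e j (tau j t) (pr j z).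

Let pr_lin j (a : R) (z w : V) : pr j (a *: z + w) = a *: pr j z + pr j w.
Proof. exact: proj_lin. Qed.

Let F0 : F 0.
Proof. by have [z Fz _] := F_neq0; have := F_lin (-1) Fz Fz; rewrite scaleN1r addNr. Qed.

Let F_sum m (v : nat -> V) : (forall j, (j < m)%N -> F (v j)) -> F (\sum_(j < m) v j).
Proof.
elim: m => [|m ih] Fv; first by rewrite big_ord0.
rewrite big_ord_recr/= addrC -[v m]scale1r; apply: F_lin; first exact: Fv.
by apply: ih => j jm; apply: Fv; exact: ltnW.
Qed.

Let FjP j z : F z -> Fj j (pr j z).
Proof. by move=> Fz; split; [exact: F_pr|exact: proj_equivariant]. Qed.

Let E_lin t (a : R) z w : E t (a *: z + w) = a *: E t z + E t w.
Proof.
rewrite /E scaler_sumr -big_split/=; apply: eq_bigr => j _.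
by rewrite pr_lin e_lin.
Qed.

Let pr0 j : pr j (0 : V) = 0.
Proof. by have := pr_lin j (-1) 0 0; rewrite scaleN1r oppr0 addr0 scaleN1r addNr. Qed.

Let pr_sum j m (v : nat -> V) : pr j (\sum_(i < m) v i) = \sum_(i < m) pr j (v i).
Proof.
elim: m => [|m ih]; first by rewrite !big_ord0 pr0.
by rewrite !big_ord_recr/= addrC -[v m]scale1r pr_lin ih !scale1r addrC.
Qed.

Let pr_E j t z : (j < 2 ^ n)%N -> F z -> pr j (E t z) = e j (tau j t) (pr j z).
Proof.
move=> jn Fz; rewrite /E (pr_sum j _ (fun j => e j (tau j t) (pr j z))).
rewrite (bigD1 (Ordinal jn))//= proj_id; last by case: (e_F (tau_le j t) (FjP j Fz)).
rewrite big1 ?addr0// => i ij.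
have [_ ew] := e_F (tau_le i t) (FjP i Fz); apply: (proj_other ew).
apply: contra ij => /eqP/(dec_inj (ltn_ord i) jn) ij.
exact/eqP/val_inj.
Qed.

Let tau_min j t u : tau j (minn t u) = minn (tau j t) (tau j u).
Proof.
rewrite /tau; wlog tu : t u / (t <= u)%N => [h|].
  have /orP[tu|ut] := leq_total t u; first exact: h.
  by rewrite [minn t u]minnC [RHS]minnC; exact: h.
rewrite (minn_idPl tu); apply/esym/minn_idPl.
by rewrite leq_min geq_minl (leq_trans (geq_minr _ _))// leq_sub2r.
Qed.

Let tau_lt t j : (j < t %/ L)%N -> tau j t = L.
Proof.
move=> jt; apply/minn_idPl; rewrite leq_subRL; last first.
  by rewrite (leq_trans _ (leq_divM t L))// leq_mul2r (ltnW jt) orbT.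
by rewrite -mulSnr (leq_trans _ (leq_divM t L))// leq_mul2r jt orbT.
Qed.

Let tau_gt t j : (t %/ L < j)%N -> tau j t = 0%N.
Proof.
move=> tj; rewrite /tau (_ : (t - j * L = 0)%N) ?minn0//; apply/eqP.
by rewrite subn_eq0 ltnW// (leq_trans (ltn_ceil t L_gt0))// leq_mul2r tj orbT.
Qed.

Let tau_eq t : tau (t %/ L) t = (t %% L)%N.
Proof.
rewrite /tau; have -> : (t - t %/ L * L = t %% L)%N.
  by rewrite {1}(divn_eq t L) addKn.
apply/minn_idPr.
by rewrite ltnW// ltn_mod.
Qed.

Let E_T t z : (T <= t)%N -> F z -> E t z = z.
Proof.
move=> Tt Fz; rewrite /E.
transitivity (\sum_(j < 2 ^ n) pr j z).
  apply: eq_bigr => j _; rewrite (_ : tau j t = L); first exact: e_L (FjP j Fz).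
  apply: tau_lt; rewrite (leq_trans (ltn_ord j))// leq_divRL//.
by rewrite -(sum_dec (fun i => proj act i z)) -proj_sum.
Qed.

Let E_lex t z : (t < T)%N -> F z ->
  E t z = \sum_(j < t %/ L) pr j z + e (t %/ L) (t %% L) (pr (t %/ L) z).
Proof.
move=> tT Fz; set m := (t %/ L)%N.
have mn : (m < 2 ^ n)%N by rewrite ltn_divLR.
rewrite /E (bigID (fun j : 'I_(2 ^ n) => (j < m)%N))/=; congr (_ + _).
  rewrite (big_ord_widen _ (fun j => pr j z) (ltnW mn)).
  apply: eq_bigr => j jm; rewrite tau_lt//; exact: e_L (FjP j Fz).
rewrite (bigD1 (Ordinal mn))/=; last by rewrite ltnn.
rewrite tau_eq big1 ?addr0// => j /andP[]; rewrite -leqNgt => mj jm.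
rewrite tau_gt; first exact: e_0 (FjP j Fz).
rewrite ltn_neqAle mj andbT eq_sym; apply: contra jm => /eqP jm.
exact/eqP/val_inj.
Qed.

Let E_F t z : F z -> F (E t z).
Proof.
move=> Fz; apply: (F_sum (v := fun j => e j (tau j t) (pr j z))) => j _.
by case: (e_F (tau_le j t) (FjP j Fz)).
Qed.

Let E_comp t u z : F z -> E t (E u z) = E (minn t u) z.
Proof.
move=> Fz; apply: eq_bigr => j _; rewrite pr_E// tau_min.
by rewrite e_comp//; exact: FjP.
Qed.

Let tau_S t j : j != (t %/ L)%N -> tau j t.+1 = tau j t.
Proof.
rewrite neq_ltn => /orP[jt|tj].
  by rewrite !tau_lt// (leq_trans jt)// leq_div2r.
have := ltn_ceil t L_gt0 => h; rewrite (tau_gt tj) /tau.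
rewrite (_ : (t.+1 - j * L = 0)%N) ?minn0//; apply/eqP.
by rewrite subn_eq0 (leq_trans h)// leq_mul2r tj orbT.
Qed.

Let tau_SS t : tau (t %/ L) t.+1 = (t %% L).+1.
Proof.
rewrite /tau; have -> : (t.+1 - t %/ L * L = (t %% L).+1)%N.
  by rewrite {1}(divn_eq t L) -addnS addKn.
apply/minn_idPr.
by rewrite ltn_mod.
Qed.

Definition block_lam t z : R :=
  if (t < T)%N then lam (t %/ L) (t %% L) (pr (t %/ L) z) else 0.

Let block_lam_ker t z : F z -> block_lam t z = 0 -> E t.+1 z = E t z.
Proof.
move=> Fz; rewrite /block_lam; case: ltnP => [tT l0|Tt _]; last first.
  by rewrite !E_T// (leq_trans Tt).
apply: eq_bigr => j _; have [->|jt] := eqVneq (nat_of_ord j) (t %/ L)%N.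
  rewrite tau_SS tau_eq; apply: lam_ker => //; first by rewrite ltn_mod.
  exact: FjP.
by rewrite tau_S.
Qed.

Let p_gt1 : 1 < 2 + s. Proof. by move: s_gt0; lra. Qed.

Let E_bound t z : s <= 14^-1 -> F z ->
  N (E t z) <= bell_kappa s / bell_lambda s * N z.
Proof.
move=> s_le Fz; rewrite !NE; have l0 := bell_lambda_gt0 s_gt0 s_le.
have [Tt|tT] := leqP T t.
  rewrite E_T// ler_peMl ?wlp_ge0// ler_pdivlMr// mul1r.
  by rewrite (le_trans (bell_lambda_le1 s_gt0)) ?bell_kappa_ge1.
apply: wlp_le_of_powR => //; rewrite E_lex//.
have kL : (t %% L <= L)%N by rewrite ltnW// ltn_mod.
have [_ ew] := e_F kL (FjP (t %/ L) Fz).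
apply: (lex_partial_sum_le actD act0 s_gt0 s_le) => //; first by rewrite ltn_divLR.
by apply: e_bell => //; exact: FjP.
Qed.

Let E_crude : exists C : R, forall t z, F z -> N (E t z) <= C * N z.
Proof.
have bd t : exists C : R, 0 <= C /\ forall z, N (E t z) <= C * N z.
  have [C C0 hC] := @wlp_linear_bounded R K (real_scalars_ok R) X omega (2 + s)
    omega_gt0 p_gt1 N NE (E t) (E_lin t).
  by exists C; split.
have [C hC] := choice bd.
exists (\sum_(t < T) C t + 1) => t z Fz.
have N0 : 0 <= N z by rewrite NE wlp_ge0.
have C0 : 0 <= \sum_(t < T) C t by apply: sumr_ge0 => i _; case: (hC i).
have [Tt|tT] := leqP T t.
  by rewrite E_T// ler_peMl// lerDr.
have [_ h] := hC t; rewrite (le_trans (h z))// ler_wpM2r//.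
rewrite (bigD1 (Ordinal tT))//= -addrA lerDl addr_ge0// sumr_ge0// => i _.
by case: (hC i).
Qed.

(** In the component of the code j a chain e j 0 = 0, ..., e j L = id is given; the
    chains are run through one after another in the order of the codes, and
    [lex_partial_sum_le] bounds each stage E t.  The functionals lam detect the steps
    of the chains. *)
Lemma blockwise_basis : exists kappa d (beta : nat -> S) (gamma : nat -> S -> K^o),
  local_basis (V := S) F kappa d beta gamma /\
  (s <= 14^-1 -> kappa <= bell_kappa s / bell_lambda s).
Proof.
have [|||||||||d [beta [gamma h]]] := @chain_basis R K S F E T block_lam.
- by split; [exact: F0|exact: F_lin].
- by move=> t a z w _ _; exact: E_lin.
- exact: E_F.
- move=> z Fz; rewrite /E big1// => j _.
  by rewrite (_ : tau j 0 = 0%N) ?minn0//; exact: e_0 (FjP j Fz).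
- by move=> z; exact: E_T.
- exact: E_comp.
- move=> t a z w _ _; rewrite /block_lam; case: ifP => _.
    by rewrite pr_lin lam_lin.
  by rewrite scaler0 addr0.
- exact: block_lam_ker.
- exact: F_neq0.
have [C hC] := E_crude.
have [s_le|s_gt] := leP s 14^-1.
  exists (bell_kappa s / bell_lambda s), d, beta, gamma; split=> //.
  by apply: h => t z; exact: E_bound.
exists C, d, beta, gamma; split; first by apply: h => t z; exact: hC.
by [].
Qed.

End blockwise_chain.

(** * Bases of a hyperplane of functions *)

Section hyperplane.
Variables (R : realType) (n : nat).
Notation G := {ffun 'I_n -> 'I_2}.
Variables (X : finType) (act : G -> X -> X).
Hypothesis actD : forall g h r, act g (act h r) = act (g + h) r.
Hypothesis act0 : forall r, act 0 r = r.
Notation V := {ffun X -> R^o}.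
Notation K := (real_scalars R).
Variables (s : R) (s_gt0 : 0 < s).
Variables (i : G) (phi : V).
Hypothesis phi_eq : equivariant act i phi.
Implicit Types (z w : V) (r : X).

(** Homogeneity allows the quotient w / dens to be treated as a function for the
    measure |dens|^p. *)
Lemma bell_homogeneous (t x y : R) :
  @bellK R K s (t * x) (t * y) = `|t| `^ (2 + s) * @bellK R K s x y.
Proof.
rewrite /bellK /bell/= !normrM !exprMn -mulrDr.
set A := `|x| ^+ 2; set B := `|y| ^+ 2.
have AB : 0 <= A + B by rewrite addr_ge0 ?sqr_ge0.
rewrite powRM ?sqr_ge0//.
have [->|t0] := eqVneq `|t| 0.
  rewrite expr0n/= !mul0r mulr0 subrr mul0r powR0 ?mul0r//.
  by rewrite gt_eqF// addr_gt0.
have -> : (`|t| ^+ 2) `^ (s / 2) = `|t| `^ s.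
  by rewrite -powR_mulrn// -powRrM mulrCA mulfV ?mulr1.
rewrite powRD ?t0 ?implybT// powR_mulrn//; ring.
Qed.

(** An equivariant function is determined on an orbit by its value at one point, so
    orbits are what the chain of [tail_avg] adds one at a time; their ranks order
    them. *)
Definition orb (r : X) : {set X} := [set act g r | g : G].
Definition ord_orb (r : X) : nat := enum_rank (orb r).
Definition norbs : nat := #|{: {set X}}|.

Lemma orb_act g r : orb (act g r) = orb r.
Proof.
apply/setP => x; apply/imsetP/imsetP => -[h _ ->].
  by exists (h + g); rewrite ?actD.
by exists (h + g); rewrite ?actD// -addrA addgg addr0.
Qed.

Lemma ord_orb_act g r : ord_orb (act g r) = ord_orb r.
Proof. by rewrite /ord_orb orb_act. Qed.

Lemma ord_orb_lt r : (ord_orb r < norbs)%N.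
Proof. exact: ltn_ord. Qed.

Lemma ord_orb_eq r r' : ord_orb r = ord_orb r' -> exists g, r' = act g r.
Proof.
move=> /val_inj/enum_rank_inj h.
have : r' \in orb r by rewrite h; apply/imsetP; exists 0; rewrite ?act0.
by case/imsetP => g _ ->; exists g.
Qed.

(** The change of density under which the averages below are contractions of
   the L_p space, p = 2 + s: it is u = sgn(phi) |phi|^(1/(p-1)), so that
   phi u = |u|^p. *)
Definition dens : V := [ffun r => Num.sg (phi r) * `|phi r| `^ (1 + s)^-1].

Let s1 : 0 < 1 + s. Proof. by rewrite addr_gt0. Qed.

Lemma dens_eq : equivariant act i dens.
Proof.
move=> g r; rewrite !ffunE phi_eq sgrM normrM.
have c1 : `|chi R i g| = 1.
  have := congr1 (fun x : R => `|x|) (chi_sqr R i g).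
  rewrite normrM normr1 -expr2 => /eqP; rewrite -[X in _ == X](expr1n _ 2).
  by rewrite eqrXn2// => /eqP.
have c2 : Num.sg (chi R i g) = chi R i g.
  by rewrite -[RHS]mulr_sg_norm c1 mulr1.
by rewrite c1 c2 mul1r mulrA.
Qed.

Lemma dens_norm r : `|dens r| = `|phi r| `^ (1 + s)^-1.
Proof.
rewrite ffunE normrM normr_sg (ger0_norm (powR_ge0 _ _)).
have [->|p0] := eqVneq (phi r) 0; last by rewrite mul1r.
by rewrite mul0r normr0 powR0// invr_eq0 gt_eqF.
Qed.

Lemma phi_dens r : phi r * dens r = `|dens r| `^ (2 + s).
Proof.
rewrite dens_norm -powRrM ffunE mulrA [phi r * _]mulrC -normrEsg.
have [->|p0] := eqVneq (phi r) 0.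
  by rewrite normr0 mul0r powR0// mulf_neq0// ?invr_eq0 gt_eqF// addr_gt0.
have p1 : `|phi r| != 0 by rewrite normr_eq0.
rewrite -{1}[`|phi r|]powRr1// -powRD ?p1 ?implybT//; congr (_ `^ _).
by field; rewrite gt_eqF.
Qed.

Lemma phi_eq0 r : dens r = 0 -> phi r = 0.
Proof.
move=> /(congr1 (fun x : R => `|x|)); rewrite normr0 dens_norm => /eqP.
by rewrite powR_eq0 normr_eq0 => /andP[/eqP].
Qed.

Let below k (r : X) := (ord_orb r < k)%N.
Definition tail_sum k (w : V) : R := \sum_(r | ~~ below k r) phi r * w r.
Definition tail_mass k : R := \sum_(r | ~~ below k r) phi r * dens r.

(** The conditional expectation, in the changed density, onto the functions that
   are proportional to the density on the orbits of rank at least k. *)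
Definition tail_avg k (w : V) : V :=
  [ffun r => if below k r then w r else tail_sum k w / tail_mass k * dens r].

Lemma tail_avgE k w r :
  tail_avg k w r = if below k r then w r else tail_sum k w / tail_mass k * dens r.
Proof. by rewrite ffunE. Qed.

Lemma tail_mass_eq0 k : tail_mass k = 0 -> forall r, ~~ below k r -> dens r = 0.
Proof.
move=> h r kr; have : phi r * dens r = 0.
  have := h; rewrite /tail_mass => /eqP; rewrite psumr_eq0.
    by move=> /allP/(_ r (mem_index_enum r)); rewrite kr => /eqP.
  by move=> x _; rewrite phi_dens powR_ge0.
by rewrite phi_dens => /eqP; rewrite powR_eq0 normr_eq0 => /andP[/eqP].
Qed.

Lemma tail_sum_eq0 k w : tail_mass k = 0 -> tail_sum k w = 0.
Proof.
move=> /tail_mass_eq0 h; apply: big1 => r kr.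
by rewrite (phi_eq0 (h r kr)) mul0r.
Qed.

Lemma tail_sum_mass k w : tail_sum k w / tail_mass k * tail_mass k = tail_sum k w.
Proof.
have [m0|m0] := eqVneq (tail_mass k) 0; first by rewrite m0 mulr0 tail_sum_eq0.
by rewrite divfK.
Qed.

Lemma tail_sum_lin k (a : R) z w : tail_sum k (a *: z + w) = a * tail_sum k z + tail_sum k w.
Proof.
rewrite /tail_sum mulr_sumr -big_split/=; apply: eq_bigr => r _.
by rewrite !ffunE -[a *: z r]/(a * z r) mulrDr mulrCA.
Qed.

Lemma tail_avg_lin k (a : R) z w : tail_avg k (a *: z + w) = a *: tail_avg k z + tail_avg k w.
Proof.
apply/ffunP => r; rewrite !ffunE; case: ifP => // _.
by rewrite tail_sum_lin -[_ *: _]/(a * _) !mulrDl !mulrA.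
Qed.

Lemma tail_avg_eq k w : equivariant act i w -> equivariant act i (tail_avg k w).
Proof.
move=> ew g r; rewrite !tail_avgE /below ord_orb_act; case: ifP => // _.
by rewrite dens_eq mulrCA.
Qed.

Lemma sum_tail_avg k w : \sum_r phi r * tail_avg k w r = \sum_r phi r * w r.
Proof.
rewrite (bigID (below k)) [RHS](bigID (below k))/=; congr (_ + _).
  by apply: eq_bigr => r kr; rewrite tail_avgE kr.
rewrite -/(tail_sum k w) -tail_sum_mass /tail_mass mulr_sumr.
by apply: eq_bigr => r kr; rewrite tail_avgE (negPf kr) mulrCA.
Qed.

Lemma tail_avg0 w : \sum_r phi r * w r = 0 -> tail_avg 0 w = 0.
Proof.
move=> h; apply/ffunP => r; rewrite !ffunE /below ltn0.
have -> : tail_sum 0 w = 0 by rewrite -[RHS]h; apply: eq_bigl => x; rewrite /below ltn0.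
by rewrite !mul0r.
Qed.

Lemma tail_avgT w : tail_avg norbs w = w.
Proof. by apply/ffunP => r; rewrite tail_avgE /below ord_orb_lt. Qed.

Lemma tail_avg_comp k l w : tail_avg k (tail_avg l w) = tail_avg (minn k l) w.
Proof.
have [kl|/ltnW lk] := leqP k l.
  have sE : tail_sum k (tail_avg l w) = tail_sum k w.
    rewrite /tail_sum (bigID (below l)) [RHS](bigID (below l))/=; congr (_ + _).
      by apply: eq_bigr => r /andP[_ lr]; rewrite tail_avgE lr.
    have cond r : ~~ below k r && ~~ below l r = ~~ below l r.
      by rewrite /below -!leqNgt andbC; case: (leqP l (ord_orb r)) => //= /(leq_trans kl) ->.
    rewrite (eq_bigl _ _ cond) [RHS](eq_bigl _ _ cond) -/(tail_sum l w) -tail_sum_mass /tail_mass mulr_sumr.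
    by apply: eq_bigr => r lr; rewrite tail_avgE (negPf lr) mulrCA.
  apply/ffunP => r; rewrite !tail_avgE sE; case: ifP => // kr.
  by rewrite /below (leq_trans kr kl).
have sE : tail_sum k (tail_avg l w) = tail_sum l w / tail_mass l * tail_mass k.
  rewrite /tail_sum /tail_mass mulr_sumr; apply: eq_bigr => r.
  rewrite /below -leqNgt tail_avgE => kr.
  by rewrite /below ltnNge (leq_trans lk kr)/= mulrCA.
apply/ffunP => r; rewrite !tail_avgE sE; case: ifP => // kr.
have lr : below l r = false.
  by apply: contraFF kr => lr; rewrite /below (leq_trans lr).
rewrite lr; have [m0|m0] := eqVneq (tail_mass k) 0; last by rewrite mulfK.
by rewrite (tail_mass_eq0 m0) ?kr// !mulr0.
Qed.

(** Passing from k to k+1 frees one value only, that at a representative r0 of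
   the orbit of rank k. *)
Definition tail_lam k (w : V) : R :=
  if [pick r | ord_orb r == k] is Some r0
  then w r0 - tail_sum k w / tail_mass k * dens r0 else 0.

Lemma tail_lam_lin k (a : R) z w : tail_lam k (a *: z + w) = a * tail_lam k z + tail_lam k w.
Proof.
rewrite /tail_lam; case: pickP => [r0 _|_]; last by rewrite mulr0 addr0.
by rewrite tail_sum_lin !ffunE -[a *: z r0]/(a * z r0); ring.
Qed.

Lemma tail_lam_ker k w : equivariant act i w -> tail_lam k w = 0 ->
  tail_avg k.+1 w = tail_avg k w.
Proof.
move=> ew; rewrite /tail_lam; set c := tail_sum k w / tail_mass k.
have lamE : (forall r, ord_orb r = k -> w r = c * dens r) -> tail_avg k.+1 w = tail_avg k w.
  move=> h; have split (f : X -> R) : \sum_(r | ~~ below k r) f r =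
      \sum_(r | ord_orb r == k) f r + \sum_(r | ~~ below k.+1 r) f r.
    rewrite (bigID (fun r => ord_orb r == k))/=; congr (_ + _).
      by apply: eq_bigl => r; rewrite /below -leqNgt; case: eqP => [->|]; rewrite ?leqnn ?andbF.
    by apply: eq_bigl => r; rewrite /below -!leqNgt andbC eq_sym -ltn_neqAle.
  have sE : tail_sum k.+1 w = c * tail_mass k.+1.
    apply: (@addrI _ (\sum_(r | ord_orb r == k) phi r * w r)).
    rewrite -(split (fun r => phi r * w r)) -/(tail_sum k w) -tail_sum_mass -/c.
    rewrite /tail_mass (split (fun r => phi r * dens r)) mulrDr; congr (_ + _).
    by rewrite mulr_sumr; apply: eq_bigr => r /eqP kr; rewrite h// mulrCA.
  apply/ffunP => r; rewrite !tail_avgE -/c sE /below ltnS.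
  have [rk|rk|rk] := ltngtP (ord_orb r) k.
  - by [].
  - have [m0|m0] := eqVneq (tail_mass k.+1) 0; last by rewrite mulfK.
    by rewrite (tail_mass_eq0 m0) ?mulr0// /below -leqNgt.
  - exact: h.
case: pickP => [r0 /eqP k0|none _]; last first.
  by apply: lamE => r kr; have := none r; rewrite kr eqxx.
move=> /eqP; rewrite subr_eq0 => /eqP h; apply: lamE => r kr.
have [g ->] : exists g, r = act g r0 by apply: ord_orb_eq; rewrite k0 kr.
by rewrite ew dens_eq h mulrCA.
Qed.

(** Jensen's inequality in tangent form.  On the part where w is averaged put
    g = w / dens and let c be the mean of g for the measure |dens|^p.  The tangent
    at (c, c) in the direction (g - c, 0) gives U(g, c) <= U(c, c) + (g - c) d, where
    U(c, c) <= 0 and g - c has mean zero. *)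
Lemma tail_avg_bell k w : s <= 14^-1 ->
  \sum_r @bellK R K s (w r) (tail_avg k w r) <= 0.
Proof.
move=> s_le; have ok := real_scalars_ok R.
have le0 (x y : R) : `|y| <= `|x| -> @bellK R K s x y <= 0.
  by move=> h; exact: (bellK_le0 ok s_gt0 (K := K)).
rewrite (bigID (below k))/= -[X in _ <= X]addr0 lerD//.
  by apply: sumr_le0 => r kr; rewrite tail_avgE kr le0.
have [m0|m0] := eqVneq (tail_mass k) 0.
  apply: sumr_le0 => r kr; rewrite tail_avgE (negPf kr) (tail_mass_eq0 m0 kr) mulr0.
  by apply: le0; rewrite normr0.
set c := tail_sum k w / tail_mass k.
have [D [DD DN DZ Dt]] := bellK_tangent ok s_gt0 s_le (c : K) (c : K).
pose d : R := D 1 0.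
have D1 (x : R) : D x 0 = x * d.
  by have := DZ x 1 0; rewrite /= mulr1 mulr0.
have tang (g : R) : @bellK R K s g c <= (g - c) * d.
  have := Dt (g - c) 0; rewrite /= normr0 normr_ge0 addr0 [c + _]addrC subrK D1 => /(_ isT) h.
  rewrite (le_trans h)// gerDr; exact: le0.
apply: (@le_trans _ _ (\sum_(r | ~~ below k r) (phi r * w r - c * (phi r * dens r)) * d)).
  apply: ler_sum => r kr; rewrite tail_avgE (negPf kr) -/c.
  have [u0|u0] := eqVneq (dens r) 0.
    by rewrite (phi_eq0 u0) !mul0r mulr0 subrr mul0r u0 mulr0 le0// normr0.
  have -> : w r = dens r * (w r / dens r) by rewrite mulrCA mulfV// mulr1.
  rewrite [c * dens r]mulrC bell_homogeneous.
  rewrite (le_trans (ler_wpM2l (powR_ge0 _ _) (tang _)))//.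
  by rewrite -phi_dens le_eqVlt; apply/orP; left; apply/eqP; field.
rewrite -mulr_suml big_split/= sumrN -mulr_sumr -/(tail_sum k w) -/(tail_mass k).
by rewrite /c divfK// subrr mul0r.
Qed.

End hyperplane.

(** * The range and the kernel of the sampling projection *)

Section projection_bases.
Variables (R : realType) (n : nat).
Notation G := {ffun 'I_n -> 'I_2}.
Variables (X : finType) (act : G -> X -> X).
Hypothesis actD : forall g h r, act g (act h r) = act (g + h) r.
Hypothesis act0 : forall r, act 0 r = r.
Notation V := {ffun X -> R^o}.
Notation K := (real_scalars R).
Variables (omega s : R).
Hypotheses (omega_gt0 : 0 < omega) (s_gt0 : 0 < s).
Variable N : V -> R.
Hypothesis NE : forall z, N z = @wlp R K X omega (2 + s) z.
Notation S := (@full_space R K V N).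
Variables (phi : G -> V) (m : R).
Hypothesis phi_eq : forall i, equivariant act i (phi i).
Hypothesis m_gt0 : 0 < m.
Hypothesis phi_norm : forall i, \sum_r phi i r * phi i r = m.
Implicit Types (z w : V) (r : X).

Definition phi_coef i z : R := \sum_r phi i r * z r.

(** The functions phi i are orthogonal, as they belong to different characters, so
    this is the orthogonal projection onto their span. *)
Definition Rproj z : V := [ffun r => m^-1 * \sum_i phi_coef i z * phi i r].

Lemma phi_coef_lin i (a : R) z w : phi_coef i (a *: z + w) = a * phi_coef i z + phi_coef i w.
Proof.
rewrite /phi_coef mulr_sumr -big_split/=; apply: eq_bigr => r _.
by rewrite !ffunE -[a *: z r]/(a * z r) mulrDr mulrCA.
Qed.

Lemma phi_coef0 i : phi_coef i 0 = 0.
Proof. by apply: big1 => r _; rewrite ffunE mulr0. Qed.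

Lemma phi_coefZ i (a : R) z : phi_coef i (a *: z) = a * phi_coef i z.
Proof. by rewrite -[a *: z]addr0 phi_coef_lin phi_coef0 addr0. Qed.

Lemma phi_coef_equivariant i j w : equivariant act j w -> i != j -> phi_coef i w = 0.
Proof.
move=> ew ij; rewrite /phi_coef -[w](proj_id ew) -(proj_adj actD act0).
rewrite (proj_other (phi_eq i) ij); apply: big1 => r _.
by rewrite ffunE mul0r.
Qed.

Lemma phi_coef_proj i j z : phi_coef i (proj act j z) = if i == j then phi_coef i z else 0.
Proof.
case: eqP => [->|/eqP ij]; last first.
  apply: phi_coef_equivariant ij; exact: proj_equivariant.
by rewrite /phi_coef -(proj_adj actD act0) (proj_id (phi_eq j)).
Qed.

Lemma Rproj_lin (a : R) z w : Rproj (a *: z + w) = a *: Rproj z + Rproj w.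
Proof.
apply/ffunP => r; rewrite [RHS]ffunE [X in _ = X + _]ffunE ![Rproj _ r]ffunE.
rewrite -[X in _ = X + _]/(a * _) [X in _ = X + _]mulrCA -mulrDr; congr (_ * _).
rewrite mulr_sumr -big_split/=; apply: eq_bigr => i _.
by rewrite phi_coef_lin mulrDl mulrA.
Qed.

Lemma Rproj_equivariant j w : equivariant act j w ->
  Rproj w = (m^-1 * phi_coef j w) *: phi j.
Proof.
move=> ew; apply/ffunP => r; rewrite !ffunE -[_ *: _]/(_ * _) -mulrA; congr (_ * _).
rewrite (bigD1 j)//= big1 ?addr0// => i ij.
by rewrite (phi_coef_equivariant ew ij) mul0r.
Qed.

Lemma Rproj_proj j z : Rproj (proj act j z) = proj act j (Rproj z).
Proof.
rewrite (Rproj_equivariant (proj_equivariant actD j z)) phi_coef_proj eqxx.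
have -> : Rproj z = \sum_i (m^-1 * phi_coef i z) *: phi i.
  apply/ffunP => r; rewrite ffunE sum_ffunE mulr_sumr; apply: eq_bigr => i _.
  by rewrite ffunE -[_ *: _]/(_ * _) mulrA.
have p0 : proj act j (0 : V) = 0.
  by have := proj_lin act j (-1) (0 : V) 0; rewrite scaleN1r oppr0 addr0 scaleN1r addNr.
have projZ (a : R) v : proj act j (a *: v) = a *: proj act j v.
  by rewrite -[X in proj act j X]addr0 proj_lin p0 addr0.
have proj_sum (I : Type) (q : seq I) (v : I -> V) :
    proj act j (\sum_(k <- q) v k) = \sum_(k <- q) proj act j (v k).
  elim: q => [|k q ih]; first by rewrite !big_nil p0.
  by rewrite !big_cons -[v k]scale1r proj_lin ih !scale1r.
rewrite proj_sum (bigD1 j)//= projZ (proj_id (phi_eq j)) big1 ?addr0// => i ij.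
by rewrite projZ (proj_other (phi_eq i) ij) scaler0.
Qed.

Lemma Rproj_eq0 z : Rproj z = 0 <-> forall i, phi_coef i z = 0.
Proof.
split=> [h i|h]; last first.
  apply/ffunP => r; rewrite !ffunE big1 ?mulr0// => i _; by rewrite h mul0r.
have : phi_coef i (Rproj (proj act i z)) = 0.
  rewrite Rproj_proj h /phi_coef; apply: big1 => r _.
  by rewrite ffunE big1 ?mulr0// => g _; rewrite ffunE mulr0.
rewrite (Rproj_equivariant (proj_equivariant actD i z)) phi_coef_proj eqxx.
by rewrite phi_coefZ [phi_coef i (phi i)]phi_norm mulrAC mulVf ?mul1r ?gt_eqF.
Qed.

Lemma Rproj_idem z : Rproj (Rproj z) = Rproj z.
Proof.
have R0 : Rproj 0 = 0.
  by apply/Rproj_eq0 => i; apply: big1 => r _; rewrite ffunE mulr0.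
suff : Rproj (z - Rproj z) = 0.
  by rewrite addrC -scaleN1r Rproj_lin scaleN1r addrC => /eqP; rewrite subr_eq0 => /eqP <-.
apply/Rproj_eq0 => i; rewrite addrC -scaleN1r phi_coef_lin.
have -> : phi_coef i (Rproj z) = phi_coef i (proj act i (Rproj z)).
  by rewrite phi_coef_proj eqxx.
rewrite -Rproj_proj (Rproj_equivariant (proj_equivariant actD i z)) phi_coef_proj eqxx.
rewrite phi_coefZ [phi_coef i (phi i)]phi_norm mulrAC mulVf ?gt_eqF// mul1r.
by rewrite mulN1r addNr.
Qed.

Let ok := real_scalars_ok R.

(** Every component of the range has dimension at most one: the chains have length
    L = 1. *)
Lemma range_basis : exists kappa d (beta : nat -> S) (gamma : nat -> S -> K^o),
  local_basis (V := S) [set z : V | Rproj z = z] kappa d beta gamma /\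
  (s <= 14^-1 -> kappa <= bell_kappa s / bell_lambda s).
Proof.
pose e (j k : nat) (w : V) : V := if k == 0%N then 0 else w.
apply: (@blockwise_basis R n X act actD act0 omega s omega_gt0 s_gt0 N NE _ 1 e
  (fun j _ => phi_coef (dec n j))) => //=.
- by move=> a z w hz hw; rewrite Rproj_lin hz hw.
- exists (phi 0).
    rewrite (Rproj_equivariant (phi_eq 0)) /phi_coef phi_norm mulVf ?gt_eqF//.
    by rewrite scale1r.
  move=> p0; have := phi_norm 0; rewrite p0 big1 => [h|r _]; last by rewrite ffunE mulr0.
  by move: m_gt0; rewrite -h ltxx.
- by move=> j z hz; rewrite Rproj_proj hz.
- by move=> j k a z w; rewrite /e; case: ifP => // _; rewrite scaler0 addr0.
- move=> j k w _ [hw ew]; rewrite /e; case: ifP => // _; split.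
    by apply/Rproj_eq0 => i; apply: big1 => r _; rewrite ffunE mulr0.
  by move=> g r; rewrite !ffunE mulr0.
- move=> j [|k] l w _ _ _; rewrite /e ?min0n//=.
  by case: l => [|l]; rewrite ?minn0// minnSS.
- by move=> j k a z w; rewrite phi_coef_lin.
- move=> j [|//] w _ [hw ew] h; rewrite /e /= -hw (Rproj_equivariant ew) h.
  by rewrite mulr0 scale0r.
- move=> _ j k w _ _; apply: sumr_le0 => r _; apply: (bellK_le0 ok s_gt0) => /=.
  by rewrite /e; case: ifP => // _; rewrite ffunE normr0.
Qed.

(** The component of the kernel is the hyperplane of functions orthogonal to phi, and
    [tail_avg] preserves it: weighted by phi, the averages have the same sum as the
    function. *)
Lemma kernel_basis : (exists2 z : V, Rproj z = 0 & z <> 0) ->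
  exists kappa d (beta : nat -> S) (gamma : nat -> S -> K^o),
  local_basis (V := S) [set z : V | Rproj z = 0] kappa d beta gamma /\
  (s <= 14^-1 -> kappa <= bell_kappa s / bell_lambda s).
Proof.
move=> F_neq0.
pose e (j k : nat) (w : V) : V := tail_avg act s (phi (dec n j)) k w.
have inF j k w : Rproj w = 0 -> equivariant act (dec n j) w -> Rproj (e j k w) = 0.
  move=> /Rproj_eq0 hw ew; apply/Rproj_eq0 => i.
  have [->|ij] := eqVneq i (dec n j).
    rewrite [LHS](sum_tail_avg act s_gt0 (phi (dec n j))); exact: hw.
  by apply: phi_coef_equivariant ij; apply: tail_avg_eq.
apply: (@blockwise_basis R n X act actD act0 omega s omega_gt0 s_gt0 N NE _ (norbs X) e
  (fun j k => tail_lam act s (phi (dec n j)) k)) => //=.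
- by move=> a z w hz hw; rewrite Rproj_lin hz hw scaler0 addr0.
- move=> j z hz; rewrite Rproj_proj hz; apply/ffunP => r.
  by rewrite !ffunE big1 ?mulr0// => g _; rewrite ffunE mulr0.
- have [z _ _] := F_neq0; rewrite /norbs; apply/card_gt0P; by exists finset.set0.
- by move=> j k a z w; exact: tail_avg_lin.
- by move=> j k w _ [hw ew]; split; [exact: inF|apply: tail_avg_eq].
- by move=> j w [/Rproj_eq0 hw ew]; apply: tail_avg0; exact: hw.
- by move=> j w _; exact: tail_avgT.
- by move=> j k l w _ _ _; exact: tail_avg_comp.
- by move=> j k a z w; exact: tail_lam_lin.
- by move=> j k w _ [_ ew] l0; apply: (tail_lam_ker act0 s_gt0 (phi_eq (dec n j)) ew l0).
- by move=> s_le j k w _ _; exact: tail_avg_bell.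
Qed.

End projection_bases.

(** * The sampling grid *)

Section sampling_grid.
Variable R : realType.

Definition ang (M k : nat) : R := 2 * pi * k%:R / M%:R.

Lemma periodic_ang (f : R -> R) (M k : nat) : (0 < M)%N -> periodic f (pi *+ 2) ->
  f (ang M (k %% M)) = f (ang M k).
Proof.
move=> M0 fp; rewrite {2}(divn_eq k M) -(periodicn fp (k %/ M)); congr f.
by rewrite /ang natrD natrM -mulr_natr -[pi *+ 2]mulr_natr; field; rewrite pnatr_eq0 -lt0n.
Qed.

Lemma sum_ang_shift (f : R -> R) (M q : nat) : periodic f (pi *+ 2) ->
  \sum_(k < M) f (ang M k) = \sum_(k < M) f (ang M (k + q)).
Proof.
case: M => [|M] fp; first by rewrite !big_ord0.
pose h (k : 'I_M.+1) : 'I_M.+1 := Ordinal (ltn_pmod (k + q) (ltn0Sn M)).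
have hi : injective h.
  move=> k l /(congr1 val)/= /eqP; rewrite eqn_modDr !modn_small// => /eqP kl.
  exact: val_inj.
rewrite (reindex_inj hi)/=; apply: eq_bigr => k _.
exact: periodic_ang.
Qed.

Definition wave (x : R) (a : 'I_2) : R :=
  Num.sqrt 2 * (if a == ord0 then cos x else sin x).

Let wave_periodic a : periodic (wave^~ a) (pi *+ 2).
Proof. by move=> x; rewrite /wave cosD2pi sinD2pi. Qed.

Lemma ang_half (M q : nat) x k : (0 < M)%N -> M = (2 * q)%N ->
  wave (ang M (k + q)) x = - wave (ang M k) x.
Proof.
move=> M0 Mq; have q0 : q%:R != 0 :> R.
  by rewrite pnatr_eq0 -lt0n; move: M0; rewrite Mq muln_gt0.
have -> : ang M (k + q) = ang M k + pi.
  rewrite /ang natrD mulrDr mulrDl; congr (_ + _).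
  by rewrite Mq natrM; field.
by rewrite /wave cosDpi sinDpi; case: ifP => _; rewrite mulrN.
Qed.

Lemma sum_wave (M q : nat) a : (0 < M)%N -> M = (2 * q)%N ->
  \sum_(k < M) wave (ang M k) a = 0.
Proof.
move=> M0 Mq; have := sum_ang_shift M q (wave_periodic a).
under [RHS]eq_bigr do rewrite (ang_half a _ M0 Mq).
by rewrite sumrN => /eqP; rewrite -addr_eq0 -mulr2n mulrn_eq0 => /eqP.
Qed.

(** A quarter turn exchanges the squares of cosine and sine, whose sum is 1; the
    number of nodes is a multiple of 4. *)
Lemma sum_wave_sqr (M q : nat) a : (0 < M)%N -> M = (4 * q)%N ->
  \sum_(k < M) wave (ang M k) a * wave (ang M k) a = M%:R.
Proof.
move=> M0 Mq; have q0 : q%:R != 0 :> R.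
  by rewrite pnatr_eq0 -lt0n; move: M0; rewrite Mq muln_gt0.
pose C := \sum_(k < M) cos (ang M k) ^+ 2.
pose D := \sum_(k < M) sin (ang M k) ^+ 2.
have cp : periodic (fun x : R => cos x ^+ 2) (pi *+ 2) by move=> x; rewrite cosD2pi.
have CD : C = D.
  rewrite /C (sum_ang_shift M q cp); apply: eq_bigr => k _.
  have -> : ang M (k + q) = ang M k + pi / 2.
    rewrite /ang natrD mulrDr mulrDl; congr (_ + _).
    by rewrite Mq natrM; field.
  by rewrite cosDpihalf sqrrN.
have S : C + D = M%:R.
  rewrite -big_split/= (eq_bigr (fun=> 1)); last by move=> k _; rewrite cos2Dsin2.
  by rewrite sumr_const card_ord.
have s2 : Num.sqrt 2 * Num.sqrt 2 = 2 :> R by rewrite -expr2 sqr_sqrtr.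
have -> : \sum_(k < M) wave (ang M k) a * wave (ang M k) a = 2 * (if a == ord0 then C else D).
  have [a0|a1] := ifP; rewrite mulr_sumr; apply: eq_bigr => k _;
  by rewrite /wave ?a0 ?a1 mulrACA s2 expr2.
by case: ifP => _; rewrite -S CD; ring.
Qed.

(** The node -theta has the number M - k, reduced modulo M because of k = 0. *)
Lemma wave_reflect (M k : nat) a : (k < M)%N ->
  wave (ang M ((M - k) %% M)) a = (-1) ^+ (a != 0) * wave (ang M k) a.
Proof.
move=> kM; have M0 : (0 < M)%N by exact: leq_ltn_trans kM.
rewrite (periodic_ang (f := wave^~ a) _ M0 (wave_periodic a)).
have -> : ang M (M - k) = - ang M k + pi *+ 2.
  rewrite /ang natrB ?(ltnW kM)// -[pi *+ 2]mulr_natr.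
  by field; rewrite pnatr_eq0 -lt0n.
rewrite (wave_periodic a) /wave cosN sinN -[ord0]/(0 : 'I_2).
by case: eqP => _ /=; rewrite ?expr0 ?expr1 ?mul1r// mulN1r mulrN.
Qed.

Section grid.
Variable n : nat.
Hypothesis n_gt0 : (0 < n)%N.
Notation K := (real_scalars R).
Notation G := {ffun 'I_n -> 'I_2}.
Notation M := (mesh n).
Notation X := (grid n).
Notation V := {ffun X -> R^o}.

Let M_gt0 : (0 < M)%N. Proof. by rewrite /mesh muln_gt0 expn_gt0 n_gt0. Qed.

Definition refl (k : 'I_M) : 'I_M := Ordinal (ltn_pmod (M - k) M_gt0).

Lemma reflK k : refl (refl k) = k.
Proof.
apply: val_inj => /=; have [k0|k0] := posnP k.
  by rewrite k0 subn0 modnn subn0 modnn.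
by rewrite (@modn_small (M - k)) ?ltn_subrL ?k0// subKn ?modn_small// ltnW.
Qed.

Definition grid_act (g : G) (r : X) : X :=
  [ffun t => if g t == 0 then r t else refl (r t)].

Lemma grid_actD g h r : grid_act g (grid_act h r) = grid_act (g + h) r.
Proof.
apply/ffunP => t; rewrite !ffunE.
have [g0|g0] := eqVneq (g t) 0; have [h0|h0] := eqVneq (h t) 0.
- by rewrite g0 h0 addr0 eqxx.
- by rewrite g0 add0r (negPf h0).
- by rewrite h0 addr0 (negPf g0).
- have := I2_add (g t) (h t); rewrite g0 h0 /= => /negbT/negPn/eqP ->.
  by rewrite eqxx reflK.
Qed.

Lemma grid_act0 r : grid_act 0 r = r.
Proof. by apply/ffunP => t; rewrite !ffunE eqxx. Qed.

Definition grid_phi (i : G) : V := [ffun r : X => \prod_(t < n) wave (ang M (r t)) (i t)].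

Lemma grid_phi_equivariant i : equivariant grid_act i (grid_phi i).
Proof.
move=> g r; rewrite !ffunE /chi -big_split/=; apply: eq_bigr => t _; rewrite ffunE.
have [_|gt] := eqVneq (g t) 0; first by rewrite andbF expr0 mul1r.
by rewrite andbT/= wave_reflect.
Qed.

Lemma sum_grid (f : 'I_n -> 'I_M -> R) :
  \sum_(r : X) \prod_(t < n) f t (r t) = \prod_(t < n) \sum_(k < M) f t k.
Proof. by rewrite -bigA_distr_bigA. Qed.

Lemma grid_phi_norm i : \sum_r grid_phi i r * grid_phi i r = M%:R ^+ n.
Proof.
under eq_bigr do rewrite ffunE -big_split/=.
rewrite (sum_grid (fun t k => wave (ang M k) (i t) * wave (ang M k) (i t))).
rewrite (eq_bigr (fun=> M%:R)); first by rewrite prodr_const card_ord.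
move=> t _; apply: (@sum_wave_sqr M (250 * n ^ 2)%N) => //.
by rewrite /mesh mulnA.
Qed.

(** A witness that the kernel of R is not zero: every block must contribute at least
    one basis vector. *)
Lemma grid_coef_const i : phi_coef grid_phi i ([ffun=> 1] : V) = 0.
Proof.
rewrite /phi_coef; under eq_bigr do rewrite !ffunE mulr1.
rewrite (sum_grid (fun t k => wave (ang M k) (i t))).
rewrite (bigD1 (Ordinal n_gt0))//= (@sum_wave M (500 * n ^ 2)%N) ?mul0r//.
by rewrite /mesh mulnA.
Qed.

Lemma Wvec_grid (r : X) i : @Wvec R K (real_model R) n (grid_point R r) i = grid_phi i r.
Proof.
rewrite !ffunE; apply: eq_bigr => t _; rewrite tnth_mktuple.
by rewrite /= /wave /ang.
Qed.

Lemma sampAE (x : tensor K n) : sampA x = \sum_i x i *: grid_phi i :> V.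
Proof.
apply/ffunP => r; rewrite ffunE sum_ffunE /ffn /tip; apply: eq_bigr => i _.
by rewrite Wvec_grid [RHS]ffunE.
Qed.

Lemma sampBE (z : gridfun R n) i : sampB z i = (M%:R ^+ n)^-1 * phi_coef grid_phi i z.
Proof.
rewrite ffunE -[LHS]/(_ * _); congr (_ * _).
rewrite sum_ffunE; apply: eq_bigr => r _; rewrite ffunE.
by rewrite Wvec_grid -[LHS]/(_ * _) mulrC.
Qed.

Lemma sampRE (z : gridfun R n) : sampR z = Rproj grid_phi (M%:R ^+ n) z.
Proof.
apply/ffunP => r; rewrite /sampR sampAE ffunE sum_ffunE mulr_sumr; apply: eq_bigr => i _.
by rewrite sampBE mulrA [LHS]ffunE.
Qed.

Lemma sampBA (x : tensor K n) : sampB (sampA x) = x.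
Proof.
have M0 : M%:R ^+ n != 0 :> R by rewrite expf_eq0 n_gt0 pnatr_eq0 -lt0n.
apply/ffunP => i; rewrite sampBE sampAE.
have -> : phi_coef grid_phi i (\sum_j x j *: grid_phi j) =
    \sum_j x j * phi_coef grid_phi i (grid_phi j).
  elim: (index_enum _) => [|j r ih]; first by rewrite !big_nil phi_coef0.
  by rewrite !big_cons phi_coef_lin ih.
rewrite (bigD1 i)//= {1}/phi_coef grid_phi_norm big1 ?addr0 => [|j ij].
  by rewrite mulrCA mulVf ?mulr1.
by rewrite (phi_coef_equivariant grid_actD grid_act0 grid_phi_equivariant (grid_phi_equivariant j)) ?mulr0// eq_sym.
Qed.

Variable omega : R.
Hypothesis omega_gt0 : 0 < omega.
Notation s := (n%:R `^ (- (3 / 4)) : R).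
Variable N : V -> R.
Hypothesis NE : forall z, N z = @wlp R K X omega (pexp R n) z.
Notation S := (@full_space R K V N).

Let s_gt0 : 0 < s. Proof. by rewrite powR_gt0// ltr0n. Qed.
Let m_gt0 : 0 < M%:R ^+ n :> R. Proof. by rewrite exprn_gt0// ltr0n. Qed.

Lemma sampR_idem (z : gridfun R n) : sampR (sampR z) = sampR z.
Proof.
rewrite !sampRE; exact: (Rproj_idem grid_actD grid_act0 grid_phi_equivariant m_gt0 grid_phi_norm).
Qed.

Lemma sampR_range_basis : exists kappa d (beta : nat -> S) (gamma : nat -> S -> K^o),
  local_basis (V := S) [set z : V | sampR z = z] kappa d beta gamma /\
  (s <= 14^-1 -> kappa <= bell_kappa s / bell_lambda s).
Proof.
under eq_set do rewrite sampRE.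
exact: (range_basis grid_actD grid_act0 omega_gt0 s_gt0 NE grid_phi_equivariant m_gt0 grid_phi_norm).
Qed.

Lemma sampR_kernel_basis : exists kappa d (beta : nat -> S) (gamma : nat -> S -> K^o),
  local_basis (V := S) [set z : V | sampR z = 0] kappa d beta gamma /\
  (s <= 14^-1 -> kappa <= bell_kappa s / bell_lambda s).
Proof.
under eq_set do rewrite sampRE.
apply: (kernel_basis grid_actD grid_act0 omega_gt0 s_gt0 NE grid_phi_equivariant m_gt0 grid_phi_norm).
exists ([ffun=> 1] : V).
  apply/(Rproj_eq0 grid_actD grid_act0 grid_phi_equivariant m_gt0 grid_phi_norm) => i.
  exact: grid_coef_const.
move=> /ffunP/(_ [ffun=> Ordinal M_gt0]); rewrite !ffunE => /eqP.
by rewrite oner_eq0.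
Qed.

End grid.
End sampling_grid.

(** * The spaces E(n,p) *)

Section scalar_measurability.
Context {R : realType} {K : scalars R}.
Hypothesis ok : scalars_ok K.
Context {d : measure_display} {T : measurableType d}.

Definition smeas (f : T -> K) : Prop :=
  measurable_fun [set: T] (fun t => sre (f t)) /\
  measurable_fun [set: T] (fun t => sim (f t)).

Lemma smeas_cst (c : K) : smeas (fun=> c).
Proof. by split; exact: measurable_cst. Qed.

Lemma smeasD f g : smeas f -> smeas g -> smeas (fun t => f t + g t).
Proof.
move=> [f1 f2] [g1 g2]; split.
  by under eq_fun do rewrite (sreD ok); exact: measurable_funD.
by under eq_fun do rewrite (simD ok); exact: measurable_funD.
Qed.

Lemma smeasM f g : smeas f -> smeas g -> smeas (fun t => f t * g t).
Proof.
move=> [f1 f2] [g1 g2]; split.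
  under eq_fun do rewrite (sreM ok).
  by apply: measurable_funB; exact: measurable_funM.
under eq_fun do rewrite (simM ok).
by apply: measurable_funD; exact: measurable_funM.
Qed.

Lemma smeasJ f : smeas f -> smeas (fun t => sconj (f t)).
Proof.
move=> [f1 f2]; split; first by under eq_fun do rewrite (sreJ ok).
by under eq_fun do rewrite (simJ ok); exact: measurableT_comp.
Qed.

Lemma smeas_sum (I : Type) (r : seq I) (f : I -> T -> K) :
  (forall i, smeas (f i)) -> smeas (fun t => \sum_(i <- r) f i t).
Proof.
move=> mf; elim: r => [|i r ih].
  by under eq_fun do rewrite big_nil; exact: smeas_cst.
by under eq_fun do rewrite big_cons; exact: smeasD.
Qed.

Lemma smeas_prod (I : Type) (r : seq I) (f : I -> T -> K) :
  (forall i, smeas (f i)) -> smeas (fun t => \prod_(i <- r) f i t).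
Proof.
move=> mf; elim: r => [|i r ih].
  by under eq_fun do rewrite big_nil; exact: smeas_cst.
by under eq_fun do rewrite big_cons; exact: smeasM.
Qed.

Lemma smeas_smod f : smeas f -> measurable_fun [set: T] (fun t => smod (f t)).
Proof.
move=> [f1 f2].
under eq_fun do rewrite (smodE ok) -powR12_sqrt ?addr_ge0 ?sqr_ge0//.
apply: (measurableT_comp (measurable_powR _)).
by apply: measurable_funD; [exact: (measurable_funX 2 f1)|exact: (measurable_funX 2 f2)].
Qed.

End scalar_measurability.

Lemma smeas_comp (R : realType) (K : scalars R) d d' (T : measurableType d)
    (T' : measurableType d') (f : T' -> K) (g : T -> T') :
  smeas f -> measurable_fun [set: T] g -> smeas (f \o g).
Proof.
by move=> [f1 f2] mg; split; [exact: (measurableT_comp f1 mg)|exact: (measurableT_comp f2 mg)].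
Qed.

Section tensor_spaces.
Context {R : realType} {K : scalars R}.
Hypothesis ok : scalars_ok K.
Variable M : model K.
Hypothesis wmeas : forall i, smeas (fun t : omega M => wvec t i).
Variable n : nat.
Implicit Types (x : tensor K n) (p : R).

Lemma smeas_Wvec i : smeas (fun t : n.-tuple (omega M) => Wvec t i).
Proof.
under eq_fun do rewrite ffunE.
apply: smeas_prod => // s; apply: (smeas_comp (wmeas (i s))).
exact: measurable_tnth.
Qed.

Lemma smeas_ffn x : smeas (@ffn R K M n x).
Proof.
apply: (smeas_sum ok) => i; apply: (smeasM ok (f := fun=> x i)).
  exact: (smeas_cst (x i : K)).
by apply: (smeasJ ok); exact: smeas_Wvec.
Qed.

(** Kept with extended values, because the norm of E(n,p) sends an infinite integral
    to 0. *)
Definition Eint p x : \bar R :=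
  (\int[power_prob (haar M) n]_t (smod (ffn x t) `^ p)%:E)%E.

Lemma measurable_Eint p x :
  measurable_fun [set: n.-tuple (omega M)] (fun t => (smod (ffn x t) `^ p)%:E).
Proof.
apply/measurable_EFinP/(measurableT_comp (measurable_powR p)).
by apply: smeas_smod => //; exact: smeas_ffn.
Qed.

Lemma Eint_ge0 p x : (0 <= Eint p x)%E.
Proof. by apply: integral_ge0 => t _; rewrite lee_fin powR_ge0. Qed.

Lemma Espace_nrmE p x : @nrm _ _ (Espace M n p) x = fine (Eint p x `^ p^-1).
Proof.
rewrite /nrm/= Lnorm.unlock; congr (fine (_ `^ _)).
by apply: eq_integral => t _; rewrite /emod gee0_abs// lee_fin smod_ge0.
Qed.

Lemma Espace_nrm_ge0 p x : 0 <= @nrm _ _ (Espace M n p) x.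
Proof. by rewrite Espace_nrmE fine_ge0// poweR_ge0. Qed.

Lemma ffnZ (a : K) x t : @ffn R K M n (a *: x) t = a * ffn x t.
Proof.
rewrite /ffn /tip mulr_sumr; apply: eq_bigr => i _.
by rewrite ffunE -[a *: x i]/(a * x i) mulrA.
Qed.

Lemma EintZ p (a : K) x : Eint p (a *: x) = ((smod a `^ p)%:E * Eint p x)%E.
Proof.
rewrite -ge0_integralZl_EFin ?powR_ge0//; last 2 first.
- by move=> t _; rewrite lee_fin powR_ge0.
- exact: measurable_Eint.
by apply: eq_integral => t _; rewrite ffnZ (smodM ok) powRM ?smod_ge0.
Qed.

(** Homogeneity holds for the extended integral, also if it is infinite: then the
    norm is 0 by convention, before and after scaling. *)
Lemma Espace_scaling p : 0 < p -> seminormed_scaling (Espace M n p).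
Proof.
move=> p0 a x _; split=> //; last exact: Espace_nrm_ge0.
rewrite !Espace_nrmE EintZ poweRM ?Eint_ge0 ?lee_fin ?powR_ge0//.
have -> : ((smod a `^ p)%:E `^ p^-1 = (smod a)%:E)%E.
  by rewrite poweR_EFin -powRrM mulfV ?gt_eqF// powRr1// smod_ge0.
have [->|a0] := eqVneq (smod a) 0; first by rewrite mul0e mul0r.
have sa : 0 < smod a by rewrite lt_neqAle eq_sym a0 smod_ge0.
have : (0 <= Eint p x `^ p^-1)%E := poweR_ge0 _ _.
by case: (Eint p x `^ p^-1)%E => [r|_|] //=; rewrite gt0_muley ?lte_fin//= mulr0.
Qed.

End tensor_spaces.

(** * Bases of admissible blocks are conditional *)

Section conditionality.
Context {R : realType} {K : scalars R}.
Hypothesis ok : scalars_ok K.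
Variables (M : model K) (n : nat).
Hypothesis adm : admissible M n.
Notation p := (pexp R n).
Notation E := (Espace M n p).
Variable U : space K.
Variables (a : tensor K n -> U) (b : U -> tensor K n) (CA CB C : R).
Hypothesis a_lin : forall (k : K) x y, a (k *: x + y) = k *: a x + a y.
Hypothesis b_lin : forall (k : K) x y, b (k *: x + y) = k *: b x + b y.
Hypothesis abK : forall x, b (a x) = x.
Hypothesis C0 : 0 <= C.
Hypothesis CA0 : 0 <= CA.
Hypothesis CB0 : 0 <= CB.
Hypothesis aC : forall x : E, nrm (a x) <= CA * nrm x.
Hypothesis bC : forall z : U, @nrm _ _ E (b z) <= CB * nrm z.
Hypothesis E_ge0 : forall x : E, 0 <= nrm x.
Variables (kappa : R) (d : nat) (beta : nat -> U) (gamma : nat -> U -> K^o).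
Hypothesis lb : local_basis [set z : U | exists x, z = a x] kappa d beta gamma.
Hypothesis unc : forall (t : nat -> K) (z : U), (forall l, smod (t l) <= 1) ->
  (exists x, z = a x) ->
  nrm (\sum_(l < d) (t l * gamma l z) *: beta l) <= C * nrm z.

Let H : vectType K := {ffun void -> K^o}.
Notation big := (tensor K n * H)%type.
Let ip (x y : H) : K := 0.

Let a0 : a 0 = 0.
Proof. by have := a_lin (-1) 0 0; rewrite scaleN1r oppr0 addr0 scaleN1r addNr. Qed.
Let b0 : b 0 = 0.
Proof. by have := b_lin (-1) 0 0; rewrite scaleN1r oppr0 addr0 scaleN1r addNr. Qed.
Let a_sum (I : Type) (r : seq I) (k : I -> K) (x : I -> tensor K n) :
  a (\sum_(i <- r) k i *: x i) = \sum_(i <- r) k i *: a (x i).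
Proof. by elim: r => [|i r ih]; rewrite ?big_nil// !big_cons a_lin ih. Qed.
Let b_sum (I : Type) (r : seq I) (k : I -> K) (x : I -> U) :
  b (\sum_(i <- r) k i *: x i) = \sum_(i <- r) k i *: b (x i).
Proof. by elim: r => [|i r ih]; rewrite ?big_nil// !big_cons b_lin ih. Qed.

Let H0 (h : H) : h = 0. Proof. by apply/ffunP => -[]. Qed.
Let pairE (z : big) : z = (z.1, 0). Proof. by case: z => x h; rewrite [h]H0. Qed.

Let abeta l : (l < d)%N -> a (b (beta l)) = beta l.
Proof. by move=> ld; have [x ->] := lb_mem lb ld; rewrite abK. Qed.

Let gamma_sum l (k : 'I_d -> K) : (l < d)%N ->
  gamma l (\sum_(i < d) k i *: beta i) = \sum_(i < d) k i * gamma l (beta i).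
Proof.
move=> ld; have lin := lb_lin lb ld.
have Fb (i : 'I_d) : exists x, beta i = a x by exact: (lb_mem lb (ltn_ord i)).
have [F0 FZD] := lb_sub lb.
have g0 : gamma l 0 = 0.
  have := lin 1 0 0 F0 F0; rewrite scale1r addr0 scale1r => /eqP.
  by rewrite -subr_eq0 opprD addrA subrr sub0r oppr_eq0 => /eqP.
have [_] : (exists x, \sum_(i < d) k i *: beta i = a x) /\
   gamma l (\sum_(i < d) k i *: beta i) = \sum_(i < d) k i * gamma l (beta i).
  elim: (index_enum _) => [|i r [Fr ih]]; first by rewrite !big_nil.
  rewrite !big_cons; split; first exact: FZD.
  by rewrite lin// ih.
by [].
Qed.

Let X : d.-tuple big := [tuple ((b (beta l) : tensor K n), (0 : H)) | l < d].
Let XE (l : 'I_d) : X`_l = (b (beta l), 0).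
Proof. by rewrite -tnth_nth tnth_mktuple. Qed.

Let fst_sum (k : 'I_d -> K) : (\sum_(l < d) k l *: X`_l).1 = \sum_(l < d) k l *: b (beta l).
Proof.
rewrite (big_morph (fun z : big => z.1) (id1 := 0) (op1 := +%R))//.
by apply: eq_bigr => l _; rewrite XE.
Qed.

Let gamma_X (k : 'I_d -> K) (l : 'I_d) : gamma l (a (\sum_(l < d) k l *: X`_l).1) = k l.
Proof.
rewrite fst_sum a_sum (eq_bigr (fun i : 'I_d => k i *: beta i)).
  rewrite gamma_sum// (bigD1 l)//= (lb_bio lb)// eqxx mulr1 big1 ?addr0// => i il.
  rewrite (lb_bio lb)// (_ : (l == i :> nat) = false) ?mulr0//.
  by rewrite eq_sym; exact: negbTE.
by move=> i _; rewrite abeta.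
Qed.

Let freeX : free X.
Proof.
apply/freeP => k h i; rewrite -(gamma_X k i) h /= a0.
have := gamma_X (fun=> 0) i; rewrite big1 ?a0//= => l _; exact: scale0r.
Qed.

Let F : {vspace big} := <<X>>%VS.

Let dimF : \dim F = d.
Proof. by have := freeX; rewrite /free => /eqP; rewrite size_tuple. Qed.

Let memF x : (x, 0) \in F.
Proof.
have -> : (x, 0) = \sum_(l < d) (gamma l (a x)) *: X`_l :> big.
  rewrite [RHS]pairE fst_sum; congr pair.
  by rewrite -[LHS]abK -{1}(lb_full lb (ex_intro _ x erefl)) b_sum.
by apply: rpred_sum => l _; apply: rpredZ; apply: memv_span; rewrite mem_nth ?size_tuple.
Qed.

Let coordXE (z : big) (l : 'I_d) : z \in F -> coord X l z = gamma l (a z.1).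
Proof. by move=> /coord_span {2}->; rewrite gamma_X. Qed.

Let dimF_le : (\dim F <= 3 * qdim n)%N.
Proof.
pose Y := [seq ((tbasis K i : tensor K n), (0 : H)) | i <- enum (tindex n)].
apply: (@leq_trans (\dim <<Y>>)).
  apply/dimvS/span_subvP => z /tnthP[l ->]; rewrite tnth_mktuple.
  have -> : (b (beta l), 0) = \sum_i (b (beta l) i) *: ((tbasis K i : tensor K n), (0 : H)) :> big.
    rewrite [RHS]pairE; congr pair.
    rewrite (big_morph (fun z : big => z.1) (id1 := 0) (op1 := +%R))//=.
    apply/ffunP => j; rewrite sum_ffunE (bigD1 j)//= !ffunE eqxx big1 ?addr0.
      by rewrite -[_ *: _]/(_ * _) mulr1.
    by move=> i ij; rewrite !ffunE eq_sym (negPf ij) scaler0.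
  by apply: rpred_sum => i _; apply: rpredZ; apply: memv_span; apply/mapP; exists i; rewrite ?mem_enum.
apply: leq_trans (dim_span _) _.
rewrite size_map -cardE card_ffun !card_ord /qdim.
by rewrite leq_pmull.
Qed.

Let bign (z : big_space M ip F p) : nrm z = @nrm _ _ E z.1.
Proof.
rewrite /nrm/= /ip_norm /ip (sre0 ok) sqrtr0 expr0n/= addr0 sqrtr_sqr ger0_norm//.
exact: (E_ge0 z.1).
Qed.

(** The unconditional constant transported to E by the maps a and b; admissibility
    speaks of constants that are at least 1. *)
Definition uncond_const : R := Num.max 1 (CB * (C * CA)).

Let uncX : @unconditional_with R K (big_space M ip F p) 'I_d
   (fun i => tnth X i) (fun i => coord X i) uncond_const.
Proof.
move=> s t us t1; apply: ge_ereal_sup => _ [z [mz z1] <-]; rewrite lee_fin bign.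
have zF : z \in F by exact: mz.
pose t' l : K := if insub l is Some i then (if i \in s then t i else 0) else 0.
have t'1 l : smod (t' l) <= 1.
  by rewrite /t'; case: insubP => [i _ _|_]; [case: ifP|]; rewrite ?(smod0 ok).
have -> : (@multiplier R K (big_space M ip F p) 'I_d (fun i => tnth X i)
      (fun i => coord X i) s t z).1 =
    b (\sum_(l < d) (t' l * gamma l (a z.1)) *: beta l).
  rewrite /multiplier (big_morph (fun z : big => z.1) (id1 := 0) (op1 := +%R))//.
  rewrite big_uniq//= b_sum big_mkcond/=; apply: eq_bigr => l _.
  rewrite /t' valK; case: ifP => _; last by rewrite mul0r scale0r.
  by rewrite coordXE// tnth_mktuple.
have z1' : @nrm _ _ E z.1 <= 1 by rewrite -bign.
rewrite (le_trans (bC _))// /uncond_const le_max; apply/orP; right.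
rewrite ler_wpM2l// (le_trans (unc t'1 _))//; first by exists z.1.
rewrite ler_wpM2l// (le_trans (aC _))//.
by rewrite ler_piMr.
Qed.

Let tip_self (u : tensor K n) : tip u u = sinj K (\sum_i smod (u i) ^+ 2).
Proof.
rewrite (sinj_sum ok); apply: eq_bigr => i _.
by rewrite mulrC (mul_sconj ok).
Qed.

Let orth_projE x : orth_proj ip F (x, 0) = (x, 0).
Proof.
have Fxx := memF x.
pose P := [set y : big | y \in F /\ forall f, f \in F -> big_ip ip ((x, 0) - y) f = 0].
have [yF yo] : P (orth_proj ip F (x, 0)).
  apply: (@xgetPex _ 0 P); exists (x, 0); split=> // f _.
  rewrite subrr /big_ip /ip addr0; apply: big1 => i _.
  by rewrite ffunE mul0r.
set y := orth_proj ip F (x, 0) in yF yo *.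
have := yo _ (memvB Fxx yF); rewrite /big_ip /ip addr0 tip_self => h.
have h2 : \sum_i smod ((((x, 0) - y).1 : tensor K n) i) ^+ 2 = 0.
  by rewrite -[LHS](sre_inj ok) h (sre0 ok).
apply/esym/eqP; rewrite -subr_eq0; apply/eqP.
rewrite [LHS]pairE; congr pair; apply/ffunP => i; rewrite [RHS]ffunE.
apply: (smod_eq0 ok); apply/eqP; rewrite -sqrf_eq0.
move/eqP: h2; rewrite psumr_eq0; last by move=> j _; exact: sqr_ge0.
by move=> /allP/(_ i (mem_index_enum i)).
Qed.

Let theta1 : theta ip F = 1.
Proof.
rewrite /theta /trace (eq_bigr (fun=> 1)); last first.
  by move=> i _; rewrite orth_projE/= ffunE eqxx.
rewrite sumr_const card_ffun !card_ord -/(qdim n).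
have -> : sre (1 *+ qdim n : K) = (qdim n)%:R.
  elim: (qdim n) => [|k ih]; first by rewrite (sre0 ok).
  by rewrite mulrS (sreD ok) (sre1 ok) ih -natr1 addrC.
by rewrite mulVf// pnatr_eq0 expn_eq0.
Qed.

(** Admissibility is applied with H = 0, modelled on the functions on an empty set,
    and with F the whole space, of dimension 2^n; there R_F is the identity and
    theta = 1. *)
Lemma admissible_conditional : 1 <= 80 * uncond_const ^+ 3 / Lambda M n.
Proof.
have [_ _ _ h] := adm; rewrite -[leLHS]theta1; apply: h.
- by rewrite le_max lexx.
- split=> //; first by move=> k x y z _ _ _; rewrite /ip mulr0 addr0.
    by move=> x y _ _; rewrite /ip (sconj0 ok).
  by move=> x _ /eqP; rewrite [x]H0.
- exact: dimF_le.
have cast k (e : d = k) : exists2 Z : k.-tuple big, basis_of F Z &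
   @unconditional_with R K (big_space M ip F p) 'I_k
     (fun i => tnth Z i) (fun i => coord Z i) uncond_const.
  case: _ / e; exists X; last exact: uncX.
  by rewrite /basis_of eqxx freeX.
exact: (cast _ (esym dimF)).
Qed.

End conditionality.

(** * Growth of the parameters *)

Section growth.
Variable R : realType.

Lemma powR_nat_small (r e : R) : 0 < r -> 0 < e ->
  exists N : nat, forall m, (N <= m)%N -> (m%:R `^ (- r) : R) <= e.
Proof.
move=> r0 e0; pose B := e^-1 `^ r^-1.
exists (Num.trunc B).+1 => m Nm.
have Bm : B <= m%:R.
  by rewrite (le_trans (ltW (truncnS_gt _)))// ler_nat.
have B0 : 0 < B by rewrite powR_gt0// invr_gt0.
have m0 : (0 : R) < m%:R := lt_le_trans B0 Bm.
rewrite powRN -[leRHS]invrK lef_pV2 ?posrE ?invr_gt0 ?powR_gt0//.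
have -> : e^-1 = B `^ r.
  by rewrite /B -powRrM mulVf ?gt_eqF// powRr1// invr_ge0 ltW.
by apply: ge0_ler_powR; rewrite ?nnegrE ?(ltW B0) ?(ltW m0) ?(ltW r0).
Qed.

(** The ratio is 1 + O(s): bell_lambda >= 1 - 3 s / 2. *)
Lemma bell_ratio_small (e : R) : 0 < e -> exists2 e' : R, 0 < e' & e' <= 14^-1 /\
  forall s, 0 < s -> s <= e' -> bell_kappa s / bell_lambda s <= 1 + e.
Proof.
move=> e0; exists (Num.min 14^-1 (e / (16 + 2 * e))).
  by rewrite lt_min invr_gt0 ltr0n/= divr_gt0// addr_gt0// mulr_gt0.
split; first by rewrite ge_min lexx.
move=> s s0; rewrite le_min => /andP[s1 s2].
have l0 := bell_lambda_gt0 s0 s1; rewrite ler_pdivrMr//.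
move: s2; rewrite ler_pdivlMr ?addr_gt0 ?mulr_gt0// => s2.
have s32 : s / (2 + s) <= s / 2.
  by rewrite ler_pdivrMr ?addr_gt0// mulrAC ler_pdivlMr// ler_wpM2l ?(ltW s0)//; lra.
have l1 : 1 - 3 / 2 * s <= bell_lambda s.
  rewrite /bell_lambda lerB// -mulrA.
  have k3 : 1 + bell_kappa s <= 3 by rewrite /bell_kappa; move: s1; lra.
  apply: (@le_trans _ _ (3 * (s / (2 + s)))).
    by rewrite ler_wpM2r// divr_ge0 ?addr_ge0 ?(ltW s0).
  by move: s32; lra.
have e1 : 0 <= 1 + e by rewrite addr_ge0// ltW.
apply: le_trans (ler_wpM2l e1 l1); rewrite /bell_kappa.
by nra.
Qed.

Section lambda.
Context {K : scalars R}.
Variables (M : model K) (n : nat -> nat) (eps : nat -> R -> R) (D : nat -> R).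
Hypothesis tau1 : 1 <= tau M.
Hypothesis sc : sequence_conditions M n eps D.
Hypothesis D2 : forall j, 2 <= D j.
Hypothesis DS : forall j, alpha M (pj R n j) ^+ n j <= D j.+1.

Lemma seq_gt0 j : (0 < n j)%N.
Proof. by have [_ adm _ _] := sc; have [] := adm j. Qed.

Lemma seq_ge j : (j <= n j)%N.
Proof.
have [mono _ _ _] := sc; elim: j => // j ih.
by apply: leq_ltn_trans ih _; apply: mono.
Qed.

Lemma pexp_gt2 m : 2 <= pexp R m.
Proof. by rewrite /pexp lerDl powR_ge0. Qed.

Lemma alpha_ge0 r : 0 <= alpha M r.
Proof. by rewrite /alpha fine_ge0// Lnorm_ge0. Qed.

Lemma Lambda_le m : Lambda M m <= alpha M (pexp R m) ^+ m.
Proof.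
rewrite /Lambda ler_piMr ?exprn_ge0 ?alpha_ge0//.
apply: le_trans (_ : tau M `^ 0 <= 1); last by rewrite powRr0.
apply: ler_powR => //; rewrite oppr_le0.
have p0 : 0 <= pexp R m := le_trans (ler0n _ 2) (pexp_gt2 m).
by apply: divr_ge0; apply: mulr_ge0 => //; rewrite subr_ge0 pexp_gt2.
Qed.

(** D_(j+1) >= alpha^n >= Lambda_j >= D_j^8 >= 2 D_j. *)
Lemma D_pow2 j : 2 ^+ j <= D j.
Proof.
have [_ _ DL _] := sc; elim: j => [|j ih].
  by rewrite expr0 (le_trans _ (D2 0))// ler1n.
apply: le_trans (DS j); apply: le_trans (Lambda_le _); apply: le_trans (DL j).
rewrite exprS (exprS _ 7) [leRHS]mulrC ler_pM ?exprn_ge0//.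
apply: (@le_trans _ _ (2 ^+ 7)); first by rewrite -natrX ler_nat.
by rewrite lerXn2r ?nnegrE ?(le_trans _ (D2 j)).
Qed.

Lemma Lambda_unbounded (B : R) : exists J, forall j, (J <= j)%N -> B < Lambda M (n j).
Proof.
have [_ _ DL _] := sc; exists (Num.trunc B).+1 => j Jj.
apply: lt_le_trans (DL j); apply: (@lt_le_trans _ _ (2 ^+ j)).
  apply: (@lt_le_trans _ _ j%:R).
    by apply: lt_le_trans (truncnS_gt _) _; rewrite ler_nat.
  by rewrite -natrX ler_nat ltnW// ltn_expl.
apply: le_trans (D_pow2 j) _; rewrite -[leLHS]expr1.
by apply: ler_weXn2l => //; rewrite (le_trans _ (D2 j))// ler1n.
Qed.

End lambda.
End growth.

(** * Assembling the blocks *)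

Section block_assembly.
Context {R : realType} {K : scalars R}.
Hypothesis ok : scalars_ok K.
Variables (M : model K) (n : nat -> nat).
Hypothesis adm : forall j, admissible M (n j).
Hypothesis LamU : forall B : R, exists J, forall j, (J <= j)%N -> B < Lambda M (n j).
Hypothesis E_ge0 : forall j (x : Espace M (n j) (pexp R (n j))), 0 <= nrm x.
Variables (I : nat -> finType) (omega p : nat -> R).
Hypothesis omega_gt0 : forall j, 0 < omega j.
Hypothesis p_gt1 : forall j, 1 < p j.
Variable N : forall j, {ffun I j -> K^o} -> R.
Hypothesis NE : forall j z, N (j := j) z = wlp (omega j) (p j) z.
Notation U := (fun j => @full_space R K {ffun I j -> K^o} (@N j)).
Variable F : forall j, set (U j).
Arguments F : clear implicits.
Variables (rng : nat -> bool) (CA CB : R).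
Hypothesis CA0 : 0 <= CA.
Hypothesis CB0 : 0 <= CB.
Hypothesis rngU : forall J, exists2 j, (J <= j)%N & rng j.
Variables (a : forall j, tensor K (n j) -> U j) (b : forall j, U j -> tensor K (n j)).
Hypothesis rngP : forall j, rng j -> [/\
  forall (k : K) x y, a (k *: x + y) = k *: a x + a y :> U j,
  forall (k : K) (x y : U j), b (k *: x + y) = k *: b x + b y,
  forall x : tensor K (n j), b (a x) = x &
  [/\ forall x : Espace M (n j) (pexp R (n j)), nrm (a x : U j) <= CA * nrm x,
      forall z : U j, @nrm _ _ (Espace M (n j) (pexp R (n j))) (b z) <= CB * nrm z &
      F j = [set z | exists x, z = a x]]].
Variable good : nat -> R -> Prop.
Hypothesis good1 : forall e : R, 0 < e -> exists J, forall j kappa,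
  (J <= j)%N -> good j kappa -> kappa <= 1 + e.
Hypothesis lbs : forall j, exists kappa d (beta : nat -> U j) (gamma : nat -> U j -> K^o),
  local_basis (F j) kappa d beta gamma /\ good j kappa.
Variable Y : set (l2sum U).
Hypothesis YE : forall x : l2sum U, Y x <-> mem x /\ forall j, F j (x j).

(** The common frame of the constructions: bases of the blocks with constants
    controlled by [good], and infinitely many blocks that are ranges of the maps a,
    with uniformly bounded a and b, on which conditionality is witnessed. *)
Theorem block_good_bases :
  has_good_bases (subspace_of Y) /\ has_good_bases (dual (subspace_of Y)).
Proof.
have nU j : normed (U j) by exact: (normed_wlp ok (omega_gt0 j) (p_gt1 j) (@NE j)).
have lbs' j : exists q : R * nat * (nat -> U j) * (nat -> U j -> K^o),
    local_basis (F j) q.1.1.1 q.1.1.2 q.1.2 q.2 /\ good j q.1.1.1.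
  by have [kappa [d [beta [gamma h]]]] := lbs j; exists (kappa, d, beta, gamma).
pose q j := sval (cid (lbs' j)).
have qP j := svalP (cid (lbs' j)).
apply: (@concatenation_good_bases R K ok U nU _ _ F (fun j => (q j).1.1.1)
  (fun j => (q j).1.1.2) (fun j => (q j).1.2) (fun j => (q j).2)).
- by [].
- by move=> j y; exact: (norming_wlp ok (omega_gt0 j) (p_gt1 j) (@NE j)).
- by move=> j; case: (qP j).
- move=> e /good1[J hJ]; exists J => j Jj; apply: hJ Jj _; by case: (qP j).
- move=> C; apply: contrapT => nC.
  pose C0 := Num.max C 0.
  have C00 : 0 <= C0 by rewrite le_max lexx orbT.
  have [J hJ] := LamU (80 * (Num.max 1 (CB * (C0 * CA))) ^+ 3).
  have [j Jj rj] := rngU J.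
  have [al bl abK [aC bC FE]] := rngP rj.
  have lbj : local_basis [set z | exists x, z = a x] (q j).1.1.1 (q j).1.1.2 (q j).1.2 (q j).2.
    by rewrite -FE; case: (qP j).
  have := @admissible_conditional R K ok M (n j) (adm j) (U j)
    (@a j) (@b j) CA CB C0 al bl abK C00 CA0 CB0 aC bC (@E_ge0 j) _ _ _ _ lbj.
  have h80 := hJ j Jj; rewrite /uncond_const.
  have L0 : 0 < Lambda M (n j).
    apply: le_lt_trans h80; rewrite mulr_ge0// exprn_ge0// le_max ler01//.
  rewrite ler_pdivlMr// mul1r leNgt h80 => h; suff : false by [].
  apply: h => t z t1 zF; rewrite leNgt; apply/negP => lt; apply: nC.
  exists j, t, z; split=> //; first by rewrite FE.
  apply: le_lt_trans lt; apply: ler_wpM2r; first exact: (nrm_ge0 ok (nU j)).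
  by rewrite le_max lexx.
- exact: YE.
Qed.

End block_assembly.

Lemma opnorm_le_max (R : realType) (K : scalars R) (ok : scalars_ok K) (S T : space K) (f : S -> T) (C : R) :
  seminormed_scaling S -> seminormed_scaling T ->
  (forall x, mem x -> mem (f x)) ->
  (forall (a : K) x, mem x -> f (a *: x) = a *: f x) ->
  (opnorm f <= C%:E)%E -> forall x, mem x -> nrm (f x) <= Num.max C 0 * nrm x.
Proof.
move=> sS sT mf fZ fC x mx; apply: le_trans (opnorm_le ok sS sT mf fZ fC mx) _.
by have [_ _ x0] := sS 1 x mx; rewrite ler_wpM2r// le_max lexx.
Qed.

(** Boundedness keeps the image of an element square summable, and by idempotence the
    image is fixed. *)
Lemma diag_image_iff (R : realType) (K : scalars R) (ok : scalars_ok K) (U : nat -> space K)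
    (nU : forall j, normed (U j)) (memU : forall j (x : U j), mem x)
    (T : forall j, U j -> U j) (C : R) : 0 <= C ->
  (forall j (x : U j), nrm (T j x) <= C * nrm x) ->
  (forall j (x : U j), T j (T j x) = T j x) ->
  forall x : l2sum U, (@diag_op R K U U T @` @mem _ _ (l2sum U)) x <->
    mem x /\ forall j, T j (x j) = x j.
Proof.
move=> C0 TC TT x; split=> [[y my <-]|[mx Tx]]; last first.
  by exists x => //; apply: functional_extensionality_dep.
split=> [|j]; last exact: TT.
have y0 : 0 <= @nrm _ _ (l2sum U) y by exact: l2_nrm_ge0.
have [] := @l2_le R K U (@diag_op R K U U T y) (C * @nrm _ _ (l2sum U) y) _ _ _ => //.
  exact: mulr_ge0.
move=> J; rewrite exprMn; apply: le_trans (ler_wpM2l (exprn_ge0 2 C0) (l2_sqs_le J my)).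
rewrite mulr_sumr; apply: ler_sum => j _; rewrite -exprMn lerXn2r ?nnegrE ?mulr_ge0//.
- exact: (nrm_ge0 ok (nU j)).
- exact: (nrm_ge0 ok (nU j)).
- exact: TC.
Qed.

(** * Real scalars *)

Section real_scalar_parts.
Variable R : realType.
Notation K := (real_scalars R).
Notation M := (real_model R).
Let ok := real_scalars_ok R.

Lemma real_wmeas i : smeas (fun t : omega M => @wvec R K M t i).
Proof.
split; last exact: measurable_cst.
apply: (@measurable_funM _ _ R setT (fun=> Num.sqrt 2)); first exact: measurable_cst.
case: (i == ord0); apply: continuous_measurable_fun => x;
  [exact: continuous_cos|exact: continuous_sin].
Qed.

Lemma real_Espace_scaling m : seminormed_scaling (Espace M m (pexp R m)).
Proof.
apply: (Espace_scaling ok real_wmeas).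
exact: lt_le_trans (ltr0n _ 2) (pexp_gt2 R m).
Qed.

Lemma real_Espace_ge0 m (x : Espace M m (pexp R m)) : 0 <= nrm x.
Proof. exact: (Espace_nrm_ge0 ok). Qed.

Lemma sampA_lin m (k : K) (x y : tensor K m) :
  sampA (k *: x + y) = k *: sampA x + sampA y :> gridfun R m.
Proof.
apply/ffunP => r; rewrite [RHS]ffunE [X in _ = X + _]ffunE ![sampA _ r]ffunE.
rewrite -[X in _ = X + _]/(k * _) /ffn /tip mulr_sumr -big_split/=; apply: eq_bigr => i _.
by rewrite [X in X * _ = _]ffunE [X in (X + _) * _ = _]ffunE -[k *: x i]/(k * x i) mulrDl mulrA.
Qed.

Section real_blocks.
Variables (n : nat -> nat) (eps : nat -> R -> R) (D : nat -> R).
Hypothesis sc : sequence_conditions M n eps D.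
Hypothesis D2 : forall j, 2 <= D j.
Hypothesis DS : forall j, alpha M (pj R n j) ^+ n j <= D j.+1.
Variable om : nat -> R.
Hypothesis om_gt0 : forall j, 0 < om j.
Variable N : forall j, {ffun grid (n j) -> K^o} -> R.
Hypothesis NE : forall j z, N (j := j) z = @wlp R K _ (om j) (pexp R (n j)) z.
Notation U := (fun j => @full_space R K {ffun grid (n j) -> K^o} (@N j)).
Variable rng : nat -> bool.
Hypothesis rngU : forall J, exists2 j, (J <= j)%N & rng j.
Variable T : forall j, U j -> U j.
Hypothesis TE : forall j z, T (j := j) z = if rng j then sampR z else sampR_compl z.
Variables (c : nat -> R) (CA CB CT : R).
Hypothesis c_neq0 : forall j, c j != 0.
Hypothesis CA0 : 0 <= CA.
Hypothesis CB0 : 0 <= CB.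
Hypothesis CT0 : 0 <= CT.
Hypothesis aC : forall j (x : Espace M (n j) (pexp R (n j))),
  N (j := j) (c j *: sampA x) <= CA * nrm x.
Hypothesis bC : forall j z,
  @nrm _ _ (Espace M (n j) (pexp R (n j))) (sampB ((c j)^-1 *: z)) <= CB * N (j := j) z.
Hypothesis TC : forall j z, N (T (j := j) z) <= CT * N z.

Let n_gt0 j : (0 < n j)%N := seq_gt0 sc j.

Let tau1 : 1 <= tau M.
Proof. by rewrite /= ler_pdivlMr// mul1r ler_nat. Qed.

Let sampB_lin j (k : R) (z w : gridfun R (n j)) :
  sampB (k *: z + w) = k *: sampB z + sampB w.
Proof.
apply/ffunP => i; rewrite [RHS]ffunE [X in _ = X + _]ffunE !sampBE.
by rewrite phi_coef_lin mulrDr -[X in _ = X + _]/(k * _) mulrCA.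
Qed.

Let sampR_lin j (k : R) (z w : gridfun R (n j)) :
  sampR (k *: z + w) = k *: sampR z + sampR w.
Proof. by rewrite /sampR sampB_lin sampA_lin. Qed.

Let sampA0 j : sampA (0 : tensor K (n j)) = 0.
Proof. by have := sampA_lin (-1) (0 : tensor K (n j)) 0; rewrite scaleN1r oppr0 addr0 scaleN1r addNr. Qed.
Let sampB0 j : sampB (0 : gridfun R (n j)) = 0.
Proof. by have := sampB_lin (-1) (0 : gridfun R (n j)) 0; rewrite scaleN1r oppr0 addr0 scaleN1r addNr. Qed.
Let sampBZ j (k : R) (z : gridfun R (n j)) : sampB (k *: z) = k *: sampB z.
Proof. by rewrite -[k *: z]addr0 sampB_lin sampB0 addr0. Qed.
Let sampAZ j (k : R) (x : tensor K (n j)) : sampA (k *: x) = k *: sampA x.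
Proof. by rewrite -[k *: x]addr0 sampA_lin sampA0 addr0. Qed.

Let sampR_sub j (z : gridfun R (n j)) : sampR (z - sampR z) = 0.
Proof. by rewrite addrC -scaleN1r sampR_lin (sampR_idem (n_gt0 j)) scaleN1r addNr. Qed.

(** The weights om and the factors c let one statement cover the normalised norms and
    the ones that are rescaled to the counting measure; rng selects the positions
    at which the range of R, and not the kernel, is the block. *)
Theorem real_diag_image_good_bases (Y : set (l2sum U)) :
  Y = @diag_op R K U U T @` @mem _ _ (l2sum U) ->
  has_good_bases (subspace_of Y) /\ has_good_bases (dual (subspace_of Y)).
Proof.
move=> ->.
have [_ adm _ _] := sc.
have p_gt1 j : 1 < pexp R (n j).
  by apply: lt_le_trans (pexp_gt2 R (n j)); rewrite ltr1n.
have nU j : normed (U j) by exact: (normed_wlp ok (om_gt0 j) (p_gt1 j) (@NE j)).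
apply: (@block_good_bases R K ok M n adm (Lambda_unbounded tau1 sc D2 DS)
  (fun j x => real_Espace_ge0 x) _ om (fun j => pexp R (n j)) om_gt0 p_gt1 N NE
  (fun j => [set z | T z = z]) rng CA CB CA0 CB0 rngU
  (fun j x => c j *: sampA x) (fun j z => sampB ((c j)^-1 *: z)) _
  (fun j kappa => let s := (n j)%:R `^ (- (3 / 4)) : R in
     s <= 14^-1 -> kappa <= bell_kappa s / bell_lambda s)).
- move=> j rj; split; [| | |split].
  + by move=> k x y; rewrite sampA_lin scalerDr !scalerA [c j * k]mulrC.
  + by move=> k x y; rewrite !sampBZ sampB_lin scalerDr !scalerA [_^-1 * k]mulrC.
  + by move=> x; rewrite scalerA mulVf// scale1r (sampBA (n_gt0 j)).
  + exact: aC.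
  + exact: bC.
  + apply/seteqP; split=> z /=; rewrite TE rj.
      move=> zE; exists (sampB ((c j)^-1 *: z)).
      by rewrite sampBZ sampAZ scalerA mulfV// scale1r.
    by move=> [x ->]; rewrite /sampR sampBZ (sampBA (n_gt0 j)) sampAZ.
- move=> e e0; have [e' e'0 [e'le h]] := bell_ratio_small e0.
  have [J hJ] := @powR_nat_small R (3 / 4) e' (divr_gt0 (ltr0n _ 3) (ltr0n _ 4)) e'0; exists J => j kappa Jj.
  have sj := hJ (n j) (leq_trans Jj (seq_ge sc j)).
  move=> /(_ (le_trans sj e'le))/le_trans; apply; apply: h sj.
  by rewrite powR_gt0// ltr0n.
- move=> j; case rj: (rng j).
    have -> : [set z : U j | T z = z] = [set z : gridfun R (n j) | sampR z = z].
      by apply/seteqP; split=> z /=; rewrite TE rj.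
    exact: (sampR_range_basis (n_gt0 j) (om_gt0 j) (@NE j)).
  have -> : [set z : U j | T z = z] = [set z : gridfun R (n j) | sampR z = 0].
    apply/seteqP; split=> z /=; rewrite TE rj /sampR_compl.
      by move=> zE; rewrite -zE sampR_sub.
    by move=> ->; rewrite subr0.
  exact: (sampR_kernel_basis (n_gt0 j) (om_gt0 j) (@NE j)).
apply: (diag_image_iff ok nU _ CT0 TC) => // j z; rewrite !TE; case: (rng j).
  exact: (sampR_idem (n_gt0 j)).
by rewrite /sampR_compl sampR_sub subr0.
Qed.

End real_blocks.
End real_scalar_parts.

Section real_conclusions.
Variable R : realType.
Notation K := (real_scalars R).
Notation M := (real_model R).
Let ok := real_scalars_ok R.
Variable rho : R.
Hypothesis rho_gt0 : 0 < rho.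
Let C1 : R := 1 + rho / 2.
Let C1_ge0 : 0 <= C1.
Proof. by rewrite addr_ge0// divr_ge0// ltW. Qed.

Lemma lp_nrmE (p : R) (I : finType) (z : {ffun I -> K^o}) :
  @nrm _ _ (@lp_space R K p I) z = @wlp R K I 1 p z.
Proof. by rewrite /wlp mul1r. Qed.

Lemma Uspace_nrmE m (z : gridfun R m) :
  @nrm _ _ (Uspace R m) z = @wlp R K (grid m) ((mesh m)%:R ^- m) (pexp R m) z.
Proof. by rewrite /wlp [_^-1 * _]mulrC. Qed.

Let pexp_gt1 m : 1 < pexp R m.
Proof. by apply: lt_le_trans (pexp_gt2 R m); rewrite ltr1n. Qed.

Let sampAZ m (k : R) (x : tensor K m) : sampA (k *: x) = k *: sampA x.
Proof.
apply/ffunP => r; rewrite [RHS]ffunE ![sampA _ r]ffunE /ffn /tip.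
rewrite -[RHS]/(k * _) mulr_sumr; apply: eq_bigr => i _.
by rewrite [X in X * _ = _]ffunE -[k *: x i]/(k * x i) mulrA.
Qed.

Let sampBZ m (k : R) (z : gridfun R m) : sampB (k *: z) = k *: sampB z.
Proof.
by apply/ffunP => i; rewrite [RHS]ffunE !sampBE phi_coefZ -[RHS]/(k * _) mulrCA.
Qed.

Theorem Z_real_good_bases (eps : nat -> R -> R) (n : nat -> nat) :
  partB_real n rho eps ->
  has_good_bases (Z_real R n) /\ has_good_bases (dual (Z_real R n)).
Proof.
move=> [sc [abK [C abC] abn]].
have n0 := seq_gt0 sc.
have D2 j : 2 <= DB M n j by case: j => [|j] //=; rewrite le_max lexx.
have DS j : alpha M (pj R n j) ^+ n j <= DB M n j.+1 by rewrite /= le_max lexx orbT.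
have g0 j : 0 < rescale R (n j).
  rewrite powR_gt0// ltr0n card_ffun card_ord expn_gt0 /mesh muln_gt0 expn_gt0.
  by rewrite n0.
have g1 j : rescale R (n j) != 0 by rewrite gt_eqF.
have sU j : seminormed_scaling (@lp_space R K (pj R n j) (grid (n j))).
  apply: (normed_scaling ok); apply: (normed_wlp ok ltr01 (pexp_gt1 (n j))) => z.
  exact: lp_nrmE.
have sE j : seminormed_scaling (Ej M n j) by exact: real_Espace_scaling.
have realAZ j (a : R) (x : Ej M n j) : realA (a *: x) = a *: realA x.
  by rewrite /realA sampAZ !scalerA mulrC.
have realBZ j (a : R) (z : @lp_space R K (pj R n j) (grid (n j))) :
    Defs.realB (a *: z) = a *: Defs.realB z.
  by rewrite /Defs.realB !sampBZ !scalerA [_^-1 * a]mulrC.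
have realAB j (z : @lp_space R K (pj R n j) (grid (n j))) : realA (Defs.realB z) = sampR z.
  by rewrite /realA /Defs.realB sampBZ sampAZ scalerA mulfV// scale1r.
apply: (@real_diag_image_good_bases R n eps (DB M n) sc D2 DS (fun=> 1) (fun=> ltr01)
  (fun j => @nrm _ _ (@lp_space R K (pj R n j) (grid (n j)))) _ (fun=> true) _
  (fun j z => realA (Defs.realB z)) _ (fun j => rescale R (n j))
  (Num.max C 0) (Num.max C 0) C1 g1 _ _ C1_ge0).
- by move=> j z; exact: lp_nrmE.
- by move=> J; exists J.
- by move=> j z; exact: realAB.
- by rewrite le_max lexx orbT.
- by rewrite le_max lexx orbT.
- move=> j x; have [aC _] := abC j.
  exact: (opnorm_le_max ok (sE j) (sU j) _ (fun a x _ => realAZ j a x) aC).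
- move=> j x; have [_ bC] := abC j.
  exact: (opnorm_le_max ok (sU j) (sE j) _ (fun a x _ => realBZ j a x) bC).
- move=> j z; apply: (opnorm_le ok (sU j) (sU j) _ _ (abn j)) => // a y _.
  by rewrite realBZ realAZ.
- by [].
Qed.

Section partC.
Variables (eps : nat -> R -> R) (n : nat -> nat).
Hypothesis hC : partC n rho eps.
Let sc : sequence_conditions M n eps (DC R n). Proof. by case: hC. Qed.

Let DC_ge j (B : R) : B <= 2 \/ (exists2 i, (i < j)%N & B <= alpha M (pj R n i) ^+ n i) ->
  B <= DC R n j.
Proof.
case=> [B2|[i ij Bi]].
  by apply: le_trans B2 _; rewrite /DC; apply: (big_rec (fun x => 2 <= x)) => // i x _ hx; rewrite le_max hx orbT.
rewrite /DC (bigD1 (Ordinal ij))//= le_max; apply/orP; left.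
by rewrite le_max Bi.
Qed.

Lemma partC_good_bases (rng : nat -> bool)
    (T : forall j, Uspace R (n j) -> Uspace R (n j)) :
  (forall J, exists2 j, (J <= j)%N & rng j) ->
  (forall j z, T j z = if rng j then sampR z else sampR_compl z) ->
  forall Y : set (Xspace R n),
  Y = @diag_op R K (fun j => Uspace R (n j)) (fun j => Uspace R (n j)) T
        @` @mem _ _ (Xspace R n) ->
  has_good_bases (subspace_of Y) /\ has_good_bases (dual (subspace_of Y)).
Proof.
move=> rngU TE Y YE.
have n0 := seq_gt0 sc.
have om0 j : 0 < (mesh (n j))%:R ^- n j :> R.
  by rewrite invr_gt0 exprn_gt0// ltr0n /mesh muln_gt0 expn_gt0 n0.
have sU j : seminormed_scaling (Uspace R (n j)).
  apply: (normed_scaling ok); apply: (normed_wlp ok (om0 j) (pexp_gt1 (n j))) => z.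
  exact: Uspace_nrmE.
have sE j : seminormed_scaling (Ej M n j) by exact: real_Espace_scaling.
apply: (@real_diag_image_good_bases R n eps (DC R n) sc _ _
  (fun j => (mesh (n j))%:R ^- n j) om0
  (fun j => @nrm _ _ (Uspace R (n j))) _ rng rngU T TE (fun=> 1) 2 2 C1 _ _ _ C1_ge0).
- by move=> j; apply: DC_ge; left.
- by move=> j; apply: DC_ge; right; exists j.
- by move=> j z; exact: Uspace_nrmE.
- by move=> j; rewrite oner_eq0.
- by [].
- by [].
- move=> j x; rewrite scale1r; have [_ /(_ j)[_ _ aC _]] := hC.
  exact: (opnorm_le ok (sE j) (sU j) _ (fun a x _ => sampAZ a x) aC).
- move=> j z; rewrite invr1 scale1r; have [_ /(_ j)[_ _ _ bC]] := hC.
  exact: (opnorm_le ok (sU j) (sE j) _ (fun a x _ => sampBZ a x) bC).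
- move=> j z; rewrite TE; have [_ /(_ j)[RC cC _ _]] := hC; case: (rng j).
    apply: (opnorm_le ok (sU j) (sU j) _ _ RC) => // a y _.
    by rewrite /sampR sampBZ sampAZ.
  apply: (opnorm_le ok (sU j) (sU j) _ _ cC) => // a y _.
  by rewrite /sampR_compl /sampR sampBZ sampAZ scalerBr.
- exact: YE.
Qed.

Theorem QX_good_bases : has_good_bases (QX R n) /\ has_good_bases (dual (QX R n)).
Proof.
apply: (@partC_good_bases (fun j => ~~ odd j)
  (fun j z => if odd j then sampR_compl z else sampR z)) => //.
  by move=> J; exists J.*2; rewrite ?odd_double// -addnn leq_addr.
by move=> j z; case: (odd j).
Qed.

Theorem IQX_good_bases : has_good_bases (IQX R n) /\ has_good_bases (dual (IQX R n)).
Proof.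
apply: (@partC_good_bases odd (fun j z => if odd j then sampR z else sampR_compl z)) => //.
  by move=> J; exists J.*2.+1; rewrite /= ?odd_double// ltnW// ltnS -addnn leq_addr.
congr (_ @` _); apply/funext => x; apply: functional_extensionality_dep => j.
rewrite /diag_op -[(x - _) j]/(x j - _) /Qop /diag_op; case: (odd j) => //.
by rewrite /sampR_compl subKr.
Qed.

End partC.
End real_conclusions.

(** * Integrals over powers of a probability space *)

Section power_integrals.
Context {R : realType} {d : measure_display} {T : measurableType d}.
Variable P : probability T R.
Local Open Scope ereal_scope.

Lemma integral_power_probS n (F : n.+1.-tuple T -> \bar R) :
  measurable_fun [set: n.+1.-tuple T] F -> (forall t, 0 <= F t) ->
  \int[power_prob P n.+1]_t F t =
    \int[P]_u \int[power_prob P n]_t F (tuple_cons (u, t)).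
Proof.
move=> mF F0; rewrite /= /distribution.
rewrite (ge0_integral_pushforward (@measurable_tuple_cons _ T n))//.
rewrite preimage_setT (fubini_tonelli1 (F \o @tuple_cons _ _ n))//.
  by apply: measurableT_comp mF _; exact: measurable_tuple_cons.
by move=> u; exact: F0.
Qed.

Definition tmap (th : nat -> T -> T) n (t : n.-tuple T) : n.-tuple T :=
  [tuple th s (tnth t s) | s < n].

Lemma tmap_cons th n u (t : n.-tuple T) :
  tmap th (tuple_cons (u, t)) = tuple_cons (th 0%N u, tmap (fun s => th s.+1) t).
Proof.
apply: eq_from_tnth => s; rewrite tnth_mktuple.
case: (unliftP ord0 s) => [k ->|->]; last by rewrite !tnth0.
by rewrite !tnthS tnth_mktuple.
Qed.

Lemma measurable_tmap th n : (forall s, measurable_fun [set: T] (th s)) ->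
  measurable_fun [set: n.-tuple T] (@tmap th n).
Proof.
move=> mth; apply/measurable_fun_tnthP => s.
rewrite (_ : _ \o _ = th s \o (fun t : n.-tuple T => tnth t s)).
  exact: (measurableT_comp (mth s) (measurable_tnth s)).
by apply/funext => t /=; rewrite tnth_mktuple.
Qed.

Definition integral_preserving (f : T -> T) : Prop :=
  forall F : T -> \bar R, measurable_fun [set: T] F -> (forall u, 0 <= F u) ->
    \int[P]_u F (f u) = \int[P]_u F u.

(** Tonelli's theorem, one coordinate at a time. *)
Lemma integral_tmap n th (F : n.-tuple T -> \bar R) :
  (forall s, measurable_fun [set: T] (th s)) -> (forall s, integral_preserving (th s)) ->
  measurable_fun [set: n.-tuple T] F -> (forall t, 0 <= F t) ->
  \int[power_prob P n]_t F (tmap th t) = \int[power_prob P n]_t F t.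
Proof.
elim: n th F => [|n ih] th F mth pth mF F0.
  by apply: eq_integral => t _; congr F; rewrite [LHS]tuple0 [RHS]tuple0.
have mc u : measurable_fun [set: n.-tuple T] (fun t => F (tuple_cons (u, t))).
  apply: measurableT_comp mF _.
  exact: (measurable_cons (f := cst u) (g := id)).
have mG : measurable_fun [set: T] (fun u => \int[power_prob P n]_t F (tuple_cons (u, t))).
  apply: (@measurable_fun_fubini_tonelli_F _ _ _ _ _ (power_prob P n) (F \o @tuple_cons _ _ n)).
    by apply: measurableT_comp mF _; exact: measurable_tuple_cons.
  by move=> ?; exact: F0.
rewrite !integral_power_probS//; last first.
  by apply: (measurableT_comp mF); exact: measurable_tmap.
under eq_integral => u _.
  under eq_integral => t _ do rewrite tmap_cons.
  rewrite (ih _ (fun t => F (tuple_cons (th 0%N u, t))))//.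
  over.
rewrite (pth 0%N _ mG)// => u; exact: integral_ge0.
Qed.

Lemma integral_prod_lty n (h : T -> R) : measurable_fun [set: T] h ->
  (forall u, (0 <= h u)%R) -> \int[P]_u (h u)%:E < +oo ->
  \int[power_prob P n]_t (\prod_(s < n) h (tnth t s))%:E < +oo.
Proof.
move=> mh h0 fin.
have mp k : measurable_fun [set: k.-tuple T] (fun t => (\prod_(s < k) h (tnth t s))%:E).
  apply/measurable_EFinP; apply: measurable_prod => s _.
  by apply: (measurableT_comp mh); exact: measurable_tnth.
have p0 k (t : k.-tuple T) : 0 <= (\prod_(s < k) h (tnth t s))%:E.
  by rewrite lee_fin prodr_ge0.
elim: n => [|n ih].
  rewrite (eq_integral (cst 1)); last by move=> t _; rewrite big_ord0.
  rewrite integral_cst// mul1e -ge0_fin_numE//; exact: (fin_num_measure (power_prob P 0) _ measurableT).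
rewrite integral_power_probS//.
pose I := \int[power_prob P n]_t (\prod_(s < n) h (tnth t s))%:E.
have -> : \int[P]_u \int[power_prob P n]_t
    (\prod_(s < n.+1) h (tnth (tuple_cons (u, t)) s))%:E = \int[P]_u (I * (h u)%:E).
  apply: eq_integral => u _; rewrite muleC /I -ge0_integralZl_EFin//; last exact: mp.
  apply: eq_integral => t _; rewrite -EFinM big_ord_recl tnth0; congr (_ * _)%:E.
  by apply: eq_bigr => s _; rewrite tnthS.
have I0 : 0 <= I by exact: integral_ge0.
have Ifin : I \is a fin_num by rewrite ge0_fin_numE.
rewrite ge0_integralZl//; first by rewrite lte_mul_pinfty// integral_ge0.
  exact/measurable_EFinP.
by move=> u _; rewrite lee_fin.
Qed.

End power_integrals.

(** * Truncation of tensors *)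

Section conjugation.
Context {R : realType} {K : scalars R}.
Hypothesis ok : scalars_ok K.
Implicit Types z w : K.

Lemma sconjM z w : sconj (z * w) = sconj z * sconj w.
Proof.
by apply: (sext ok); rewrite ?(sreJ ok) ?(simJ ok) ?(sreM ok) ?(simM ok) ?(sreJ ok) ?(simJ ok);
  ring.
Qed.

Lemma sconjN z : sconj (- z) = - sconj z.
Proof.
by apply: (sext ok); rewrite ?(sreJ ok) ?(simJ ok) ?(sreN ok) ?(simN ok) ?(sreJ ok) ?(simJ ok).
Qed.

Lemma sconj1 : sconj (1 : K) = 1.
Proof.
apply: (sext ok); rewrite ?(sreJ ok) ?(simJ ok)//.
by rewrite (sim1 ok) oppr0.
Qed.

Lemma sconj_walsh n k l : sconj (walsh K n k l) = walsh K n k l.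
Proof.
rewrite /walsh; apply: (big_ind (fun z : K => sconj z = z)).
- exact: sconj1.
- by move=> z w hz hw; rewrite sconjM hz hw.
- by move=> t _; case: (_ && _); rewrite ?expr0 ?expr1 ?sconjN sconj1.
Qed.

End conjugation.

Section sign_flips.
Context {R : realType} {K : scalars R}.
Hypothesis ok : scalars_ok K.
Variable M : model K.
Hypothesis wmeas : forall i, smeas (fun t : omega M => wvec t i).
Variable fl : omega M -> omega M.
Hypothesis mfl : measurable_fun [set: omega M] fl.
Hypothesis pfl : integral_preserving (haar M) fl.
Hypothesis flE : forall t i, wvec (fl t) i = (-1) ^+ (i != 0) * wvec t i.
Variable n : nat.
Implicit Types (x y : tensor K n) (t : n.-tuple (omega M)).

Definition flips (l s : nat) : omega M -> omega M := if bit s l then fl else id.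

Lemma Wvec_flip l k t : Wvec (tmap (flips l) t) (dec n k) = walsh K n k l * Wvec t (dec n k).
Proof.
rewrite !ffunE -big_split/=; apply: eq_bigr => s _; rewrite tnth_mktuple /flips.
have <- := dec_neq0 k s.
by case: (bit s l); rewrite ?flE ?andbT ?andbF ?expr0 ?mul1r.
Qed.

Lemma ffn_flip x l t : ffn x (tmap (flips l) t) =
  \sum_(k < 2 ^ n) walsh K n k l * (x (dec n k) * sconj (Wvec t (dec n k))).
Proof.
rewrite /ffn /tip sum_dec; apply: eq_bigr => k _.
by rewrite Wvec_flip (sconjM ok) (sconj_walsh ok) mulrCA.
Qed.

Definition trunc m x : tensor K n := \sum_(k < m) x (dec n k) *: tbasis K (dec n k).

Lemma truncE m x k : (m <= 2 ^ n)%N -> (k < 2 ^ n)%N ->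
  trunc m x (dec n k) = if (k < m)%N then x (dec n k) else 0.
Proof.
move=> mn kn; rewrite /trunc sum_ffunE; have [km|mk] := ltnP k m.
  rewrite (bigD1 (Ordinal km))//= big1 => [|j jk].
    by rewrite !ffunE eqxx addr0 -[LHS]/(_ * _) mulr1.
  rewrite !ffunE; case: eqP => [/(dec_inj kn (leq_trans (ltn_ord j) mn)) kj|_].
    by move: jk; rewrite -val_eqE/= kj eqxx.
  by rewrite -[LHS]/(_ * _) mulr0.
rewrite big1// => j _; rewrite !ffunE; case: eqP => [/(dec_inj kn (leq_trans (ltn_ord j) mn)) kj|_].
  by move: mk; rewrite kj leqNgt ltn_ord.
by rewrite -[LHS]/(_ * _) mulr0.
Qed.

Lemma ffn_trunc_flip m x l t : (m <= 2 ^ n)%N -> ffn (trunc m x) (tmap (flips l) t) =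
  \sum_(k < m) walsh K n k l * (x (dec n k) * sconj (Wvec t (dec n k))).
Proof.
move=> mn; rewrite ffn_flip.
rewrite (big_ord_widen _ (fun k => walsh K n k l * (x (dec n k) * sconj (Wvec t (dec n k)))) mn).
rewrite [RHS]big_mkcond/=; apply: eq_bigr => k _; rewrite truncE//.
by case: ifP => // _; rewrite mul0r mulr0.
Qed.

(** Each flip preserves the measure, so averaging over all of them reproduces the
    integral; this brings in the Walsh sums. *)
Lemma integral_sum_flips (c p : R) y : 0 <= c ->
  (\int[power_prob (haar M) n]_t
     (c * \sum_(l < 2 ^ n) smod (ffn y (tmap (flips l) t)) `^ p)%:E
   = (c * (2 ^ n)%:R)%:E * Eint M p y)%E.
Proof.
move=> c0; have mF := measurable_Eint ok wmeas p y.
have mth l s : measurable_fun [set: omega M] (flips l s) by rewrite /flips; case: ifP.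
have mFl l : measurable_fun [set: n.-tuple (omega M)]
    (fun t => (smod (ffn y (tmap (flips l) t)) `^ p)%:E).
  exact: (measurableT_comp mF (measurable_tmap (mth l))).
have F0 l t : (0 <= (smod (ffn y (tmap (flips l) t)) `^ p)%:E)%E by rewrite lee_fin powR_ge0.
under eq_integral => t _ do rewrite EFinM -sumEFin.
rewrite ge0_integralZl_EFin//; last 2 first.
- by move=> t _; exact: sume_ge0.
- by apply: emeasurable_sum => l _; exact: mFl.
rewrite EFinM -muleA; congr (_ * _)%E.
rewrite ge0_integral_sum//.
rewrite (eq_bigr (fun=> Eint M p y)) => [|l _]; last first.
  apply: (@integral_tmap _ _ _ (haar M) n (flips l) (fun t => (smod (ffn y t) `^ p)%:E)) => //.
    by move=> s; rewrite /flips; case: ifP.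
  by move=> t; rewrite lee_fin powR_ge0.
rewrite big_const_ord; elim: (2 ^ n)%N => [|k ih]; first by rewrite mul0e.
rewrite iterS ih -{1}[Eint M p y]mul1e -natr1 EFinD addrC.
by rewrite ge0_muleDl// lee_fin.
Qed.

Definition wabs (u : omega M) : R := smod (wvec u 0) + smod (wvec u 1).

Hypothesis wabs_lty : forall p : R, 0 < p ->
  (\int[haar M]_u (wabs u `^ p)%:E < +oo)%E.

Let wabs_ge0 u : 0 <= wabs u.
Proof. by rewrite addr_ge0// smod_ge0. Qed.

Let measurable_wabs (p : R) : measurable_fun [set: omega M] (fun u => wabs u `^ p).
Proof.
apply: (measurableT_comp (measurable_powR p)).
by apply: measurable_funD; apply: (smeas_smod ok).
Qed.

Let smod_ffn_le x t : smod (ffn x t) <= (\sum_i smod (x i)) * \prod_(s < n) wabs (tnth t s).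
Proof.
rewrite mulr_suml; apply: le_trans (ler_smod_sum ok _ _ _) _; apply: ler_sum => i _.
rewrite (smodM ok) (smodJ ok) ler_wpM2l ?(smod_ge0 ok)// ffunE.
have -> : smod (\prod_(s < n) wvec (tnth t s) (i s)) =
    \prod_(s < n) smod (wvec (tnth t s) (i s)).
  exact: (big_morph _ (smodM ok) (smod1 ok)).
apply: ler_prod => s _; rewrite (smod_ge0 ok)/= /wabs.
have [i0|i1] : i s = 0 \/ i s = 1.
- by case: (i s) => -[|[|//]] lt; [left|right]; apply: val_inj.
- by rewrite i0 lerDl (smod_ge0 ok).
- by rewrite i1 lerDr (smod_ge0 ok).
Qed.

(** |f_x(t)| is dominated by a product of functions of the single entries. *)
Lemma Eint_lty (p : R) x : 0 < p -> (Eint M p x < +oo)%E.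
Proof.
move=> p0; set C := (\sum_i smod (x i)) `^ p.
have prod_powR t : (\prod_(s < n) wabs (tnth t s)) `^ p = \prod_(s < n) wabs (tnth t s) `^ p.
  have [] : 0 <= \prod_(s < n) wabs (tnth t s) /\
    (\prod_(s < n) wabs (tnth t s)) `^ p = \prod_(s < n) wabs (tnth t s) `^ p.
    elim: (index_enum _) => [|s r [ih0 ih]]; first by rewrite !big_nil powR1.
    by rewrite !big_cons powRM// ih mulr_ge0.
  by [].
have Cle t : ((smod (ffn x t) `^ p)%:E <= C%:E * (\prod_(s < n) wabs (tnth t s) `^ p)%:E)%E.
  rewrite -EFinM lee_fin -prod_powR /C -powRM ?prodr_ge0 ?sumr_ge0//; last first.
    by move=> i _; exact: (smod_ge0 ok).
  apply: ge0_ler_powR; rewrite ?nnegrE ?(ltW p0) ?(smod_ge0 ok) ?mulr_ge0 ?prodr_ge0 ?sumr_ge0//.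
  by move=> i _; exact: (smod_ge0 ok).
have fin := integral_prod_lty n (measurable_wabs p) (fun u => powR_ge0 _ _) (wabs_lty p0).
have mprod : measurable_fun [set: n.-tuple (omega M)]
    (fun t => (\prod_(s < n) wabs (tnth t s) `^ p)%:E).
  apply/measurable_EFinP; apply: measurable_prod => s _.
  exact: (measurableT_comp (measurable_wabs p) (measurable_tnth s)).
have prod0 t : (0 <= (\prod_(s < n) wabs (tnth t s) `^ p)%:E)%E.
  by rewrite lee_fin prodr_ge0// => s _; exact: powR_ge0.
have C0 : 0 <= C by exact: powR_ge0.
apply: (@le_lt_trans _ _ (C%:E * \int[power_prob (haar M) n]_t
    (\prod_(s < n) wabs (tnth t s) `^ p)%:E)%E).
  rewrite -ge0_integralZl_EFin//; apply: ge0_le_integral => //.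
  - by move=> t _; rewrite lee_fin powR_ge0.
  - exact: (measurable_Eint ok wmeas).
  - exact: measurable_funeM.
rewrite lte_mul_pinfty ?lee_fin//.
Qed.

Variable s : R.
Hypotheses (s_gt0 : 0 < s) (s_le : s <= 14^-1).

(** [walsh_powR] holds at each point t for the values of f_x at the flips of t; then
    integrate.  With b = 0 the partial last term contributes U(a_m, 0) <= 0. *)
Lemma Eint_trunc m x : (m <= 2 ^ n)%N ->
  ((bell_lambda s)%:E * Eint M (2 + s) (trunc m x) <=
   (bell_kappa s)%:E * Eint M (2 + s) x)%E.
Proof.
move=> mn; have l0 := bell_lambda_gt0 s_gt0 s_le; have k1 := bell_kappa_ge1 s_gt0.
have k0 : 0 <= bell_kappa s := le_trans ler01 k1.
have q0 : 0 < (2 ^ n)%:R :> R by rewrite ltr0n expn_gt0.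
suff : ((bell_lambda s * (2 ^ n)%:R)%:E * Eint M (2 + s) (trunc m x) <=
    (bell_kappa s * (2 ^ n)%:R)%:E * Eint M (2 + s) x)%E.
  move: ((2 ^ n)%:R : R) q0 => q q0.
  by rewrite [bell_lambda s * q]mulrC [bell_kappa s * q]mulrC 2!EFinM -2!muleA lee_pmul2l.
rewrite -(integral_sum_flips _ _ (ltW l0)) -(integral_sum_flips _ _ k0).
have mS (c : R) y : measurable_fun [set: n.-tuple (omega M)]
   (fun t => (c * \sum_(l < 2 ^ n) smod (ffn y (tmap (flips l) t)) `^ (2 + s))%:E).
  apply/measurable_EFinP; apply: measurable_funM; first exact: measurable_cst.
  apply: measurable_sum => l.
  have mth u : measurable_fun [set: omega M] (flips l u) by rewrite /flips; case: ifP.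
  apply/measurable_EFinP.
  exact: (measurableT_comp (measurable_Eint ok wmeas (2 + s) y) (measurable_tmap mth)).
have S0 y t : 0 <= \sum_(l < 2 ^ n) smod (ffn y (tmap (flips l) t)) `^ (2 + s).
  by apply: sumr_ge0 => l _; exact: powR_ge0.
apply: ge0_le_integral => //.
  by move=> t _; rewrite lee_fin mulr_ge0// ltW.
move=> t _; rewrite lee_fin.
pose a k : K := x (dec n k) * sconj (Wvec t (dec n k)).
under eq_bigr do rewrite ffn_trunc_flip//.
under [X in _ <= _ * X]eq_bigr do rewrite ffn_flip.
move: mn; rewrite leq_eqVlt => /orP[/eqP ->|mn].
  by rewrite ler_wpM2r// ?(le_trans (bell_lambda_le1 s_gt0))// sumr_ge0// => l _; exact: powR_ge0.
apply: le_trans (le_trans _ (@walsh_powR R K ok s s_gt0 s_le n a m 0 mn)) _.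
  by rewrite ler_wpM2l ?(ltW l0)//; apply: ler_sum => l _; rewrite mulr0 addr0.
rewrite gerDr.
rewrite mulr_ge0_le0// ?(ltW q0)//; apply: (bellK_le0 ok s_gt0).
by rewrite (smod0 ok) smod_ge0.
Qed.

Lemma nrm_trunc m x : (m <= 2 ^ n)%N ->
  @nrm _ _ (Espace M n (2 + s)) (trunc m x) <=
  bell_kappa s / bell_lambda s * @nrm _ _ (Espace M n (2 + s)) x.
Proof.
move=> mn; have l0 := bell_lambda_gt0 s_gt0 s_le; have k1 := bell_kappa_ge1 s_gt0.
have p0 : 0 < 2 + s by rewrite addr_gt0.
set c := bell_kappa s / bell_lambda s.
have c1 : 1 <= c by rewrite ler_pdivlMr// mul1r (le_trans (bell_lambda_le1 s_gt0)).
have c0 : 0 <= c := le_trans ler01 c1.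
have fin y : exists2 r, 0 <= r & Eint M (2 + s) y = r%:E.
  have := Eint_lty y p0; have := Eint_ge0 M (2 + s) y.
  by case: (Eint M (2 + s) y) => [r r0 _|//|//]; exists r.
have [r r0 rE] := fin (trunc m x); have [q q0 qE] := fin x.
rewrite !Espace_nrmE// rE qE !poweR_EFin/=.
have := Eint_trunc x mn; rewrite rE qE -!EFinM lee_fin => h.
apply: (@le_trans _ _ (c `^ (2 + s)^-1 * q `^ (2 + s)^-1)).
  rewrite -powRM//; apply: ge0_ler_powR.
  - by rewrite invr_ge0 ltW.
  - by [].
  - exact: mulr_ge0.
  by rewrite /c mulrAC ler_pdivlMr// mulrC.
rewrite ler_wpM2r ?powR_ge0// -[leRHS]powRr1//.
by apply: ler_powR => //; rewrite invf_le1//; move: s_gt0; lra.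
Qed.

End sign_flips.

(** * The constant c_p *)

Section moment_product.
Variable R : realType.
Implicit Types x y z s m : R.

(** e^z - 1 <= z e^z, hence e^z - 1 - z <= z (e^z - 1), and the last factor is
    compared with z e^z or with z, according to the sign of z. *)
Lemma expR_quadratic z m : 1 <= m -> expR z <= m -> expR z <= 1 + z + z ^+ 2 * m.
Proof.
move=> m1 zm; have h : expR z * (1 - z) <= 1.
  rewrite -[X in _ <= X](expR0 R) -(subrr z) expRD ler_wpM2l ?expR_ge0//.
  exact: expR_ge1Dx.
have e1 := expR_ge1Dx z.
have [z0|z0] := leP 0 z.
  have : z * (expR z - 1) <= z * (z * m).
    rewrite ler_wpM2l//; apply: le_trans (_ : z * expR z <= _); last by rewrite ler_wpM2l.
    by move: h; lra.
  by move: h; rewrite expr2; lra.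
have : z ^+ 2 * 1 <= z ^+ 2 * m by rewrite ler_wpM2l// sqr_ge0.
have : - z * (expR z - 1) >= - z * z by rewrite ler_wpM2l ?oppr_ge0 ?(ltW z0)//; lra.
by move: h; rewrite expr2; lra.
Qed.

(** With y = ln x, u = s/(1+s) and p' = 2 - u, the left-hand side is
    x^2 (e^(s y) / p + e^(- u y) / p').  The terms of first order in y cancel since
    s / p = u / p', and the remainder is quadratic in s. *)
Lemma powR_pair_le x s : 0 <= x <= 2 -> 0 < s <= 1 ->
  x `^ (2 + s) / (2 + s) + x `^ ((2 + s) / (2 + s - 1)) / ((2 + s) / (2 + s - 1))
    <= x ^+ 2 + 8 * s ^+ 2.
Proof.
move=> /andP[x0 x2] /andP[s0 s1].
have p0 : 0 < 2 + s by rewrite addr_gt0.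
have p1 : 0 < 1 + s by rewrite addr_gt0.
have -> : 2 + s - 1 = 1 + s by lra.
set u := s / (1 + s).
have u0 : 0 < u by rewrite divr_gt0.
have us : u <= s by rewrite ler_pdivrMr// mulrDr mulr1 lerDl mulr_ge0// ltW.
have pE : (2 + s) / (1 + s) = 2 - u by rewrite /u; field; rewrite gt_eqF.
have q0 : 0 < 2 - u by rewrite -pE divr_gt0.
rewrite pE; have [->|xn0] := eqVneq x 0.
  by rewrite !powR0 ?gt_eqF// !mul0r addr0 expr0n/= add0r mulr_ge0// sqr_ge0.
have x_gt0 : 0 < x by rewrite lt_neqAle eq_sym xn0.
pose y := ln x; have xE : expR y = x by rewrite lnK.
have split r : x `^ (2 + r) = x ^+ 2 * expR (r * y).
  by rewrite /powR (negPf xn0) -/y mulrDl expRD expRM_natl xE.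
rewrite (split s) (split (- u)).
(* A common bound m for both exponentials: 2 if x >= 1, and 1/x otherwise, where x (ln x)^2 <= 4. *)
have [m [m1 ms mu mx]] : exists m, [/\ 1 <= m, expR (s * y) <= m, expR (- u * y) <= m
    & x ^+ 2 * (y ^+ 2 * m) <= 8].
  have [y0|y0] := leP 0 y.
    have y1 : y <= 1 by have := expR_ge1Dx y; rewrite xE; move: x2; lra.
    exists 2; split.
    - by rewrite ler1n.
    - by apply: le_trans x2; rewrite -xE ler_expR ler_piMl.
    - apply: (@le_trans _ _ 1); last by rewrite ler1n.
      by rewrite -(expR0 R) ler_expR mulNr oppr_le0 mulr_ge0// ltW.
    have h1 : x ^+ 2 <= 4.
      by rewrite (_ : 4 = 2 ^+ 2) ?lerXn2r ?nnegrE// -natrX.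
    have h2 : y ^+ 2 <= 1 by rewrite expr_le1.
    have -> : (8 : R) = 4 * (1 * 2) by lra.
    by rewrite ler_pM ?mulr_ge0 ?sqr_ge0// ler_wpM2r.
  exists (expR (- y)); split.
  - by rewrite -(expR0 R) ler_expR oppr_ge0 ltW.
  - rewrite ler_expR (@le_trans _ _ 0) ?oppr_ge0 ?(ltW y0)//.
    by rewrite mulr_ge0_le0 ?(ltW s0) ?(ltW y0).
  - rewrite ler_expR mulNr lerN2 -[leLHS]mul1r ler_wnM2r ?(ltW y0)//.
    exact: le_trans us s1.
  rewrite (_ : x ^+ 2 * _ = x * y ^+ 2); last first.
    by rewrite expRN xE; field; rewrite gt_eqF.
  apply: (@le_trans _ _ 4); last by rewrite ler_nat.
  have t0 : 0 <= - y / 2 by rewrite divr_ge0// oppr_ge0 ltW.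
  have h : - y / 2 <= expR (- y / 2).
    by apply: le_trans (expR_ge1Dx _); rewrite lerDr.
  have : (- y / 2) ^+ 2 <= expR (- y / 2) ^+ 2 by rewrite lerXn2r ?nnegrE ?expR_ge0.
  rewrite -expRM_natl (_ : 2 * (- y / 2) = - y); last by field.
  rewrite expRN xE -(ler_pM2l x_gt0) mulfV ?gt_eqF//.
  by rewrite expr2; lra.
have m0 : 0 <= m := le_trans ler01 m1.
have e1 := expR_quadratic m1 ms; have e2 := expR_quadratic m1 mu.
have x20 : 0 <= x ^+ 2 := sqr_ge0 x.
apply: (@le_trans _ _ (x ^+ 2 * ((1 + s * y + (s * y) ^+ 2 * m) / (2 + s)
    + (1 + - u * y + (- u * y) ^+ 2 * m) / (2 - u)))).
  by rewrite mulrDr; apply: lerD; rewrite -[leLHS]mulrA ler_wpM2l// ler_wpM2r// invr_ge0 ltW.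
have -> : (1 + s * y + (s * y) ^+ 2 * m) / (2 + s)
    + (1 + - u * y + (- u * y) ^+ 2 * m) / (2 - u)
    = 1 + (s ^+ 2 / (2 + s) + u ^+ 2 / (2 - u)) * (y ^+ 2 * m).
  rewrite -pE /u; field.
  by rewrite !gt_eqF.
rewrite mulrDr mulr1 lerD2l mulrCA.
have c1 : s ^+ 2 / (2 + s) + u ^+ 2 / (2 - u) <= s ^+ 2.
  have h1 : s ^+ 2 / (2 + s) <= s ^+ 2 / 2.
    by rewrite ler_wpM2l ?sqr_ge0// lef_pV2 ?posrE//; lra.
  have h2 : u ^+ 2 / (2 - u) <= s ^+ 2 / 2.
    have -> : u ^+ 2 / (2 - u) = s ^+ 2 / ((1 + s) * (2 + s)).
      by rewrite -pE /u; field; rewrite !gt_eqF.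
    rewrite ler_wpM2l ?sqr_ge0// lef_pV2 ?posrE ?mulr_gt0//.
    by have := sqr_ge0 s; rewrite expr2; lra.
  by move: h1 h2; lra.
rewrite [leRHS]mulrC; apply: ler_pM => //.
- by rewrite addr_ge0// divr_ge0 ?sqr_ge0// ltW.
- by rewrite mulr_ge0// mulr_ge0// sqr_ge0.
Qed.

End moment_product.

Section moment_constant.
Context {R : realType} {K : scalars R}.
Hypothesis ok : scalars_ok K.
Variable M : model K.
Hypothesis wmeas : forall i, smeas (fun t : omega M => wvec t i).
Notation X := (fun t : omega M => smod (wvec t ord0)).
Hypothesis X_le2 : {ae haar M, forall t, X t <= 2}.
Hypothesis X_sqr : (\int[haar M]_t (X t ^+ 2)%:E <= 1)%E.

Let X0 t : 0 <= X t. Proof. exact: (smod_ge0 ok). Qed.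

Let mX : measurable_fun [set: omega M] X.
Proof. exact: (smeas_smod ok). Qed.

Let mXr (r : R) : measurable_fun [set: omega M] (fun t => (X t `^ r)%:E).
Proof. exact/measurable_EFinP/(measurableT_comp (measurable_powR r)). Qed.

Let alphaE (r a : R) : (\int[haar M]_t (X t `^ r)%:E = a%:E)%E -> alpha M r = a `^ r^-1.
Proof.
move=> h; rewrite /alpha Lnorm.unlock.
rewrite (_ : (\int[haar M]_t _)%E = a%:E) ?poweR_EFin// -h.
by apply: eq_integral => t _; rewrite /emod gee0_abs// lee_fin.
Qed.

(** By Young's inequality c_p <= E|w_1|^p / p + E|w_1|^p' / p', and [powR_pair_le] is
    integrated with E|w_1|^2 <= 1. *)
Lemma cconst_le (s : R) : 0 < s <= 1 -> cconst M (2 + s) <= 1 + 8 * s ^+ 2.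
Proof.
move=> s01; have /andP[s0 s1] := s01.
set p := 2 + s; set q := p / (p - 1).
have p0 : 0 < p by rewrite addr_gt0.
have p1 : 0 < p - 1 by rewrite /p; move: s0; lra.
have q0 : 0 < q by rewrite divr_gt0.
pose A := (\int[haar M]_t (X t `^ p)%:E)%E; pose B := (\int[haar M]_t (X t `^ q)%:E)%E.
have A0 : (0 <= A)%E by apply: integral_ge0 => t _; rewrite lee_fin powR_ge0.
have B0 : (0 <= B)%E by apply: integral_ge0 => t _; rewrite lee_fin powR_ge0.
have AB : ((p^-1)%:E * A + (q^-1)%:E * B <= (1 + 8 * s ^+ 2)%:E)%E.
  rewrite -!ge0_integralZl_EFin ?invr_ge0 ?(ltW p0) ?(ltW q0)//; last 2 first.
  - by move=> t _; rewrite lee_fin powR_ge0.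
  - by move=> t _; rewrite lee_fin powR_ge0.
  have m2 : measurable_fun [set: omega M] (fun t => (X t ^+ 2)%:E).
    exact/measurable_EFinP/(measurable_funX 2 mX).
  rewrite -ge0_integralD//; last 4 first.
  - by move=> t _; rewrite -EFinM lee_fin mulr_ge0 ?powR_ge0// invr_ge0 ltW.
  - exact: measurable_funeM.
  - by move=> t _; rewrite -EFinM lee_fin mulr_ge0 ?powR_ge0// invr_ge0 ltW.
  - exact: measurable_funeM.
  apply: (@le_trans _ _ (\int[haar M]_t ((X t ^+ 2)%:E + (8 * s ^+ 2)%:E))%E).
    apply: ae_ge0_le_integral => //.
    - by move=> t _; rewrite -!EFinM -EFinD lee_fin addr_ge0 ?mulr_ge0 ?powR_ge0 ?invr_ge0 ?(ltW p0) ?(ltW q0).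
    - by apply: emeasurable_funD; exact: measurable_funeM.
    - by move=> t _; rewrite -EFinD lee_fin addr_ge0 ?sqr_ge0// mulr_ge0// sqr_ge0.
    - exact: emeasurable_funD.
    apply: filterS X_le2 => t X2 _; rewrite -!EFinM -!EFinD lee_fin.
    by rewrite mulrC [q^-1 * _]mulrC; apply: powR_pair_le => //; rewrite X0 X2.
  rewrite ge0_integralD//; last 2 first.
  - by move=> t _; rewrite lee_fin sqr_ge0.
  - by move=> t _; rewrite lee_fin mulr_ge0// sqr_ge0.
  rewrite EFinD leeD// integral_cst//.
  by rewrite [X in (_ * X <= _)%E](probability_setT (haar M)) mule1.
have pinv0 : 0 < p^-1 by rewrite invr_gt0.
have qinv0 : 0 < q^-1 by rewrite invr_gt0.
move: AB; rewrite -/A -/B.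
case AE : A A0 => [a||//] A0; last first.
  have Bn : ((q^-1)%:E * B != -oo)%E.
    by rewrite -ltNye (lt_le_trans _ (mule_ge0 _ B0)) ?ltNyr ?lee_fin ?(ltW qinv0).
  by rewrite gt0_muley ?lte_fin// addye// leye_eq.
case BE : B B0 => [b||//] B0; last first.
  by rewrite gt0_muley ?lte_fin// addey ?leye_eq.
rewrite -!EFinM -EFinD lee_fin => ab; apply: le_trans ab.
rewrite /cconst -/p -/q (alphaE AE) (alphaE BE).
rewrite !lee_fin in A0 B0.
have pq : p^-1 + q^-1 = 1 by rewrite /q invf_div; field; rewrite gt_eqF.
apply: le_trans (conjugate_powR (powR_ge0 _ _) (powR_ge0 _ _) p0 q0 pq) _.
rewrite -!powRrM !mulVf ?gt_eqF// !powRr1//.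
by rewrite mulrC [b / q]mulrC.
Qed.

End moment_constant.

(** * The sphere of C^2 *)

Section complex_sphere.
Variable R : realType.
Notation K := (complex_scalars R).
Notation C2 := ((measurableTypeR R * measurableTypeR R) *
  (measurableTypeR R * measurableTypeR R))%type.
Let ok := complex_scalars_ok R.

Lemma smeas_coord i : @smeas R K _ C2 (fun t => C2_coord t i).
Proof.
rewrite /C2_coord; case: (i == ord0); split => /=.
- exact: (measurableT_comp measurable_fst measurable_fst).
- exact: (measurableT_comp measurable_snd measurable_fst).
- exact: (measurableT_comp measurable_fst measurable_snd).
- exact: (measurableT_comp measurable_snd measurable_snd).
Qed.

Lemma measurable_C2_act U : measurable_fun [set: C2] (@C2_act R U).
Proof.
have h i : @smeas R K _ C2 (fun t => \sum_j U i j * C2_coord t j).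
  apply: (smeas_sum ok) => j; apply: (smeasM ok (f := fun=> U i j)).
    exact: (@smeas_cst R K _ _ (U i j)).
  exact: smeas_coord.
have [h1 h2] := h ord0; have [h3 h4] := h ord_max.
by apply: measurable_fun_pair; apply: measurable_fun_pair.
Qed.

Variable sigma : probability C2 R.
Hypothesis inv : invariant_on_sphere sigma.
Notation M := (complex_model sigma).

Lemma complex_wmeas i : smeas (fun t : omega M => @wvec R K M t i).
Proof.
apply: (smeasM ok (f := fun=> Complex (Num.sqrt 2) 0)); last exact: smeas_coord.
exact: (@smeas_cst R K _ _ (Complex (Num.sqrt 2) 0)).
Qed.

Lemma unitary_preserving (U : 'M[R[i]]_2) : U *m (map_mx (@conjc R) U)^T = 1%:M ->
  integral_preserving sigma (C2_act U).
Proof.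
move=> UU F mF F0; have [_ sigU] := inv.
transitivity (\int[pushforward sigma (C2_act U)]_u F u)%E.
  by rewrite (ge0_integral_pushforward (measurable_C2_act U))//.
apply: eq_measure_integral => [|mact A mA _]; first exact: measurable_C2_act.
exact: (sigU U UU A mA).
Qed.

Lemma sphere_ae : {ae sigma, forall t, C2_sphere t}.
Proof.
have mS : measurable (@C2_sphere R).
  rewrite (_ : @C2_sphere R = (fun t : C2 => t.1.1 ^+ 2 + t.1.2 ^+ 2 + (t.2.1 ^+ 2 + t.2.2 ^+ 2)) @^-1` [set 1])//.
  rewrite -[X in measurable X]setTI.
  have [h1 h2] := smeas_coord ord0; have [h3 h4] := smeas_coord ord_max.
  have mf : measurable_fun [set: C2] (fun t : C2 => t.1.1 ^+ 2 + t.1.2 ^+ 2 + (t.2.1 ^+ 2 + t.2.2 ^+ 2) : R).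
    apply: measurable_funD; apply: measurable_funD; exact: measurable_funX.
  exact: mf.
have [s1 _] := inv.
exists (~` @C2_sphere R); split; first exact: measurableC.
  by rewrite probability_setC// s1 subee.
by [].
Qed.

Definition flip_mx : 'M[R[i]]_2 := diag_mx (\row_j (-1) ^+ (j != 0)).
Definition swap_mx : 'M[R[i]]_2 := \matrix_(i, j) (i != j)%:R.

Lemma flip_unitary : flip_mx *m (map_mx (@conjc R) flip_mx)^T = 1%:M.
Proof.
apply/matrixP => i j; rewrite !mxE !big_ord_recl big_ord0 !mxE.
case: i => -[|[|//]] li; case: j => -[|[|//]] lj; rewrite /= ?expr0 ?expr1 ?mulr0n ?mulr1n ?mul0r ?mul1r ?add0r ?addr0//;
  apply: (sext ok) => /=; ring.
Qed.

Lemma swap_unitary : swap_mx *m (map_mx (@conjc R) swap_mx)^T = 1%:M.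
Proof.
apply/matrixP => i j; rewrite !mxE !big_ord_recl big_ord0 !mxE.
case: i => -[|[|//]] li; case: j => -[|[|//]] lj; rewrite /= ?mulr0n ?mulr1n ?mul0r ?mul1r ?add0r ?addr0//;
  apply: (sext ok) => /=; ring.
Qed.

Lemma C2_coord_act (U : 'M[R[i]]_2) t i :
  C2_coord (C2_act U t) i = \sum_j U i j * C2_coord t j.
Proof.
rewrite {1}/C2_coord /C2_act /C2_point; case: eqP => [->|i0] /=.
  by case: (\sum_j _).
have -> : i = ord_max by apply: val_inj; case: i i0 => -[|[|//]] li// i0; case: i0; apply: val_inj.
by case: (\sum_j _).
Qed.

Lemma flip_act t i : @wvec R K M (C2_act flip_mx t) i = (-1) ^+ (i != 0) * @wvec R K M t i.
Proof.
rewrite /= C2_coord_act !big_ord_recl big_ord0 !mxE [RHS]mulrCA; congr (_ * _).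
case: i => -[|[|//]] li; rewrite /= ?expr0 ?expr1 ?mulr0n ?mulr1n ?mul0r ?mul1r ?add0r ?addr0//.
Qed.

Lemma swap_act t : C2_coord (C2_act swap_mx t) ord0 = C2_coord t ord_max.
Proof.
rewrite C2_coord_act !big_ord_recl big_ord0 !mxE /= ?mulr0n ?mulr1n ?mul0r ?mul1r ?add0r ?addr0.
by congr C2_coord; apply: val_inj.
Qed.

Let w_sqr t (i : 'I_2) : smod (@wvec R K M t i) ^+ 2 =
  2 * (complex.Re (C2_coord t i) ^+ 2 + complex.Im (C2_coord t i) ^+ 2).
Proof.
have s2 : Num.sqrt 2 ^+ 2 = 2 :> R by rewrite sqr_sqrtr.
rewrite (smod_sqr ok) (sreM ok) (simM ok) /= !mul0r subr0 addr0.
by rewrite !exprMn s2 mulrDr.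
Qed.

Let w_sphere t : C2_sphere t ->
  smod (@wvec R K M t 0) ^+ 2 + smod (@wvec R K M t 1) ^+ 2 = 2.
Proof. by move=> tS; rewrite !w_sqr -mulrDr /= tS mulr1. Qed.

Let w_le2 t i : C2_sphere t -> smod (@wvec R K M t i) <= 2.
Proof.
move=> tS; rewrite -(@ler_pXn2r _ 2) ?nnegrE ?(smod_ge0 ok)//.
have /(congr1 (fun x : R => x <= 2)) := w_sphere tS; rewrite lexx.
have w0 := sqr_ge0 (smod (@wvec R K M t 0)); have w1 := sqr_ge0 (smod (@wvec R K M t 1)).
have [->|->] : i = 0 \/ i = 1.
- by case: i => -[|[|//]] li; [left|right]; apply: val_inj.
- by move=> h; have : smod (@wvec R K M t 0) ^+ 2 <= 2 by [move: h w1; lra]; rewrite [(2 : R) ^+ 2]expr2; lra.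
- by move=> h; have : smod (@wvec R K M t 1) ^+ 2 <= 2 by [move: h w0; lra]; rewrite [(2 : R) ^+ 2]expr2; lra.
Qed.

Lemma complex_w_le2 : {ae sigma, forall t, smod (@wvec R K M t ord0) <= 2}.
Proof. by apply: filterS sphere_ae => t; exact: w_le2. Qed.

Let mX2 i : measurable_fun [set: C2] (fun t => (smod (@wvec R K M t i) ^+ 2)%:E).
Proof.
apply/measurable_EFinP; apply: (measurable_funX 2); apply: (smeas_smod ok).
exact: complex_wmeas.
Qed.

Let X20 i t : (0 <= (smod (@wvec R K M t i) ^+ 2)%:E)%E.
Proof. by rewrite lee_fin sqr_ge0. Qed.

(** Exchanging the coordinates is unitary, so |w_1|^2 and |w_2|^2 have the same
    expectation, and they add up to 2 on the sphere. *)
Lemma complex_w_sqr : (\int[sigma]_t (smod (@wvec R K M t ord0) ^+ 2)%:E <= 1)%E.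
Proof.
pose I i := (\int[sigma]_t (smod (@wvec R K M t i) ^+ 2)%:E)%E.
have I1 : I 1%R = I 0%R.
  rewrite /I -(unitary_preserving swap_unitary (@mX2 0) (@X20 0)).
  apply: eq_integral => t _; rewrite !w_sqr; congr (2 * _)%:E.
  by rewrite [C2_coord _ 0]swap_act; congr (_ + _); congr (_ _ ^+ 2); congr C2_coord; apply: val_inj.
have I2 : (I 0%R + I 1%R = 2%:E)%E.
  rewrite /I -ge0_integralD//; try exact: mX2.
  have -> : (2%:E = \int[sigma]_t (2 : R)%:E)%E.
    by rewrite integral_cst// [X in (_ * X)%E](probability_setT sigma) mule1.
  apply: ge0_ae_eq_integral => //.
  - by apply: emeasurable_funD; exact: mX2.
  - by move=> t _; exact: adde_ge0.
  by apply: filterS sphere_ae => t tS _; rewrite -EFinD w_sphere.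
have I0 : (0 <= I 0%R)%E by exact: integral_ge0.
apply: (@le_trans _ _ (I 0%R)).
  rewrite le_eqVlt; apply/orP; left; apply/eqP; apply: eq_integral => u _.
  congr ((smod (@wvec R K M u _) ^+ 2)%:E); exact: val_inj.
move: I2; rewrite I1; case: (I 0) I0 => [r||]//.
move=> _ [rr]; rewrite lee_fin; lra.
Qed.

Lemma complex_wabs_lty (p : R) : 0 < p -> (\int[sigma]_t (@wabs R K M t `^ p)%:E < +oo)%E.
Proof.
move=> p0; apply: (@le_lt_trans _ _ (\int[sigma]_t ((4 `^ p)%:E))%E).
  apply: ae_ge0_le_integral => //.
  - by move=> t _; rewrite lee_fin powR_ge0.
  - apply/measurable_EFinP/(measurableT_comp (measurable_powR p)).
    by apply: measurable_funD; apply: (smeas_smod ok); exact: complex_wmeas.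
  apply: filterS sphere_ae => t tS _; rewrite lee_fin.
  have w0 : 0 <= @wabs R K M t by rewrite addr_ge0 ?(smod_ge0 ok).
  apply: ge0_ler_powR; rewrite ?nnegrE ?(ltW p0)// /wabs.
  by have := w_le2 0 tS; have := w_le2 1 tS; lra.
rewrite integral_cst// [X in (_ * X < _)%E](probability_setT sigma) mule1 ltry//.
Qed.

End complex_sphere.

(** * Complex scalars *)

Section tensor_truncation.
Context {R : realType} {K : scalars R}.
Variables (n : nat) (U : space K).
Variables (a : tensor K n -> U) (b : U -> tensor K n).
Hypothesis a_lin : forall (k : K) x y, a (k *: x + y) = k *: a x + a y.
Hypothesis b_lin : forall (k : K) x y, b (k *: x + y) = k *: b x + b y.
Hypothesis abK : forall x, b (a x) = x.

Let a0 : a 0 = 0.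
Proof. by have := a_lin (-1) 0 0; rewrite scaleN1r oppr0 addr0 scaleN1r addNr. Qed.

Lemma trunc_full (x : tensor K n) : trunc (2 ^ n) x = x.
Proof.
by apply/ffunP => i; have [k kn <-] := dec_surj i; rewrite truncE// kn.
Qed.

Lemma trunc_lin m (k : K) (x y : tensor K n) :
  trunc m (k *: x + y) = k *: trunc m x + trunc m y.
Proof.
rewrite /trunc scaler_sumr -big_split/=; apply: eq_bigr => l _.
by rewrite scalerA -scalerDl; congr (_ *: _); rewrite [LHS]ffunE [X in X + _]ffunE.
Qed.

Lemma image_trunc m (x : tensor K n) :
  \sum_(l < m) x (dec n l) *: a (tbasis K (dec n l)) = a (trunc m x).
Proof.
rewrite /trunc; elim: (index_enum _) => [|l r ih]; first by rewrite !big_nil a0.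
by rewrite !big_cons a_lin ih.
Qed.

Lemma trunc_local_basis (kappa : R) :
  (forall m x, (m <= 2 ^ n)%N -> nrm (a (trunc m x)) <= kappa * nrm (a x)) ->
  local_basis [set z | exists x, z = a x] kappa (2 ^ n)
    (fun l => a (tbasis K (dec n l))) (fun l z => b z (dec n l)).
Proof.
move=> bound; constructor.
- split; first by exists 0; rewrite a0.
  by move=> k _ _ [x ->] [y ->]; exists (k *: x + y); rewrite a_lin.
- by rewrite expn_gt0.
- by move=> l _; exists (tbasis K (dec n l)).
- by move=> l _ k x y _ _; rewrite b_lin [LHS]ffunE [X in X + _]ffunE.
- move=> l l' ln l'n; rewrite abK ffunE; congr (_%:R); congr (nat_of_bool _).
  by apply/eqP/eqP => [/(dec_inj ln l'n)//|->].
- by move=> _ [x ->]; rewrite image_trunc abK trunc_full.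
- by move=> m _ mn [x ->]; rewrite image_trunc abK; exact: bound.
Qed.

End tensor_truncation.

Section complex_conclusion.
Variable R : realType.
Notation K := (complex_scalars R).
Notation C2 := ((measurableTypeR R * measurableTypeR R) *
  (measurableTypeR R * measurableTypeR R))%type.
Let ok := complex_scalars_ok R.
Variables (rho : R) (sigma : probability C2 R) (eps : nat -> R -> R) (n N : nat -> nat).
Notation M := (complex_model sigma).
Notation U := (fun j => @lp_space R K (pj R n j) 'I_(N j)).
Variables (a : forall j, {linear Ej M n j -> U j}) (b : forall j, {linear U j -> Ej M n j}).
Hypothesis rho_gt0 : 0 < rho.
Hypothesis inv : invariant_on_sphere sigma.
Hypothesis hB : partB_complex a b rho eps.
Notation s j := ((n j)%:R `^ (- (3 / 4)) : R).

Let sc : sequence_conditions M n eps (DB M n). Proof. by case: hB. Qed.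
Let n0 j : (0 < n j)%N := seq_gt0 sc j.
Let s_gt0 j : 0 < s j. Proof. by rewrite powR_gt0// ltr0n. Qed.
Let p_gt1 j : 1 < pexp R (n j).
Proof. by apply: lt_le_trans (pexp_gt2 R (n j)); rewrite ltr1n. Qed.
Let wm := @complex_wmeas R sigma.
Let NE j (z : {ffun 'I_(N j) -> K^o}) :
  @nrm _ _ (U j) z = @wlp R K 'I_(N j) 1 (pexp R (n j)) z.
Proof. by rewrite /wlp mul1r. Qed.
Let nU j : normed (U j) := normed_wlp ok ltr01 (p_gt1 j) (@NE j).
Let sU j : seminormed_scaling (U j) := normed_scaling ok (nU j).
Let sE j : seminormed_scaling (Ej M n j).
Proof. by apply: (Espace_scaling ok wm); apply: lt_trans (p_gt1 j). Qed.
Let E_ge0 j (x : Ej M n j) : 0 <= nrm x.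
Proof. exact: (Espace_nrm_ge0 ok). Qed.
Let abK j (x : Ej M n j) : b j (a j x) = x.
Proof. by have [_ [h _ _] _] := hB; exact: h. Qed.
Let aZ j (k : K) (x : Ej M n j) : a j (k *: x) = k *: a j x.
Proof. exact: linearZ. Qed.
Let bZ j (k : K) (x : U j) : b j (k *: x) = k *: b j x.
Proof. exact: linearZ. Qed.

Lemma s_sqr_mul j : (n j)%:R * s j ^+ 2 = (n j)%:R `^ (- (1 / 2)).
Proof.
have nj : (n j)%:R != 0 :> R by rewrite pnatr_eq0 -lt0n.
rewrite -powR_mulrn ?powR_ge0// -powRrM -{1}[(n j)%:R]powRr1// -powRD; last first.
  by rewrite nj implybT.
by congr (_ `^ _); field.
Qed.

(** c_p <= 1 + 8 (p - 2)^2 <= e^(8 (p - 2)^2), and n (p - 2)^2 = n^(-1/2). *)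
Lemma cconst_pow_le j : s j <= 1 ->
  cconst M (pexp R (n j)) ^+ n j <= expR (8 * (n j)%:R `^ (- (1 / 2))).
Proof.
move=> s1.
have c0 : 0 <= cconst M (pexp R (n j)) by rewrite mulr_ge0 ?alpha_ge0.
have h : cconst M (pexp R (n j)) <= expR (8 * s j ^+ 2).
  apply: le_trans (expR_ge1Dx _).
  apply: (cconst_le ok wm (complex_w_le2 inv) (complex_w_sqr inv)).
  by rewrite s_gt0.
apply: le_trans (_ : expR (8 * s j ^+ 2) ^+ n j <= _).
  by rewrite lerXn2r ?nnegrE ?expR_ge0.
by rewrite -expRM_natl mulrCA s_sqr_mul.
Qed.

Let trunc_bound (j : nat) (cd : R) m (x : Ej M n j) : s j <= 14^-1 -> (m <= 2 ^ n j)%N ->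
  (@opnorm R K (Ej M n j) (U j) (a j) <= 1%:E)%E ->
  (@opnorm R K (U j) (Ej M n j) (b j) <= cd%:E)%E ->
  @nrm _ _ (U j) (a j (trunc m x)) <=
    bell_kappa (s j) / bell_lambda (s j) * cd * @nrm _ _ (U j) (a j x).
Proof.
move=> sj mn a1 bcd.
have h1 := opnorm_le ok (@sE j) (@sU j) (fun _ _ => I) (fun k x _ => @aZ j k x) a1.
have h2 := opnorm_le ok (@sU j) (@sE j) (fun _ _ => I) (fun k x _ => @bZ j k x) bcd.
apply: le_trans (h1 (trunc m x) Logic.I) _; rewrite mul1r.
have := nrm_trunc ok wm (measurable_C2_act (flip_mx R))
  (unitary_preserving inv (flip_unitary R)) (@flip_act R sigma)
  (complex_wabs_lty inv) (s_gt0 j) sj x mn.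
move/le_trans; apply; rewrite -[leRHS]mulrA ler_wpM2l//.
  rewrite divr_ge0 ?(ltW (bell_lambda_gt0 (s_gt0 j) sj))//.
  by rewrite (le_trans ler01)// bell_kappa_ge1.
by rewrite -{1}[x]abK; exact: h2.
Qed.

Let crude_bound j : exists C : R, forall m (x : Ej M n j), (m <= 2 ^ n j)%N ->
  @nrm _ _ (U j) (a j (trunc m x)) <= C * @nrm _ _ (U j) (a j x).
Proof.
have bd m : exists C : R, 0 <= C /\ forall z : U j, @nrm _ _ (U j) (a j (trunc m (b j z))) <= C * nrm z.
  have [|C C0 hC] := @wlp_linear_bounded R K ok 'I_(N j) 1 (pexp R (n j))
    ltr01 (p_gt1 j) _ (@NE j) (fun z => a j (trunc m (b j z))).
    by move=> k x z; rewrite !linearP trunc_lin linearP.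
  by exists C.
have [C hC] := choice bd.
exists (\sum_(m < (2 ^ n j).+1) C m) => m x; rewrite -ltnS => mn.
have [_ h] := hC m; have := h (a j x); rewrite abK => /le_trans; apply.
rewrite ler_wpM2r ?(nrm_ge0 ok (nU j))//.
rewrite (bigD1 (Ordinal mn))//= lerDl sumr_ge0// => i _.
by case: (hC i).
Qed.

Theorem Z_complex_good_bases :
  has_good_bases (Z_complex a b) /\ has_good_bases (dual (Z_complex a b)).
Proof.
have [_ [_ [C abC] abn] [delta [d01 d_cvg _ a1 bcd]]] := hB.
pose cd j := cconst M (pj R n j) ^+ n j / (1 - delta j).
have tau1 : 1 <= tau M by rewrite /= ler_pdivlMr// mul1r ler_nat.
have D2 j : 2 <= DB M n j by case: j => [|j] //=; rewrite le_max lexx.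
have DS j : alpha M (pj R n j) ^+ n j <= DB M n j.+1 by rewrite /= le_max lexx orbT.
have [_ adm _ _] := sc.
have C0 : 0 <= Num.max C 0 by rewrite le_max lexx orbT.
have bC j (z : U j) : @nrm _ _ (Ej M n j) (b j z) <= Num.max C 0 * nrm z.
  have [_ h] := abC j.
  exact: (opnorm_le_max ok (@sU j) (@sE j) _ (fun k x _ => @bZ j k x) h).
have aC j (x : Ej M n j) : @nrm _ _ (U j) (a j x) <= Num.max C 0 * nrm x.
  have [h _] := abC j.
  exact: (opnorm_le_max ok (@sE j) (@sU j) _ (fun k x _ => @aZ j k x) h).
apply: (@block_good_bases R K ok M n adm (Lambda_unbounded tau1 sc D2 DS) E_ge0
  (fun j => 'I_(N j)) (fun=> 1) (fun j => pexp R (n j)) (fun=> ltr01) p_gt1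
  (fun j => @nrm _ _ (U j)) NE
  (fun j => [set z | exists x, z = a j x]) (fun=> true) (Num.max C 0) (Num.max C 0) C0 C0 _
  (fun j => a j) (fun j => b j) _
  (fun j kappa => s j <= 14^-1 -> kappa <= bell_kappa (s j) / bell_lambda (s j) * cd j)).
- by move=> J; exists J.
- move=> j _; split; [| | |split].
  + by move=> k x y; rewrite linearP.
  + by move=> k x y; rewrite linearP.
  + exact: abK.
  + exact: aC.
  + exact: bC.
  + by [].
- move=> e e0; pose e' := Num.min 1 (e / 7).
  have e'0 : 0 < e' by rewrite lt_min ltr01 divr_gt0.
  have e'1 : e' <= 1 by rewrite ge_min lexx.
  have e'7 : e' <= e / 7 by rewrite ge_min lexx orbT.
  have e1_gt0 : 0 < 1 + e' by rewrite addr_gt0.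
  have [e2 e2_gt0 [e2_le hratio]] := bell_ratio_small e'0.
  have eta_gt0 : 0 < ln (1 + e') / 8 by rewrite divr_gt0// ln_gt0// ltrDl.
  have [J1 hJ1] := @powR_nat_small R (3 / 4) e2 (divr_gt0 (ltr0n _ 3) (ltr0n _ 4)) e2_gt0.
  have [J2 hJ2] := @powR_nat_small R (1 / 2) _ (divr_gt0 ltr01 (ltr0n _ 2)) eta_gt0.
  have d0 : 0 < e' / (1 + e') by rewrite divr_gt0.
  have /cvgrPdist_le/(_ _ d0)[J3 _ hJ3] := d_cvg.
  exists (maxn J1 (maxn J2 J3)) => j kappa; rewrite !geq_max => /andP[jJ1 /andP[jJ2 jJ3]].
  have sj := hJ1 (n j) (leq_trans jJ1 (seq_ge sc j)).
  have s14 := le_trans sj e2_le.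
  move=> /(_ s14)/le_trans; apply.
  have ratio_le := hratio _ (s_gt0 j) sj.
  have ratio0 : 0 <= bell_kappa (s j) / bell_lambda (s j).
    rewrite divr_ge0 ?(ltW (bell_lambda_gt0 (s_gt0 j) s14))//.
    by rewrite (le_trans ler01)// bell_kappa_ge1.
  have cpow : cconst M (pj R n j) ^+ n j <= 1 + e'.
    apply: le_trans (cconst_pow_le (le_trans s14 _)) _.
      by rewrite invf_le1// ler1n.
    rewrite -[leRHS]lnK ?posrE// ler_expR mulrC -ler_pdivlMr//.
    exact: hJ2 (n j) (leq_trans jJ2 (seq_ge sc j)).
  have cpow0 : 0 <= cconst M (pj R n j) ^+ n j.
    by rewrite exprn_ge0// mulr_ge0 ?alpha_ge0.
  have /andP[dj0 dj1] := d01 j.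
  have dinv : (1 - delta j)^-1 <= 1 + e'.
    have := hJ3 j jJ3; rewrite sub0r normrN gtr0_norm// ler_pdivlMr// => dj.
    rewrite -[leLHS]mul1r ler_pdivrMr ?subr_gt0// mulrBr mulr1.
    by move: dj; rewrite mulrC; lra.
  have dinv0 : 0 <= (1 - delta j)^-1 by rewrite invr_ge0 subr_ge0 ltW.
  apply: (@le_trans _ _ ((1 + e') * ((1 + e') * (1 + e')))).
    apply: ler_pM => //; first exact: mulr_ge0.
    exact: ler_pM.
  have e'2 : e' * e' <= e' by rewrite ler_piMl// ltW.
  have e'3 : e' * (e' * e') <= e' * e' by rewrite ler_wpM2l// ltW.
  by rewrite ler_pdivlMr// in e'7; nra.
- move=> j; have [sj|sj] := leP (s j) 14^-1.
    exists (bell_kappa (s j) / bell_lambda (s j) * cd j), (2 ^ n j)%N,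
      (fun l => a j (tbasis K (dec (n j) l))), (fun l z => b j z (dec (n j) l)).
    split=> //; apply: trunc_local_basis.
    + by move=> k x y; rewrite linearP.
    + by move=> k x y; rewrite linearP.
    + exact: abK.
    + by move=> m x mn; apply: trunc_bound.
  have [C' hC'] := crude_bound j.
  exists C', (2 ^ n j)%N,
      (fun l => a j (tbasis K (dec (n j) l))), (fun l z => b j z (dec (n j) l)).
  split; last by [].
  apply: trunc_local_basis.
  + by move=> k x y; rewrite linearP.
  + by move=> k x y; rewrite linearP.
  + exact: abK.
  + by move=> m x mn; apply: hC'.
have C1 : 0 <= 1 + rho / 2 by rewrite addr_ge0// divr_ge0// ltW.
move=> x; rewrite /Z_complex.
apply: iff_trans (@diag_image_iff R K ok U nU (fun _ _ => Logic.I)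
  (fun j z => a j (b j z)) _ C1 _ _ x) _.
- move=> j z; apply: (opnorm_le ok (@sU j) (@sU j) _ _ (abn j)) => // k y _.
  by rewrite bZ aZ.
- by move=> j z; rewrite abK.
- split=> -[mx h]; split=> // j; first by exists (b j (x j)); rewrite h.
  by have [y xE] := h j; rewrite xE abK.
Qed.

End complex_conclusion.

(** * The theorem *)

Theorem corollary5p2 (R : realType) (rho : R) (rho_gt0 : 0 < rho) :
  [/\ (forall (eps : nat -> R -> R) (n : nat -> nat),
         @is_epsilon R (real_scalars R) eps -> partB_real n rho eps ->
         has_good_bases (Z_real R n) /\ has_good_bases (dual (Z_real R n))),
      (forall (sigma : probability
                 ((measurableTypeR R * measurableTypeR R) *
                  (measurableTypeR R * measurableTypeR R))%type R)
              (eps : nat -> R -> R) (n N : nat -> nat)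
              (a : forall j, {linear Ej (complex_model sigma) n j ->
                     @lp_space R (complex_scalars R) (pj R n j) 'I_(N j)})
              (b : forall j,
                     {linear @lp_space R (complex_scalars R) (pj R n j) 'I_(N j) ->
                      Ej (complex_model sigma) n j}),
         invariant_on_sphere sigma ->
         @is_epsilon R (complex_scalars R) eps -> partB_complex a b rho eps ->
         has_good_bases (Z_complex a b) /\ has_good_bases (dual (Z_complex a b))) &
      (forall (eps : nat -> R -> R) (n : nat -> nat),
         @is_epsilon R (real_scalars R) eps -> partC n rho eps ->
         [/\ has_good_bases (QX R n), has_good_bases (dual (QX R n)),
             has_good_bases (IQX R n) & has_good_bases (dual (IQX R n))])].
Proof.
split.
- by move=> eps n _; exact: Z_real_good_bases.
- move=> sigma eps n N a b inv _; exact: (Z_complex_good_bases rho_gt0 inv).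
move=> eps n _ hC.
by have [? ?] := QX_good_bases rho_gt0 hC; have [? ?] := IQX_good_bases rho_gt0 hC.
Qed.
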